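(* Suppose that conditions (C1), (C2) and (C3) (stated in the context) hold. For fixed $l\in\mathbb{N}$, there exists a unique probability measure $\mathbf{Q}_{(l)}$ on $\mathfrak{N}^{\circ}(\mathbb{R})$ such that for every $\mu\in\mathfrak{N}^{\circ}(\mathbb{R})$, $$\mathbb{P}_{\mu}(Z_n\in\cdot\mid N_{n+l}>0)\longrightarrow\mathbf{Q}_{(l)}(\cdot)\quad\text{weakly as } n\to\infty.$$ Moreover, if $L_{\mathbf{Q}_{\rm min}}$ denotes the Laplace functional of the Yaglom limit $\mathbf{Q}_{\rm min}$, then the Laplace functional of $\mathbf{Q}_{(l)}$ is $$L_{\mathbf{Q}_{(l)}}[h]=\frac{L_{\mathbf{Q}_{\rm min}}[h]-L_{\mathbf{Q}_{\rm min}}\big[h-\log f_l(0)\big]}{m^{l}},\quad h\in\mathcal{B}_b^+(\mathbb{R}).$$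
   Context: Let $\mathbb{N}=\{0,1,2,\dots\}$. Let $p=\{p_j\}_{j\in\mathbb{N}}$ be a probability measure on $\mathbb{N}$ (offspring distribution) with mean $m=\sum_j jp_j$ and generating function $f(s)=\sum_jp_js^j$; $f_0(s)=s$, $f_n=f\circ f_{n-1}$. Let $P$ be a transition probability (Markov kernel) on $\mathbb{R}$, with $n$-step transition probability $P_n$; write $P_nh(x)=\int h(y)P_n(x,\mathrm{d}y)$. $\mathfrak{N}(\mathbb{R})$ is the space of finite integer-valued Borel measures (finite point measures) on $\mathbb{R}$ with the topology of weak convergence, $\mathbf{0}$ the null measure, $\mathfrak{N}^{\circ}(\mathbb{R})=\mathfrak{N}(\mathbb{R})\setminus\{\mathbf{0}\}$. $\mathcal{B}_b^+(\mathbb{R})$ is the set of bounded nonnegative Borel functions on $\mathbb{R}$. Branching Markov chain: under $\mathbb{P}_{\delta_x}$, generation $0$ consists of one particle at $x$. Each particle of generation $n$, independently of the others of its generation, is replaced after one unit of time by a random number of children with law $p$; given that the parent is at $y$, the children are positioned independently according to $P(y,\cdot)$; they form generation $n+1$. For $\mu=\sum_i\delta_{x_i}\in\mathfrak{N}^\circ(\mathbb{R})$, under $\mathbb{P}_\mu$ the system is the union of independent branching Markov chains started from single particles at the $x_i$. $Z_n$ is the counting measure on $\mathbb{R}$ of the positions of the particles of generation $n$, and $N_n=Z_n(\mathbb{R})$. Conditions. (C1): $0<m<1$ and $p$ has finite moments of all orders. (C2): $\limsup_{n\to\infty}(p_n)^{1/n}\in[0,1)$. (C3): there exists a probability measure $\pi$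 on $\mathbb{R}$ such that $P_nh(x)\to\pi(h):=\int h\,\mathrm{d}\pi$ as $n\to\infty$ for every $x\in\mathbb{R}$ and every $h\in\mathcal{B}_b^+(\mathbb{R})$. Yaglom limit: under (C1)–(C3) there is a unique probability measure $\mathbf{Q}_{\rm min}$ on $\mathfrak{N}^{\circ}(\mathbb{R})$ such that $\mathbb{P}_\mu(Z_n\in\cdot\mid N_n>0)\to\mathbf{Q}_{\rm min}$ weakly as $n\to\infty$ for every $\mu\in\mathfrak{N}^\circ(\mathbb{R})$. Laplace functional of a probability measure $\mathbf{Q}$ on $\mathfrak{N}(\mathbb{R})$ (or $\mathfrak{N}^\circ(\mathbb{R})$): $L_{\mathbf{Q}}[h]=\int\mathrm{e}^{-\mu(h)}\,\mathbf{Q}(\mathrm{d}\mu)$, $\mu(h)=\int h\,\mathrm{d}\mu$. For $l=0$ one has $f_0(0)=0$, and $L_{\mathbf{Q}_{\rm min}}[h-\log 0]$ is understood as $L_{\mathbf{Q}_{\rm min}}[+\infty]=0$. *)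

(* Defs.v *)
From HB Require Import structures.
From mathcomp Require Import all_boot all_order all_algebra.
From mathcomp Require Import all_classical all_reals all_analysis.

Set Implicit Arguments.
Unset Strict Implicit.
Unset Printing Implicit Defensive.

Import Order.TTheory GRing.Theory Num.Theory.
Import numFieldNormedType.Exports.

Local Open Scope classical_set_scope.
Local Open Scope ring_scope.

Section point_measures.
Variable R : realType.

(* Finiteness is part of [pmeasure_nat], since the total mass is a natural
   number.  Library measures are functions on all subsets, so two equal Borel
   measures may differ, as terms, on non-measurable sets; the topology below
   does not separate such terms, hence neither does its Borel sigma-algebra. *)
Record pmeasure := PMeasure {
  pmeasure_val :> {measure set (measurableTypeR R) -> \bar R} ;
  pmeasure_nat : forall A, measurable A ->
    exists k : nat, pmeasure_val A = k%:R%:E }.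

Program Definition pmeasure_of_seq (s : seq R) : pmeasure :=
  @PMeasure (msum (fun i => \d_(nth 0 s i : measurableTypeR R)) (size s)) _.
Next Obligation.
move=> s A _; exists (\sum_(i < size s) (nth 0%R s i \in A))%N.
rewrite /= /msum natr_sum -sumEFin; apply: eq_bigr => i _.
by rewrite /= diracE.
Qed.

HB.instance Definition _ := gen_eqMixin pmeasure.
HB.instance Definition _ := gen_choiceMixin pmeasure.

Definition cbfun : set (R -> R) := [set f | continuous f /\ bounded_fun f].

Definition integral_cbfun (mu : pmeasure) : {ptws cbfun -> R} :=
  fun f => (\int[mu]_x (set_val f) x)%R.

(* The topology of weak convergence: the coarsest one making
   [mu |-> \int f d mu] continuous for every bounded continuous [f]. *)
HB.instance Definition _ :=
  Topological.copy pmeasure (initial_topology integral_cbfun).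

Definition nonnull : set pmeasure := [set mu | mu setT != 0%E].

Definition pmeasure0 : Type := nonnull.

HB.instance Definition _ := Topological.copy pmeasure0 (set_type nonnull).

Lemma nonnull_point : pmeasure_of_seq [:: 0] \in nonnull.
Proof.
by rewrite inE /nonnull /= /msum big_ord1 /= diracE in_setT onee_eq0.
Qed.

HB.instance Definition _ := isPointed.Build pmeasure0
  (exist _ (pmeasure_of_seq [:: 0]) nonnull_point : nonnull).

Definition pmeasure0_val (mu : pmeasure0) : pmeasure := set_val mu.

Definition borel_pmeasure0 := g_sigma_algebraType (@open pmeasure0).

End point_measures.

Section laws.
Variable R : realType.
Local Open Scope ereal_scope.

Definition weak_cvg (Q_ : nat -> set (borel_pmeasure0 R) -> \bar R)
    (Q : set (borel_pmeasure0 R) -> \bar R) : Prop :=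
  forall F : pmeasure0 R -> R, continuous F -> bounded_fun F ->
  \int[Q_ n]_mu (F mu)%:E @[n --> \oo] --> \int[Q]_mu (F mu)%:E.

(* The argument is extended-valued, with [expeR -oo = 0]. *)
Definition laplace (Q : set (borel_pmeasure0 R) -> \bar R) (h : R -> \bar R) :
    \bar R :=
  \int[Q]_mu expeR (- \int[pmeasure0_val mu]_x h x).

Definition Bbp : set (R -> R) :=
  [set h : R -> R | [/\ measurable_fun setT h, forall x, (0 <= h x)%R & bounded_fun h]].

End laws.

Section offspring.
Variables (R : realType) (p : probability nat R).

Definition offspring_prob (j : nat) : R := fine (p [set j]).

Definition mean : \bar R :=
  (\sum_(0 <= j <oo) (j%:R * offspring_prob j)%:E)%E.

Definition genfun (s : R) : R :=
  limn (series (fun j => offspring_prob j * s ^+ j)).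

Definition genfun_iter (n : nat) : R -> R := iter n genfun.

Definition condC1 : Prop :=
  [/\ (0 < mean)%E, (mean < 1)%E &
      forall k : nat,
        (\sum_(0 <= j <oo) (j%:R ^+ k * offspring_prob j)%:E < +oo)%E].

(* The term of index [0] does not affect the limit superior. *)
Definition condC2 : Prop :=
  (0 <= limn_esup (fun n => (offspring_prob n `^ n%:R^-1)%:E) < 1)%E.

End offspring.

Section kernel.
Variables (R : realType).
Variable P : R.-pker (measurableTypeR R) ~> (measurableTypeR R).

Fixpoint nstep (n : nat) : R.-spker (measurableTypeR R) ~> (measurableTypeR R) :=
  if n is n'.+1 then mkcomp_noparam P (nstep n')
  else kdirac (@measurable_id _ (measurableTypeR R) setT).

Definition condC3 : Prop :=
  exists pi : probability (measurableTypeR R) R,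
  forall (x : R) (h : R -> R), Bbp h ->
  (\int[nstep n x]_y (h y)%:E @[n --> \oo] --> \int[pi]_y (h y)%:E)%E.

End kernel.

(* Particles carry Ulam-Harris labels: the [i]-th child of [u] is [i :: u].
   The empty label is not a particle but a virtual parent of the initial ones,
   so that generation [n] consists of labels of length [n.+1].
   [nchild u] and [pos u] are the number of children and the position of [u];
   their values are irrelevant when [u] is never born. *)
Section branching.
Variables (R : realType) (p : probability nat R).
Variable P : R.-pker (measurableTypeR R) ~> (measurableTypeR R).
Variables (d : measure_display) (Omega : measurableType d).
Variables (nchild : seq nat -> Omega -> nat) (pos : seq nat -> Omega -> R).

Definition children (w : Omega) (s : seq (seq nat)) : seq (seq nat) :=
  flatten [seq [seq i :: u | i <- iota 0 (nchild u w)] | u <- s].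

Definition generation (n : nat) (w : Omega) : seq (seq nat) :=
  iter n.+1 (children w) [:: [::]].

Definition population (n : nat) (w : Omega) : pmeasure R :=
  pmeasure_of_seq [seq pos u w | u <- generation n w].

(* The sigma-algebra generated by the family tree and the positions of the
   particles up to generation [n]. *)
Definition history (n : nat) : set (set Omega) :=
  <<s [set E | exists k (U : seq (seq nat)) (A : seq nat -> set R),
    [/\ (k <= n)%N, forall u, measurable (A u) &
        E = [set w | generation k w = U /\
                     forall u, u \in U -> A u (pos u w)]] ] >>.

(* Given the history up to generation [n], the litters of the particles of
   generation [n] are independent; the size of a litter has law [p] and, given
   its size, its members are independently distributed according to [P y],
   where [y] is the position of the parent. *)
Definition branching_property (Pr : probability Omega R) : Prop :=
  forall (n : nat) (E : set Omega) (U : seq (seq nat)) (k : seq nat -> nat)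
    (A : seq nat -> set R),
  history n E -> (forall u, measurable (A u)) ->
  Pr (E `&` [set w | generation n w = U /\
        forall u, u \in U -> nchild u w = k u /\
          forall i, (i < k u)%N -> A (i :: u) (pos (i :: u) w)]) =
  (\int[Pr]_(w in E `&` [set w | generation n w = U])
     \prod_(u <- U) (p [set k u] *
       \prod_(i < k u) P (pos u w) (A (val i :: u))))%E.

Record branching_markov_chain (Pr : pmeasure0 R -> probability Omega R) : Prop := {
  measurable_nchild : forall u, measurable_fun setT (nchild u) ;
  measurable_pos : forall u, measurable_fun setT (pos u) ;
  initial_state : forall mu : pmeasure0 R,
    {ae Pr mu, forall w A, measurable A ->
      population 0 w A = pmeasure0_val mu A} ;
  branching_step : forall mu : pmeasure0 R, branching_property (Pr mu) }.

Variable Pr : pmeasure0 R -> probability Omega R.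

Definition alive (k : nat) : set Omega := [set w | (0 < population k w setT)%E].

(* The conditional law of [population n] given survival up to generation [k]. *)
Definition cond_law (mu : pmeasure0 R) (n k : nat)
    (A : set (borel_pmeasure0 R)) : \bar R :=
  (Pr mu (alive k `&` population n @^-1` (@pmeasure0_val R @` A)) /
   Pr mu (alive k))%E.

Definition yaglom_limit (Q : probability (borel_pmeasure0 R) R) : Prop :=
  forall mu : pmeasure0 R, weak_cvg (fun n => cond_law mu n n) Q.

Definition future_survival_limit (l : nat)
    (Q : probability (borel_pmeasure0 R) R) : Prop :=
  forall mu : pmeasure0 R, weak_cvg (fun n => cond_law mu n (n + l)) Q.

End branching.

(* Main.v *)
Require Import Defs.
From HB Require Import structures.
From mathcomp Require Import all_boot all_order all_algebra.
From mathcomp Require Import all_classical all_reals all_analysis.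
From mathcomp Require Import measurable_realfun giry ring lra zify.

Set Implicit Arguments.
Unset Strict Implicit.
Unset Printing Implicit Defensive.

Import Order.TTheory GRing.Theory Num.Theory.
Import numFieldNormedType.Exports.

Local Open Scope classical_set_scope.
Local Open Scope ring_scope.

(** A population is handled as the list of its positions.  Let [V_n s] be the
    probability that the [n]-th generation issued from the list [s] lies in an
    event [A] which excludes the empty population.  By the second moment of [p],
    [V_n] is additive in [s] up to an error of order [m ^ (2n)], so that
    [w_n x = V_n [:: x] / m ^ n] satisfies [w_(n+1) = P w_n + O(m ^ n)].  The
    ergodicity of [P] then forces [w_n x] to converge to a number [c A] which
    does not depend on [x]; the convergence is uniform enough in [A] for [c] to
    be a measure, and Kolmogorov's estimate [q_(n+1) >= m q_n - M2 q_n ^ 2] of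
    the survival probabilities gives it positive mass.

    By the Markov property at time [n], a population started from [k] particles
    satisfies, with [s] ranging over lists of positions,
      [P (Z_n in A, N_(n+l) > 0) ~ k m ^ n \int_A (1 - f_l(0) ^ |s|) c(ds)].
    Hence the conditional laws converge setwise, and [Q_(l)] has the density
    [(1 - f_l(0) ^ |s|) / m ^ l] with respect to [Q_min = Q_(0)], which is the
    formula for its Laplace functional.

    Borel sets of point measures pull back to measurable sets of lists, so
    setwise convergence entails weak convergence.  Conversely the ordered atoms
    of a point measure depend measurably on it, and the indicators of boxes for
    these atoms are limits of continuous functions, whence the uniqueness of
    weak limits. *)

(** * Lists of positions *)

(** On lists, concatenation expresses the independence of the families of distinct ancestors, and a
    finite measure is determined by boxes, which decompose into the events of [branching_property].

    [V_n] fails to be additive only when two ancestors both have living descendants, since an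
    extinct family does not alter the list and [A] excludes the empty one. This has probability of
    order [m ^ (2n)], negligible against the scale [m ^ n].

    The remaining problem has two scales. Generation [n + k] issued from [x] is compared with the
    average of [w_n] under the [k]-step law of [P], with a scaled error of order [m ^ n] uniform in
    [k]. Letting [k] tend to infinity with [n] fixed turns this average into a [pi]-average, and
    only then does [n] grow. The [pi]-average does not involve [x] and the error does not involve
    [A]: the first fact makes the limit independent of [x], the second makes it countably additive.

    The mass under [c] of the density [1 - f_l(0) ^ |s|] is not computed from [c]: it is read off by
    taking the limit of the survival probability at time [n + l] in two ways, through the Markov
    property at time [n] and through a shift of [n]. *)

Section lists.
Variable R : realType.

(* Half-lines, because membership of the ordered atoms of a point measure in such
   a box is a condition on its distribution function. *)
Definition hbox (k : nat) (b : nat -> R) : set (seq R) :=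
  [set s | size s = k /\ forall i, (i < k)%N -> nth 0 s i <= b i].

Definition hboxes : set (set (seq R)) := [set A | A = set0 \/ exists k b, A = hbox k b].

HB.instance Definition _ := isPointed.Build (seq R) [::].

Definition plist := g_sigma_algebraType hboxes.
HB.instance Definition _ := Measurable.on plist.

Lemma measurable_hbox k b : measurable (hbox k b : set plist).
Proof. by apply: sub_sigma_algebra; right; exists k, b. Qed.

Lemma measurable_size_eq k : measurable ([set s | size s = k] : set plist).
Proof.
rewrite [X in measurable X](_ : _ = \bigcup_m hbox k (fun=> m%:R)).
  by apply: bigcup_measurable => m _; exact: measurable_hbox.
apply/seteqP; split => [s /= sk|s [m _ []//]].
(* The sum of the absolute values dominates every entry, so one natural bound serves for the whole
   list. *)
pose M := \sum_(i < k) `|nth 0 s i|.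
exists (Num.truncn M).+1 => //; split=> // i ik.
rewrite (le_trans (ler_norm _))// (@le_trans _ _ M)//; last first.
  by apply: ltW; rewrite truncnS_gt.
by rewrite /M (bigD1 (Ordinal ik))//= lerDl sumr_ge0.
Qed.

Lemma measurable_size : measurable_fun setT (size : plist -> nat).
Proof.
move=> _ Y _; rewrite setTI.
rewrite [X in measurable X](_ : _ = \bigcup_(k in Y) [set s | size s = k]).
  by apply: bigcup_measurable => k _; exact: measurable_size_eq.
by apply/seteqP; split => [s /= Ys|s [k Yk /= ->]//]; exists (size s).
Qed.

Lemma measurable_nth i :
  measurable_fun setT (fun s : plist => nth 0 s i : measurableTypeR R).
Proof.
apply: (measurability _ (RGenOInfty.measurableE R)) => _ [_ [x ->] <-].
rewrite setTI.
have -> : (fun s : plist => nth 0 s i) @^-1` `]x, +oo[ =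
    ~` [set s : plist | nth 0 s i <= x].
  apply/seteqP; split => s /=; rewrite in_itv/= andbT ltNge => /negP//.
apply: measurableC.
have -> : [set s : plist | nth 0 s i <= x] =
    \bigcup_k ([set s | size s = k] `&` [set s : plist | nth 0 s i <= x]).
  apply/seteqP; split => [s /= sx|s [k _ []//]].
  by exists (size s).
apply: bigcup_measurable => k _.
(* Beyond the length, [nth] returns the default [0], so that either all lists of length [k] satisfy
   the bound or none does, according to the sign of [x]. *)
have [ki|ik] := leqP k i.
  have [x0|x0] := leP 0 x.
    rewrite (_ : _ `&` _ = [set s | size s = k]); first exact: measurable_size_eq.
    apply/seteqP; split => [s []//|s /= sk]; split => //.
    by rewrite nth_default ?sk.
  rewrite (_ : _ `&` _ = set0)//; apply/seteqP; split => // s [/= sk].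
  by rewrite nth_default ?sk// leNgt x0.
rewrite (_ : _ `&` _ = \bigcup_m hbox k (fun j => if j == i then x else m%:R)).
  by apply: bigcup_measurable => m _; exact: measurable_hbox.
apply/seteqP; split => [s /= [sk sx]|s [m _ [sk h]]]; last first.
  by split => //; have := h _ ik; rewrite eqxx.
pose M := \sum_(i < k) `|nth 0 s i|.
exists (Num.truncn M).+1 => //; split=> // j jk.
case: eqP => [->//|_].
rewrite (le_trans (ler_norm _))// (@le_trans _ _ M)//; last first.
  by apply: ltW; rewrite truncnS_gt.
by rewrite /M (bigD1 (Ordinal jk))//= lerDl sumr_ge0.
Qed.

Lemma measurable_fun_plist d (T : measurableType d) (f : T -> plist) :
  (forall k, measurable (f @^-1` [set s | size s = k])) ->
  (forall i, measurable_fun setT (fun x => nth 0 (f x) i : measurableTypeR R)) ->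
  measurable_fun setT f.
Proof.
move=> ms mn; apply: (@measurability _ _ T plist setT f hboxes) => [//|] _ [_ [->|[k [b ->]]] <-].
  by rewrite preimage_set0 setI0.
rewrite setTI.
rewrite (_ : _ @^-1` _ = f @^-1` [set s | size s = k] `&`
   \bigcap_(i in [set i | (i < k)%N])
     ((fun x => nth 0 (f x) i) @^-1` [set` `]-oo, b i]])); last first.
  by apply/seteqP; split => [x /= [sk h]|x /= [sk h]]; split => // i ik;
    move: (h _ ik); rewrite /= in_itv.
apply: measurableI => //; apply: bigcap_measurableType.
by move=> i _; rewrite -[X in measurable X]setTI; apply: mn.
Qed.

Lemma setI_closed_hboxes : setI_closed hboxes.
Proof.
move=> A B [->|[k [b ->]]]; first by rewrite set0I; left.
move=> [->|[k' [b' ->]]]; first by rewrite setI0; left.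
have [<-|kk'] := eqVneq k k'; [right|left].
  exists k, (fun i => Num.min (b i) (b' i)).
  apply/seteqP; split => [s [[sk h] [_ h']]|s [sk h]].
    by split => // i ik; rewrite le_min h// h'.
  by split; split => // i /h; rewrite le_min => /andP[].
by apply/seteqP; split => // s [[sk _] [sk' _]]; move: kk'; rewrite -sk -sk' eqxx.
Qed.

Lemma plist_measure_unique (m1 m2 : {measure set plist -> \bar R}) :
  (forall k b, m1 (hbox k b) = m2 (hbox k b)) -> (m1 setT < +oo)%E ->
  forall A, measurable A -> m1 A = m2 A.
Proof.
move=> m12 m1oo A mA.
(* Boxes with a constant natural bound exhaust the lists; [pickle] enumerates the pairs of a length
   and a bound. *)
pose g (n : nat) := if (unpickle n : option (nat * nat)) is Some km
  then hbox km.1 (fun=> km.2%:R) else set0.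
have Gg n : hboxes (g n).
  by rewrite /g; case: unpickle => [km|]; [right; exists km.1, (fun=> km.2%:R)|left].
apply: (@measure_unique _ R plist hboxes g _ _ _ _ m1 m2) => //.
- exact: setI_closed_hboxes.
- apply/seteqP; split => // s _.
  pose M := \sum_(i < size s) `|nth 0 s i|.
  exists (pickle (size s, (Num.truncn M).+1)) => //; rewrite /g pickleK; split=> // j jk.
  rewrite (le_trans (ler_norm _))// (@le_trans _ _ M)//; last first.
    by apply: ltW; rewrite truncnS_gt.
  by rewrite /M (bigD1 (Ordinal jk))//= lerDl sumr_ge0.
- by move=> B [->|[k [b ->]]]; rewrite ?measure0.
- move=> n; apply: le_lt_trans m1oo; apply: le_measure; rewrite ?inE//.
  by have [->|[k [b ->]]] := Gg n => //; exact: measurable_hbox.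
Qed.

Lemma measurable_box k (B : nat -> set R) : (forall i, measurable (B i)) ->
  measurable ([set s | size s = k /\ forall i, (i < k)%N -> B i (nth 0 s i)] : set plist).
Proof.
move=> mB.
rewrite (_ : [set _ | _] = [set s | size s = k] `&`
   \bigcap_(i in [set i | (i < k)%N]) ((fun s : plist => nth 0 s i) @^-1` B i)).
  apply: measurableI; first exact: measurable_size_eq.
  apply: bigcap_measurableType => i _; rewrite -[X in measurable X]setTI.
  exact: (@measurable_nth i measurableT _ (mB i)).
by apply/seteqP; split => [x /= [sk h]|x /= [sk h]]; split.
Qed.

End lists.

Section list_functions.
Context {R : realType}.
Local Notation plist := (plist R).

(** Maps on lists are handled length by length: once the length is fixed, they become fixed
    expressions in the entries. *)
Lemma measurable_fun_nat_case d d' (T : measurableType d) (U : measurableType d')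
    (g : T -> nat) (f : nat -> T -> U) : measurable_fun setT g ->
  (forall k, measurable_fun setT (f k)) -> measurable_fun setT (fun x => f (g x) x).
Proof.
move=> mg mf _ Y mY; rewrite setTI.
rewrite (_ : _ @^-1` _ = \bigcup_k ((g @^-1` [set k]) `&` (f k @^-1` Y))).
  apply: bigcup_measurable => k _; apply: measurableI.
    by rewrite -[X in measurable X]setTI; exact: mg.
  by rewrite -[X in measurable X]setTI; exact: mf.
by apply/seteqP; split => [x /= Yx|x [k _ [/= -> ]]//]; exists (g x).
Qed.

Lemma measurable_cat :
  measurable_fun setT (fun ab : plist * plist => ab.1 ++ ab.2 : plist).
Proof.
have m1 : measurable_fun setT (fun ab : plist * plist => size ab.1).
  exact: (measurableT_comp (@measurable_size R)).
apply: measurable_fun_plist => [k|i].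
  rewrite -[X in measurable X]setTI.
  rewrite (_ : _ @^-1` _ =
    (fun ab : plist * plist => (size ab.1 + size ab.2)%N) @^-1` [set k]).
    apply: measurable_fun_addn => //; exact: (measurableT_comp (@measurable_size R)).
  by apply/seteqP; split => ab /=; rewrite size_cat.
pose F k (ab : plist * plist) : measurableTypeR R :=
  if (i < k)%N then nth 0 ab.1 i else nth 0 ab.2 (i - k).
rewrite (_ : (fun _ => _) = fun ab : plist * plist => F (size ab.1) ab); last first.
  by apply/funext => ab; rewrite nth_cat.
apply: (measurable_fun_nat_case m1) => k; rewrite /F.
by case: (i < k)%N; apply: (measurableT_comp (@measurable_nth R _)).
Qed.

Lemma measurable_seq1 : measurable_fun setT (fun x : measurableTypeR R => [:: x] : plist).
Proof.
apply: measurable_fun_plist => [k|[|i]] //.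
  have [->|k1] := eqVneq k 1%N.
    by rewrite (_ : _ @^-1` _ = setT)//; apply/seteqP.
  rewrite (_ : _ @^-1` _ = set0)//; apply/seteqP; split => // x /= /esym/eqP.
  by rewrite (negbTE k1).
exact: measurable_id.
Qed.

Lemma measurable_behead : measurable_fun setT (behead : plist -> plist).
Proof.
apply: measurable_fun_plist => [k|i]; last first.
  by under eq_fun do rewrite nth_behead; exact: measurable_nth.
rewrite (_ : _ @^-1` _ = (fun s : plist => (size s - 1)%N) @^-1` [set k]).
  rewrite -[X in measurable X]setTI; apply: measurable_fun_subn => //.
  exact: measurable_size.
by apply/seteqP; split => s /=; rewrite size_behead subn1.
Qed.

Lemma measurable_sum_list d (T : measurableType d) (h : measurableTypeR R -> \bar R)
    (f : T -> plist) :
  measurable_fun setT h -> measurable_fun setT f ->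
  measurable_fun setT (fun t => (\sum_(x <- f t) h x)%E).
Proof.
move=> mh mf.
pose F k t := (\sum_(i < k) h (nth 0%R (f t) i))%E.
rewrite (_ : (fun _ => _) = fun t => F (size (f t)) t).
  apply: (measurable_fun_nat_case (measurableT_comp (@measurable_size R) mf)) => k.
  apply: emeasurable_sum => i.
  exact: (measurableT_comp mh (measurableT_comp (@measurable_nth R i) mf)).
by apply/funext => t; rewrite (big_nth 0) big_mkord.
Qed.

End list_functions.

(** * The branching kernel on lists *)

Section litters.
Context {R : realType}.
Local Notation plist := (plist R).
Local Notation RR := (measurableTypeR R).
Local Open Scope ereal_scope.

(** A convolution for the monoid of lists: the law of the concatenation of two independent random
    lists. *)
Definition giry_cat (mu nu : giry plist R) : giry plist R :=
  giry_map measurable_cat (giry_prod (mu, nu)).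

Lemma integral_giry_cat (mu nu : giry plist R) (f : plist -> \bar R) :
  measurable_fun setT f -> (forall s, 0 <= f s) ->
  \int[giry_cat mu nu]_s f s = \int[mu]_a \int[nu]_b f (a ++ b).
Proof.
move=> mf f0; rewrite [LHS](giry_int_map measurable_cat)//.
rewrite [LHS]giry_int_prod1//=.
by apply: measurableT_comp => //; exact: measurable_cat.
Qed.

Lemma measurable_giry_cat d (T : measurableType d) (k1 k2 : T -> giry plist R) :
  measurable_fun setT k1 -> measurable_fun setT k2 ->
  measurable_fun setT (fun x => giry_cat (k1 x) (k2 x)).
Proof.
move=> mk1 mk2; apply: (measurableT_comp (measurable_giry_map measurable_cat)).
apply: (measurableT_comp measurable_giry_prod).
exact: measurable_fun_pair.
Qed.

Lemma measurable_integral_giry d d' (T : measurableType d) (U : measurableType d')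
    (k : T -> giry U R) (f : U -> \bar R) :
  measurable_fun setT k -> measurable_fun setT f -> (forall x, 0 <= f x) ->
  measurable_fun setT (fun x => \int[k x]_y f y).
Proof.
move=> mk mf f0; exact: (measurableT_comp (measurable_giry_int mf f0) mk).
Qed.

Lemma measurable_fun_cat_r (f : plist -> \bar R) (a : plist) :
  measurable_fun setT f -> measurable_fun setT (fun b : plist => f (a ++ b)).
Proof.
move=> mf; apply: (measurableT_comp mf).
have m2 : measurable_fun setT (fun b : plist => (a, b)).
  by apply: measurable_fun_pair => //; exact: measurable_cst.
exact: (measurableT_comp measurable_cat m2).
Qed.

Lemma measurable_integral_cat_r (nu : giry plist R) (f : plist -> \bar R) :
  measurable_fun setT f -> (forall x, 0 <= f x) ->
  measurable_fun setT (fun a : plist => \int[nu]_b f (a ++ b)).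
Proof.
move=> mf f0.
apply: (measurable_fun_fubini_tonelli_F (m2 := nu)
  (fun ab : plist * plist => f (ab.1 ++ ab.2))) => //=.
by apply: (measurableT_comp mf); exact: measurable_cat.
Qed.

End litters.

Section kernel_giry.
Context d d' (X : measurableType d) (Y : measurableType d') (R : realType).
Variable k : R.-spker X ~> Y.

(** Repackages the values of a kernel as points of the Giry space, so that map, product and bind
    apply to them. *)
Definition kernel_law (x : X) : set Y -> \bar R := k x.

HB.instance Definition _ x := Measure.copy (kernel_law x) (k x).

HB.instance Definition _ x :=
  Measure_isSubProbability.Build _ _ _ (kernel_law x) (sprob_kernel_le1 k x).

Lemma measurable_kernel_law :
  measurable_fun setT (fun x => kernel_law x : giry Y R).
Proof.
by apply: measurable_giry_codensity => // B mB; exact: measurable_kernel.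
Qed.

End kernel_giry.

Section reproduction.
Context {R : realType}.
Local Notation plist := (plist R).
Local Notation RR := (measurableTypeR R).
Local Open Scope ereal_scope.
Variables (p : probability nat R) (P : R.-pker RR ~> RR).

Definition child_law (x : RR) : giry plist R :=
  giry_map measurable_seq1 (kernel_law P x).

Lemma measurable_child_law : measurable_fun setT child_law.
Proof.
exact: (measurableT_comp (measurable_giry_map _) (measurable_kernel_law P)).
Qed.

Lemma integral_child_law (x : RR) (f : plist -> \bar R) :
  measurable_fun setT f -> (forall s, 0 <= f s) ->
  \int[child_law x]_s f s = \int[P x]_y f [:: y].
Proof. by move=> mf f0; rewrite [LHS](giry_int_map measurable_seq1). Qed.

Fixpoint litter_law (x : RR) (j : nat) : giry plist R :=
  if j is j'.+1 then giry_cat (child_law x) (litter_law x j')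
  else giry_ret ([::] : plist).

Lemma measurable_litter_law j : measurable_fun setT (litter_law ^~ j).
Proof.
elim: j => [|j ih]; first exact: measurable_cst.
by apply: measurable_giry_cat => //; exact: measurable_child_law.
Qed.

Lemma measurable_litter_law_nat x : measurable_fun setT (litter_law x).
Proof. by []. Qed.

Definition offspring_law (x : RR) : giry plist R :=
  giry_bind (p : giry nat R) (measurable_litter_law_nat x).

Lemma integral_offspring_law x (f : plist -> \bar R) :
  measurable_fun setT f -> (forall s, 0 <= f s) ->
  \int[offspring_law x]_s f s = \int[p]_j \int[litter_law x j]_s f s.
Proof. by move=> mf f0; rewrite [LHS]giry_int_bind. Qed.

Lemma measurable_offspring_law : measurable_fun setT offspring_law.
Proof.
apply: measurable_giry_codensity => // B mB.
rewrite (_ : (fun _ => _) = fun x => \int[p]_j litter_law x j B).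
  apply: (measurable_fun_fubini_tonelli_F (m2 := p)
    (fun xj : RR * nat => litter_law xj.1 xj.2 B)) => //=.
  pose F j (xj : RR * nat) := litter_law xj.1 j B.
  refine (@measurable_fun_nat_case _ _ (RR * nat)%type (\bar R) snd F measurable_snd _) => j.
  have mj := measurableT_comp (measurable_giry_ev mB) (measurable_litter_law j).
  exact: (measurableT_comp mj measurable_fst).
apply/funext => x.
have := @integral_offspring_law x (fun s => (\1_B s)%:E).
rewrite integral_indic// setIT => ->; last 2 first.
  exact/measurable_EFinP/measurable_indic.
  by move=> s; rewrite lee_fin.
by apply: eq_integral => j _; rewrite integral_indic// setIT.
Qed.

(** The one-step transition kernel of the branching Markov chain, on lists: each particle is
    replaced by its litter, independently and in order. *)
Fixpoint branch_law (s : seq R) : giry plist R :=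
  if s is x :: s' then giry_cat (offspring_law x) (branch_law s')
  else giry_ret ([::] : plist).

Lemma measurable_branch_law : measurable_fun setT (branch_law : plist -> _).
Proof.
(* The recursion is moved from the list to its length, so that for each length the law is a finite
   composition of measurable maps. *)
pose F := fix F k (s : plist) : giry plist R :=
  if k is k'.+1 then giry_cat (offspring_law (nth 0%R s 0)) (F k' (behead s))
  else giry_ret ([::] : plist).
rewrite (_ : branch_law = fun s : plist => F (size s) s).
  apply: (measurable_fun_nat_case (@measurable_size R)); elim=> [|k ih] /=.
    exact: measurable_cst.
  apply: measurable_giry_cat.
    exact: (measurableT_comp measurable_offspring_law (@measurable_nth R 0)).
  exact: (measurableT_comp ih measurable_behead).
by apply/funext; elim=> //= x s ->.
Qed.

Fixpoint generation_law (n : nat) (s : seq R) : giry plist R :=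
  if n is n'.+1 then giry_bind (generation_law n' s) measurable_branch_law
  else giry_ret (s : plist).

End reproduction.

#[global] Opaque giry_cat child_law offspring_law.

Section moments.
Context {R : realType}.
Local Notation plist := (plist R).
Local Notation RR := (measurableTypeR R).
Local Open Scope ereal_scope.
Variables (p : probability nat R) (P : R.-pker RR ~> RR).
Local Notation K := (branch_law p P).
Local Notation offs := (offspring_law p P).
Local Notation sz s := ((size s)%:R%:E : \bar R).

Lemma measurable_fun_size (phi : nat -> \bar R) :
  measurable_fun setT (fun s : plist => phi (size s)).
Proof. exact: (measurableT_comp (f := phi) _ (@measurable_size R)). Qed.

Lemma measurable_sz : measurable_fun setT (fun s : plist => sz s).
Proof. exact: (measurable_fun_size (fun n => n%:R%:E)). Qed.

Lemma integral_mass1 d (T : measurableType d) (mu : {measure set T -> \bar R}) c :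
  mu setT = 1 -> \int[mu]_x c = c.
Proof. by move=> mu1; rewrite integral_cst// mu1 mule1. Qed.

Lemma giryT_integral d (T : measurableType d) (mu : {measure set T -> \bar R}) :
  mu setT = \int[mu]_x 1.
Proof. by rewrite integral_cst// mul1e. Qed.

(** Points of [giry] are only sub-probabilities, so total mass one has to be propagated through each
    construction. *)
Lemma giry_cat_mass1 (mu nu : giry plist R) :
  mu setT = 1 -> nu setT = 1 -> giry_cat mu nu setT = 1.
Proof.
move=> mu1 nu1; rewrite giryT_integral integral_giry_cat//.
under eq_integral do rewrite integral_mass1//.
by rewrite integral_mass1.
Qed.

Lemma integral_ret_nil (f : plist -> \bar R) : measurable_fun setT f ->
  \int[giry_ret ([::] : plist)]_s f s = f [::].
Proof. exact: giry_int_ret. Qed.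

Lemma child_law_mass1 x : child_law P x setT = 1.
Proof. by rewrite giryT_integral integral_child_law// integral_mass1// prob_kernel. Qed.

Lemma litter_law_mass1 x j : litter_law P x j setT = 1.
Proof.
elim: j => [|j ih] /=; first by rewrite diracT.
exact: (giry_cat_mass1 (child_law_mass1 x) ih).
Qed.

Lemma offspring_law_mass1 x : offs x setT = 1.
Proof.
rewrite giryT_integral integral_offspring_law//.
under eq_integral => j _ do rewrite (integral_mass1 _ (litter_law_mass1 x j)).
by rewrite integral_mass1//; exact: probability_setT.
Qed.

Lemma branch_law_mass1 s : K s setT = 1.
Proof.
elim: s => [|x s ih] /=; first by rewrite diracT.
exact: (giry_cat_mass1 (offspring_law_mass1 x) ih).
Qed.

(** The branching property in kernel form; it rests on the associativity of concatenation. *)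
Lemma integral_branch_law_cat a b (f : plist -> \bar R) :
  measurable_fun setT f -> (forall s, 0 <= f s) ->
  \int[K (a ++ b)]_s f s = \int[K a]_s \int[K b]_t f (s ++ t).
Proof.
elim: a f => [|x a ih] f mf f0 /=.
  by rewrite integral_ret_nil//; exact: measurable_integral_cat_r.
rewrite integral_giry_cat// [RHS]integral_giry_cat//; last 2 first.
- exact: measurable_integral_cat_r.
- by move=> s; exact: integral_ge0.
apply: eq_integral => u _; rewrite ih//; last exact: measurable_fun_cat_r.
by apply: eq_integral => v _; apply: eq_integral => w _; rewrite catA.
Qed.

Lemma integral_branch_law1 x (f : plist -> \bar R) :
  measurable_fun setT f -> (forall s, 0 <= f s) ->
  \int[K [:: x]]_s f s = \int[offs x]_s f s.
Proof.
move=> mf f0; rewrite /= integral_giry_cat//; apply: eq_integral => a _.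
by rewrite integral_ret_nil ?cats0//; exact: measurable_fun_cat_r.
Qed.

Lemma integral_litter_size x j (phi : nat -> \bar R) : (forall n, 0 <= phi n) ->
  \int[litter_law P x j]_s phi (size s) = phi j.
Proof.
elim: j phi => [|j ih] phi phi0 /=.
  by rewrite integral_ret_nil//; exact: measurable_fun_size.
rewrite integral_giry_cat//; last exact: measurable_fun_size.
transitivity (\int[child_law P x]_a (fun n => phi (n + j)%N) (size a)).
  apply: eq_integral => a _.
  rewrite -(ih (fun n => phi (size a + n)%N))//.
  by apply: eq_integral => b _; rewrite size_cat.
rewrite integral_child_law//; last exact: (measurable_fun_size (fun n => phi (n + j)%N)).
by rewrite /= integral_mass1// prob_kernel.
Qed.

Lemma integral_offspring_size x (phi : nat -> \bar R) : (forall n, 0 <= phi n) ->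
  \int[offs x]_s phi (size s) = \int[p]_j phi j.
Proof.
move=> phi0; rewrite integral_offspring_law//; last exact: measurable_fun_size.
by apply: eq_integral => j _; rewrite integral_litter_size.
Qed.

Lemma measurable_esum_list (g : RR -> \bar R) : measurable_fun setT g ->
  measurable_fun setT (fun s : plist => \sum_(y <- s) g y).
Proof. by move=> mg; exact: (measurable_sum_list mg). Qed.

Lemma integral_litter_sum x j (g : RR -> \bar R) :
  measurable_fun setT g -> (forall y, 0 <= g y) ->
  \int[litter_law P x j]_s \sum_(y <- s) g y = j%:R%:E * \int[P x]_y g y.
Proof.
move=> mg g0; have msum := measurable_esum_list mg.
have sum0 (s : seq R) : 0 <= \sum_(y <- s) g y by rewrite sume_ge0.
elim: j => [|j ih].
  by rewrite /= integral_ret_nil//= big_nil mul0e.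
rewrite [litter_law _ _ _]/= integral_giry_cat//.
transitivity (\int[child_law P x]_a
    (\sum_(y <- a) g y + j%:R%:E * \int[P x]_y g y)).
  apply: eq_integral => a _; under [LHS]eq_integral => b _ do rewrite big_cat/=.
  by rewrite ge0_integralD// ih (integral_mass1 _ (litter_law_mass1 x j)).
rewrite ge0_integralD//; last by rewrite mule_ge0// integral_ge0.
rewrite integral_mass1; last exact: child_law_mass1.
rewrite integral_child_law//.
under [X in X + _]eq_integral => y _ do rewrite big_seq1.
by rewrite -[in RHS]natr1 EFinD ge0_muleDl ?lee_fin// mul1e addeC.
Qed.

(** The many-to-one formula for one step: by linearity, the dependence between siblings through the
    size of their litter does not matter. *)
Lemma integral_offspring_sum x (g : RR -> \bar R) :
  measurable_fun setT g -> (forall y, 0 <= g y) ->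
  \int[offs x]_s \sum_(y <- s) g y = (\int[p]_j j%:R%:E) * \int[P x]_y g y.
Proof.
move=> mg g0; have msum := measurable_esum_list mg.
rewrite integral_offspring_law//; last by move=> s; rewrite sume_ge0.
transitivity (\int[p]_j (j%:R%:E * \int[P x]_y g y)).
  by apply: eq_integral => j _; exact: integral_litter_sum.
by rewrite ge0_integralZr//; exact: integral_ge0.
Qed.

Lemma integral_branch_size s : \int[K s]_t sz t = (\int[p]_j j%:R%:E) * sz s.
Proof.
elim: s => [|x s ih].
  by rewrite /= integral_ret_nil ?mule0//; exact: measurable_sz.
have := @integral_branch_law_cat [:: x] s (fun t => sz t) measurable_sz.
rewrite cat1s => ->//.
transitivity (\int[K [:: x]]_a (sz a + (\int[p]_j j%:R%:E) * sz s)).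
  apply: eq_integral => a _; under [LHS]eq_integral => b _ do rewrite size_cat natrD EFinD.
  rewrite ge0_integralD//; [|exact: measurable_sz].
  by rewrite ih (integral_mass1 _ (branch_law_mass1 s)).
have mp0 : 0 <= \int[p]_j j%:R%:E :> \bar R.
  by apply: integral_ge0 => j _; rewrite lee_fin.
rewrite ge0_integralD//; [|exact: measurable_sz|by rewrite mule_ge0// lee_fin].
rewrite integral_branch_law1//; last exact: measurable_sz.
have -> : \int[offs x]_t sz t = \int[p]_j j%:R%:E :> \bar R.
  exact: (@integral_offspring_size x (fun n => n%:R%:E)).
rewrite (integral_mass1 _ (branch_law_mass1 _)).
by rewrite /= -[(size s).+1%:R]natr1 EFinD ge0_muleDr// mule1 addeC.
Qed.

End moments.

(** * Asymptotics of the generation laws *)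

Section almost_additivity.
Context {R : realType}.
Local Notation plist := (plist R).
Local Notation RR := (measurableTypeR R).
Local Open Scope ereal_scope.
Variables (p : probability nat R) (P : R.-pker RR ~> RR).
Local Notation K := (branch_law p P).
Local Notation offs := (offspring_law p P).
Local Notation sz s := ((size s)%:R%:E : \bar R).

Variables (m M2 : R).
Hypothesis pm : \int[p]_j j%:R%:E = m%:E.
Hypothesis pM2 : \int[p]_j (j%:R ^+ 2)%:E = M2%:E.

(* The branching step multiplies the cross term by [m ^ 2] for distinct ancestors,
   whereas siblings contribute the second moment of [p]. *)
Definition almost_additive (C : R) (V : plist -> \bar R) := forall a b,
  V (a ++ b) <= V a + V b + (C * (size a)%:R * (size b)%:R)%:E /\
  V a + V b <= V (a ++ b) + (C * (size a)%:R * (size b)%:R)%:E.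

Lemma mean_ge0 : (0 <= m)%R.
Proof. by rewrite -lee_fin -pm; apply: integral_ge0 => j _; rewrite lee_fin. Qed.

Lemma almost_additive_step C V : (0 <= C)%R -> measurable_fun setT V ->
  (forall s, 0 <= V s) -> almost_additive C V ->
  almost_additive (C * m ^+ 2)%R (fun s => \int[K s]_t V t).
Proof.
move=> C0 mV V0 aV a b.
(* [D] is the joint law of the independent families of [a] and [b]. Every term becomes an integral
   against it, and the expected cross term factorises into two mean sizes, whence [m ^ 2]. *)
pose D : giry (plist * plist)%type R := giry_prod (K a : giry plist R, K b : giry plist R).
pose S (z : plist * plist) := (C * (size z.1)%:R * (size z.2)%:R)%:E.
have S0 z : 0 <= S z by rewrite lee_fin !mulr_ge0.
have m1 : measurable_fun setT (V \o fst : plist * plist -> \bar R).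
  exact: measurableT_comp.
have m2 : measurable_fun setT (V \o snd : plist * plist -> \bar R).
  exact: measurableT_comp.
have mcat : measurable_fun setT (fun z : plist * plist => V (z.1 ++ z.2)).
  exact: (measurableT_comp mV measurable_cat).
have mS : measurable_fun setT S.
  apply/measurable_EFinP; apply: measurable_funM.
    apply: measurable_funM => //.
    apply: (measurableT_comp (f := fun n : nat => n%:R : RR)) => //.
    exact: (measurableT_comp (@measurable_size R)).
  apply: (measurableT_comp (f := fun n : nat => n%:R : RR)) => //.
  exact: (measurableT_comp (@measurable_size R)).
have EcatD : \int[K (a ++ b)]_t V t = \int[D]_z V (z.1 ++ z.2).
  by rewrite integral_branch_law_cat// [RHS]giry_int_prod1.
have E1 : \int[D]_z V z.1 = \int[K a]_t V t.
  rewrite [LHS]giry_int_prod1//; apply: eq_integral => x _.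
  by rewrite /giry_int/= (integral_mass1 _ (branch_law_mass1 p P b)).
have E2 : \int[D]_z V z.2 = \int[K b]_t V t.
  rewrite [LHS]giry_int_prod1// /giry_int/=.
  by rewrite (integral_mass1 _ (branch_law_mass1 p P a)).
have ES : \int[D]_z S z = (C * m ^+ 2 * (size a)%:R * (size b)%:R)%:E.
  rewrite [LHS]giry_int_prod1//.
  transitivity (\int[K a]_x ((C * m * (size b)%:R)%:E * sz x)).
    apply: eq_integral => x _; rewrite /giry_int.
    under eq_integral do rewrite /S/= EFinM.
    rewrite ge0_integralZl_EFin//; [|exact: measurable_sz|by rewrite mulr_ge0].
    rewrite integral_branch_size pm -!EFinM; congr EFin.
    by rewrite -!mulrA; congr (_ * _)%R; rewrite mulrC -!mulrA.
  rewrite ge0_integralZl_EFin//; [|exact: measurable_sz|by rewrite !mulr_ge0// mean_ge0].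
  rewrite integral_branch_size pm -!EFinM; congr EFin.
  by rewrite expr2 -!mulrA; congr (_ * (_ * _))%R; rewrite mulrC -!mulrA.
have m12 : measurable_fun setT (fun z : plist * plist => V z.1 + V z.2).
  exact: emeasurable_funD.
have ED12 : \int[D]_z (V z.1 + V z.2) = \int[D]_z V z.1 + \int[D]_z V z.2.
  exact: ge0_integralD.
have ge0_12 z : 0 <= V (z : plist * plist).1 + V z.2 by rewrite adde_ge0.
rewrite EcatD -E1 -E2 -ES -ED12; split.
  rewrite -ge0_integralD//; apply: ge0_le_integral => //.
    exact: emeasurable_funD.
  by move=> z _; have [] := aV z.1 z.2.
rewrite -ge0_integralD//; apply: ge0_le_integral => //.
  exact: emeasurable_funD.
by move=> z _; have [] := aV z.1 z.2.
Qed.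

Lemma linear_bound_step (c : R) (V : plist -> \bar R) : (0 <= c)%R -> measurable_fun setT V ->
  (forall s, 0 <= V s <= (c * (size s)%:R)%:E) ->
  forall s, 0 <= \int[K s]_t V t <= (c * m * (size s)%:R)%:E.
Proof.
move=> c0 mV V0 s; apply/andP; split.
  by apply: integral_ge0 => t _; have /andP[] := V0 t.
apply: (@le_trans _ _ (\int[K s]_t (c%:E * sz t))).
  apply: ge0_le_integral => //.
  - by move=> t _; have /andP[] := V0 t.
  - by apply: measurable_funeM; exact: measurable_sz.
  - by move=> t _; have /andP[_] := V0 t; rewrite EFinM.
rewrite ge0_integralZl_EFin//; last exact: measurable_sz.
by rewrite integral_branch_size pm -!EFinM mulrA.
Qed.

(** Splitting off one particle costs [C] times the number of the remaining ones; these costs add up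
    to at most [C * |s| ^ 2]. *)
Lemma almost_additive_sum (C : R) (V : plist -> \bar R) s :
  (0 <= C)%R -> V [::] = 0 -> almost_additive C V ->
  V s <= \sum_(x <- s) V [:: x] + (C * (size s)%:R ^+ 2)%:E /\
  \sum_(x <- s) V [:: x] <= V s + (C * (size s)%:R ^+ 2)%:E.
Proof.
move=> C0 V0 aV; elim: s => [|x s [ih1 ih2]].
  by rewrite big_nil V0 expr0n mulr0 adde0.
have [h1 h2] := aV [:: x] s.
have le_sq : (C * 1 * (size s)%:R)%:E + (C * (size s)%:R ^+ 2)%:E <=
    (C * (size (x :: s))%:R ^+ 2)%:E.
  rewrite -EFinD lee_fin mulr1 -mulrDr ler_wpM2l//= -natr1.
  by have : (0 <= (size s)%:R :> R)%R by []; nra.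
rewrite big_cons; split.
  rewrite (le_trans h1)//.
  apply: (@le_trans _ _ (V [:: x] + (\sum_(x <- s) V [:: x] +
     (C * (size s)%:R ^+ 2)%:E) + (C * 1 * (size s)%:R)%:E)).
    by rewrite leeD2r// leeD2l.
  by rewrite addeA -(addeA (_ + _)) leeD2l// addeC.
apply: (@le_trans _ _ (V [:: x] + (V s + (C * (size s)%:R ^+ 2)%:E))).
  by rewrite leeD2l.
rewrite addeA.
apply: (@le_trans _ _ (V (x :: s) + (C * 1 * (size s)%:R)%:E + (C * (size s)%:R ^+ 2)%:E)).
  by rewrite leeD2r.
by rewrite -addeA leeD2l.
Qed.

(** Averaging the previous bound over a litter: the sum over the children becomes [m * P] by the
    many-to-one formula, and the squared size becomes the second moment. *)
Lemma almost_additive_offspring (C : R) (V : plist -> \bar R) x :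
  (0 <= C)%R -> measurable_fun setT V ->
  (forall s, 0 <= V s) -> V [::] = 0 -> almost_additive C V ->
  \int[K [:: x]]_s V s <= m%:E * \int[P x]_y V [:: y] + (C * M2)%:E /\
  m%:E * \int[P x]_y V [:: y] <= \int[K [:: x]]_s V s + (C * M2)%:E.
Proof.
move=> C0 mV V0 Vnil aV; rewrite integral_branch_law1//.
have mv : measurable_fun setT (fun y : RR => V [:: y]).
  exact: (measurableT_comp mV measurable_seq1).
have mS : measurable_fun setT (fun s : plist => (C * (size s)%:R ^+ 2)%:E).
  exact: (measurable_fun_size (fun n => (C * n%:R ^+ 2)%:E)).
have S0 (s : plist) : 0 <= (C * (size s)%:R ^+ 2)%:E.
  by rewrite lee_fin mulr_ge0// exprn_ge0.
have msum := measurable_esum_list mv.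
have sum0 (s : plist) : 0 <= \sum_(y <- s) V [:: y] by rewrite sume_ge0.
have ES : \int[offs x]_s (C * (size s)%:R ^+ 2)%:E = (C * M2)%:E.
  rewrite (integral_offspring_size _ _ x (phi := fun n => (C * n%:R ^+ 2)%:E)).
    under eq_integral do rewrite EFinM.
    by rewrite ge0_integralZl_EFin// pM2 EFinM.
  by move=> n; rewrite lee_fin mulr_ge0// exprn_ge0.
rewrite -pm -(integral_offspring_sum p P x mv)// -ES; split.
  rewrite -ge0_integralD//; apply: ge0_le_integral => //.
    exact: emeasurable_funD.
  by move=> s _; have [] := almost_additive_sum s C0 Vnil aV.
rewrite -ge0_integralD//; apply: ge0_le_integral => //.
  exact: emeasurable_funD.
by move=> s _; have [] := almost_additive_sum s C0 Vnil aV.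
Qed.

End almost_additivity.

Section generations.
Context {R : realType}.
Local Notation plist := (plist R).
Local Notation RR := (measurableTypeR R).
Local Open Scope ereal_scope.
Variables (p : probability nat R) (P : R.-pker RR ~> RR).
Local Notation K := (branch_law p P).
Local Notation offs := (offspring_law p P).
Local Notation gl := (generation_law p P).
Local Notation sz s := ((size s)%:R%:E : \bar R).

Lemma integral_generation_law0 s (f : plist -> \bar R) : measurable_fun setT f ->
  \int[gl 0 s]_t f t = f s.
Proof. exact: giry_int_ret. Qed.

Lemma integral_generation_lawS n s (f : plist -> \bar R) :
  measurable_fun setT f -> (forall t, 0 <= f t) ->
  \int[gl n.+1 s]_t f t = \int[gl n s]_t \int[K t]_u f u.
Proof. by move=> mf f0; rewrite [LHS]giry_int_bind. Qed.

Lemma measurable_generation_law n : measurable_fun setT (gl n : plist -> _).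
Proof.
elim: n => [|n ih]; first exact: measurable_giry_ret.
exact: (measurableT_comp (measurable_giry_bind (measurable_branch_law p P)) ih).
Qed.

(** [generation_law] branches at the last generation, whereas the estimates below condition on the
    first one. *)
Lemma integral_generation_lawSr n s (f : plist -> \bar R) :
  measurable_fun setT f -> (forall t, 0 <= f t) ->
  \int[gl n.+1 s]_t f t = \int[K s]_t \int[gl n t]_u f u.
Proof.
elim: n s f => [|n ih] s f mf f0; rewrite integral_generation_lawS//.
  rewrite integral_generation_law0; last first.
    exact: (measurable_integral_giry (measurable_branch_law p P)).
  by apply: eq_integral => t _; rewrite integral_generation_law0.
rewrite ih//.
- by apply: eq_integral => t _; rewrite integral_generation_lawS.
- exact: (measurable_integral_giry (measurable_branch_law p P)).
- by move=> t; exact: integral_ge0.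
Qed.

Lemma measurable_generation_law_ev n A : measurable A ->
  measurable_fun setT (fun s : plist => gl n s A).
Proof.
by move=> mA; exact: (measurableT_comp (measurable_giry_ev mA) (measurable_generation_law n)).
Qed.

Lemma integral_indicE d (T : measurableType d) (mu : {measure set T -> \bar R}) A :
  measurable A -> \int[mu]_x (\1_A x)%:E = mu A.
Proof. by move=> mA; rewrite integral_indic// setIT. Qed.

Lemma generation_lawSr n s A : measurable A ->
  gl n.+1 s A = \int[K s]_t gl n t A.
Proof.
move=> mA; rewrite -[LHS]integral_indicE//.
have m1 : measurable_fun setT (fun s : plist => (\1_A s)%:E : \bar R).
  exact/measurable_EFinP/measurable_indic.
rewrite integral_generation_lawSr//.
by apply: eq_integral => t _; rewrite integral_indicE.
Qed.

Lemma generation_law_le1 n s A : measurable A -> gl n s A <= 1.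
Proof.
move=> mA; apply: (@le_trans _ _ (gl n s setT)); last exact: sprobability_setT.
by apply: le_measure; rewrite ?inE.
Qed.

Lemma generation_law_fin_num n s A : measurable A -> gl n s A \is a fin_num.
Proof.
move=> mA; rewrite ge0_fin_numE//; apply: le_lt_trans (generation_law_le1 _ _ mA) _.
exact: ltry.
Qed.

Lemma integral_nstepS k x (f : RR -> \bar R) :
  measurable_fun setT f -> (forall y, 0 <= f y) ->
  \int[nstep P k.+1 x]_y f y = \int[P x]_y \int[nstep P k y]_z f z.
Proof.
move=> mf f0.
transitivity (\int[giry_bind (kernel_law P x) (measurable_kernel_law (nstep P k))]_y f y).
  (* The composite kernel and the Giry bind agree on measurable sets, which is enough to transfer
     the integral formula. *)
  apply: eq_measure_integral => A mA _.
  have m1 : measurable_fun setT (fun s : RR => (\1_A s)%:E : \bar R).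
    exact/measurable_EFinP/measurable_indic.
  rewrite -[RHS]integral_indicE// [RHS]giry_int_bind//.
  by apply: eq_integral => y _; rewrite /giry_int integral_indicE.
by rewrite [LHS]giry_int_bind.
Qed.

End generations.

Section two_scale_limit.
Context {R : realType}.

(** [lam n] stands for the inner limit at scale [n]. Since [w] is eventually within about [eps n] of
    it for every [n], [w] is Cauchy, and the bound passes to its limit without the extra [e]. *)
Lemma cvg_two_scale (w lam eps : nat -> R) : eps n @[n --> \oo] --> 0 ->
  (forall n e, 0 < e -> \forall k \near \oo, `|w k - lam n| <= eps n + e) ->
  exists c, w k @[k --> \oo] --> c /\ forall n, `|c - lam n| <= eps n.
Proof.
move=> eps0 H.
have cw : cvgn w.
  apply/cauchy_cvgP/cauchy_exP => e e0.
  have e20 : 0 < e / 4%:R by rewrite divr_gt0.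
  have [n _ hn] := ((cvgrPdist_le _ _).1 eps0 _ e20).
  exists (lam n); have := H n _ e20; apply: filterS => k hk.
  rewrite /ball/= distrC (le_lt_trans hk)//.
  have := hn n (leqnn n); rewrite sub0r normrN => /(le_trans (ler_norm _)) h.
  lra.
exists (limn w); split => // n; apply/ler_addgt0Pr => e e0.
have cn : `|w k - lam n| @[k --> \oo] --> `|limn w - lam n|.
  by apply: cvg_norm; apply: cvgB => //; exact: cvg_cst.
rewrite -(cvg_lim _ cn)//; apply: limr_le; first by apply/cvg_ex; eexists; exact: cn.
exact: H.
Qed.

End two_scale_limit.

Section asymptotics.
Context {R : realType}.
Local Notation plist := (plist R).
Local Notation RR := (measurableTypeR R).
Local Open Scope ereal_scope.
Variables (p : probability nat R) (P : R.-pker RR ~> RR).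
Local Notation K := (branch_law p P).
Local Notation gl := (generation_law p P).
Variables (m M2 : R).
Hypothesis pm : \int[p]_j j%:R%:E = m%:E.
Hypothesis pM2 : \int[p]_j (j%:R ^+ 2)%:E = M2%:E.
Hypotheses (m0 : (0 < m)%R) (m1 : (m < 1)%R).

(** The constant [2] comes from generation [0]: for two nonempty lists, the defect of additivity of
    an indicator is at most [2], and if one of the lists is empty it vanishes because [A] excludes
    the empty list. The linear bound also starts there, an event without the empty list having
    indicator at most the size. *)
Lemma generation_law_additive n (A : set plist) : measurable A -> ~ A [::] ->
  almost_additive (2 * (m ^+ n) ^+ 2)%R (fun s => gl n s A) /\
  forall s, 0 <= gl n s A <= (m ^+ n * (size s)%:R)%:E.
Proof.
move=> mA nA; elim: n => [|n [ih1 ih2]].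
  split=> [a b|s]; rewrite /= !diracE; last first.
    rewrite !lee_fin ler0n expr0 mul1r/=; case: s => [|x s].
      by rewrite memNset.
    by rewrite ler_nat; case: (_ \in A).
  rewrite expr0 expr1n mulr1 -!EFinD !lee_fin.
  have A0 : ([::] \in A) = false by rewrite memNset.
  case: a => [|x a]; first by rewrite A0 /= mulr0 mul0r !addr0 add0r.
  case: b => [|y b]; first by rewrite cats0 A0 mulr0 !addr0.
  have h (s : seq R) : (0 <= ((s \in A)%:R : R) <= 1)%R.
    by rewrite ler0n lern1; case: (_ \in A).
  have := h ((x :: a) ++ y :: b); have := h (x :: a); have := h (y :: b).
  have : (1 <= (size (x :: a))%:R * (size (y :: b))%:R :> R)%R.
    by rewrite -natrM ler1n.
  by rewrite -mulrA => ? /andP[? ?] /andP[? ?] /andP[? ?]; split; lra.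
have m_ge0 : (0 <= m)%R by exact: ltW.
have mg := measurable_generation_law_ev p P n mA.
have -> : (fun s => gl n.+1 s A) = (fun s => \int[K s]_t gl n t A).
  by apply/funext => s; rewrite generation_lawSr.
split.
  rewrite [(m ^+ n.+1)%R]exprSr exprMn mulrA; apply: (almost_additive_step P pm) => //.
  by rewrite mulr_ge0// exprn_ge0// exprn_ge0.
move=> s; rewrite generation_lawSr// exprSr.
exact: (linear_bound_step P pm (exprn_ge0 n m_ge0) mg ih2).
Qed.

(* [\sum_i 2 * M2 * m ^ (i - 1)]: the step from generation [n + i] costs
   [2 * M2 * m ^ (2 * (n + i))], to be divided by [m ^ (i + 1)]. *)
Definition tail_const : R := 2 * M2 / (m * (1 - m)).
Local Notation C0 := tail_const.

Lemma M2_ge0 : (0 <= M2)%R.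
Proof. by rewrite -lee_fin -pM2; apply: integral_ge0 => j _; rewrite lee_fin exprn_ge0. Qed.

Lemma tail_const_ge0 : (0 <= C0)%R.
Proof.
have m_ge0 : (0 <= m)%R by exact: ltW.
by rewrite divr_ge0// mulr_ge0// ?M2_ge0// subr_ge0 ltW.
Qed.

(** Iterates the one-step estimate through generations [n] to [n + k]. Divided by [m ^ (n + k)], the
    error stays below [C0 * m ^ n] whatever [k], which allows [k] to tend to infinity first. *)
Lemma generation_law_multistep n k x (A : set plist) : measurable A -> ~ A [::] ->
  gl (n + k)%N [:: x] A <= (m ^+ k)%:E * \int[nstep P k x]_y gl n [:: y] A +
    (C0 * (m ^+ n) ^+ 2 * m ^+ k * (1 - m ^+ k))%:E /\
  (m ^+ k)%:E * \int[nstep P k x]_y gl n [:: y] A <= gl (n + k)%N [:: x] A +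
    (C0 * (m ^+ n) ^+ 2 * m ^+ k * (1 - m ^+ k))%:E.
Proof.
move=> mA nA.
have mv j : measurable_fun setT (fun y : RR => gl j [:: y] A).
  exact: (measurableT_comp (measurable_generation_law_ev p P j mA) measurable_seq1).
have m_ge0 : (0 <= m)%R by exact: ltW.
elim: k x => [|k ih] x.
  rewrite addn0 expr0 subrr mulr0 adde0 mul1e adde0.
  by rewrite (_ : \int[_]_y _ = gl n [:: x] A)// integral_dirac// diracT mul1e.
rewrite addnS generation_lawSr// integral_nstepS//.
have [aa lb] := generation_law_additive (n + k) mA nA.
have C2 : (0 <= 2 * (m ^+ (n + k)) ^+ 2 :> R)%R by rewrite mulr_ge0// exprn_ge0// exprn_ge0.
have Vnil : gl (n + k)%N [::] A = 0.
  by apply/eqP; rewrite eq_le; have /andP[-> h] := lb [::]; rewrite (le_trans h)//= mulr0.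
have [st1 st2] := almost_additive_offspring P pm pM2 x C2
   (measurable_generation_law_ev p P (n + k) mA) (fun s => measure_ge0 _ _) Vnil aa.
set B := (C0 * _ * m ^+ k * _)%R in ih.
have B0 : (0 <= B)%R.
  apply: mulr_ge0; last by rewrite subr_ge0 exprn_ile1// ltW.
  by rewrite mulr_ge0 ?exprn_ge0// mulr_ge0 ?tail_const_ge0// exprn_ge0 ?exprn_ge0.
have mI : measurable_fun setT (fun y : RR => \int[nstep P k y]_z gl n [:: z] A).
  exact: (measurable_integral_giry (measurable_kernel_law (nstep P k))).
have I0 (y : RR) : 0 <= \int[nstep P k y]_z gl n [:: z] A by exact: integral_ge0.
set J := \int[P x]_y \int[nstep P k y]_z gl n [:: z] A.
have P1 : P x setT = 1 by exact: prob_kernel.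
have i1 : \int[P x]_y gl (n + k)%N [:: y] A <= (m ^+ k)%:E * J + B%:E.
  rewrite /J -ge0_integralZl_EFin// ?exprn_ge0//.
  rewrite -[X in _ + X](integral_mass1 B%:E P1) -ge0_integralD//; last 2 first.
  - by move=> y _; rewrite mule_ge0// lee_fin exprn_ge0.
  - exact: measurable_funeM.
  apply: ge0_le_integral => //.
  - by apply: emeasurable_funD => //; exact: measurable_funeM.
  - by move=> y _; have [] := ih y.
have i2 : (m ^+ k)%:E * J <= \int[P x]_y gl (n + k)%N [:: y] A + B%:E.
  rewrite /J -ge0_integralZl_EFin// ?exprn_ge0//.
  rewrite -[X in _ + X](integral_mass1 B%:E P1) -ge0_integralD//.
  apply: ge0_le_integral => //.
  - by move=> y _; rewrite mule_ge0// lee_fin exprn_ge0.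
  - exact: measurable_funeM.
  - exact: emeasurable_funD.
  - by move=> y _; have [] := ih y.
(* The factor [1 - m ^ k] encodes the partial geometric sum: [m] times the old error plus the cost
   of the new step is exactly the new error. *)
have EB : (C0 * (m ^+ n) ^+ 2 * m ^+ k.+1 * (1 - m ^+ k.+1) =
    m * B + 2 * (m ^+ (n + k)) ^+ 2 * M2)%R.
  rewrite /B /C0 exprD [(m ^+ k.+1)%R]exprS; move: (m ^+ n)%R (m ^+ k)%R => a b; field.
  by rewrite subr_eq0 gt_eqF//= gt_eqF.
rewrite EB EFinD [(m * B)%:E]EFinM; split.
  rewrite (le_trans st1)// [(m ^+ k.+1)%R]exprS [(m * m ^+ k)%:E]EFinM -muleA addeA leeD2r//.
  have J0 : 0 <= (m ^+ k)%:E * J by rewrite mule_ge0 ?lee_fin ?exprn_ge0 ?integral_ge0.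
  by rewrite -ge0_muleDr ?lee_fin// lee_pmul2l ?lte_fin.
rewrite [(m ^+ k.+1)%R]exprS [(m * m ^+ k)%:E]EFinM -muleA.
apply: (@le_trans _ _ (m%:E * (\int[P x]_y gl (n + k)%N [:: y] A + B%:E))).
  by rewrite lee_pmul2l ?lte_fin.
rewrite ge0_muleDr ?lee_fin ?integral_ge0//.
rewrite [leLHS]addeC [leRHS]addeCA; exact: leeD2l.
Qed.

End asymptotics.

(** * The limit measure on lists *)

Section limit_measure.
Context {R : realType}.
Local Notation plist := (plist R).
Local Notation RR := (measurableTypeR R).
Local Open Scope ereal_scope.
Variables (p : probability nat R) (P : R.-pker RR ~> RR).
Local Notation gl := (generation_law p P).
Variables (m M2 : R).
Hypothesis pm : \int[p]_j j%:R%:E = m%:E.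
Hypothesis pM2 : \int[p]_j (j%:R ^+ 2)%:E = M2%:E.
Hypotheses (m0 : (0 < m)%R) (m1 : (m < 1)%R).
Variable pi : probability RR R.
Hypothesis Ppi : forall (x : R) (h : R -> R), Bbp h ->
  \int[nstep P n x]_y (h y)%:E @[n --> \oo] --> \int[pi]_y (h y)%:E.
Local Notation C0 := (tail_const m M2).

Lemma measurable_generation_law1 n : measurable_fun setT (fun y : RR => gl n [:: y]).
Proof. exact: (measurableT_comp (measurable_generation_law p P n) measurable_seq1). Qed.

(** Generation [n] issued from one ancestor distributed according to [pi]: the limit, as [k] grows,
    of the averages in [generation_law_multistep]. *)
Definition stationary_law n : giry plist R :=
  giry_bind (pi : giry RR R) (measurable_generation_law1 n).

Lemma stationary_lawE n A : measurable A ->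
  stationary_law n A = \int[pi]_y gl n [:: y] A.
Proof.
move=> mA; have mA1 : measurable_fun setT (fun s : plist => (\1_A s)%:E : \bar R).
  exact/measurable_EFinP/measurable_indic.
rewrite -[LHS]integral_indicE// [LHS]giry_int_bind//.
by apply: eq_integral => y _; rewrite /giry_int integral_indicE.
Qed.

Definition scaled_law (A : set plist) n (s : plist) : R := (fine (gl n s A) / m ^+ n)%R.

Definition scaled_stationary (A : set plist) n : R :=
  (fine (stationary_law n A) / m ^+ n)%R.

Lemma cvg_geometric_tail : (C0 * m ^+ n)%R @[n --> \oo] --> (0%R : R).
Proof. by apply: cvg_geometric; rewrite ger0_norm// ltW. Qed.

Lemma fin_num_prob_integral d (T : measurableType d) (mu : {measure set T -> \bar R})
    (f : T -> \bar R) : mu setT <= 1 -> measurable_fun setT f ->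
  (forall x, 0 <= f x <= 1) -> \int[mu]_x f x \is a fin_num.
Proof.
move=> mu1 mf f01; rewrite ge0_fin_numE; last first.
  by apply: integral_ge0 => x _; have /andP[] := f01 x.
apply: (@le_lt_trans _ _ (\int[mu]_x 1)); last first.
  by rewrite integral_cst// mul1e (le_lt_trans mu1)// ltry.
by apply: ge0_le_integral => // x _; have /andP[] := f01 x.
Qed.

Lemma scaled_law_cvg_exists (A : set plist) (x : R) : measurable A -> ~ A [::] -> exists c : R,
  scaled_law A n [:: x] @[n --> \oo] --> c /\
  forall n, (`|c - scaled_stationary A n| <= C0 * m ^+ n)%R.
Proof.
move=> mA nA; apply: cvg_two_scale; first exact: cvg_geometric_tail.
move=> n e e0.
have mv : measurable_fun setT (fun y : RR => gl n [:: y] A).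
  exact: (measurableT_comp (measurable_giry_ev mA) (measurable_generation_law1 n)).
have v01 (y : RR) : 0 <= gl n [:: y] A <= 1 by rewrite measure_ge0 generation_law_le1.
pose I k := \int[nstep P k x]_y gl n [:: y] A.
have If k : I k \is a fin_num.
  by apply: fin_num_prob_integral => //; exact: sprob_kernel_le1.
have mn0 k : (0 < m ^+ k)%R by rewrite exprn_gt0.
have Icvg : fine (I k) @[k --> \oo] --> fine (stationary_law n A).
  apply: fine_cvg; rewrite stationary_lawE// fineK; last first.
    exact: (fin_num_prob_integral (probability_le1 pi measurableT) mv v01).
  have E (y : RR) : (fine (gl n [:: y] A))%:E = gl n [:: y] A.
    by rewrite fineK// generation_law_fin_num.
  have := @Ppi x (fun y => fine (gl n [:: y] A)).
  rewrite (_ : (fun _ => _) = I); last first.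
    by apply/funext => k; apply: eq_integral => y _; exact: E.
  rewrite (_ : \int[pi]_y _ = \int[pi]_y gl n [:: y] A); last first.
    by apply: eq_integral => y _; exact: E.
  apply; split.
  - exact: (measurableT_comp (fine_measurable measurableT) mv).
  - by move=> y; rewrite fine_ge0.
  - exists 1%R; split => // M M1 y _ /=.
    rewrite ger0_norm ?fine_ge0// (le_trans _ (ltW M1))// -lee_fin fineK.
      exact: generation_law_le1.
    exact: generation_law_fin_num.
(* The tolerance is [e * m ^ n] because [Icvg] concerns probabilities not yet divided by [m ^ n]. *)
have em0 : (0 < e * m ^+ n)%R by rewrite mulr_gt0.
have [k0 _ hk0] := ((cvgrPdist_le _ _).1 Icvg _ em0).
exists (n + k0)%N => // N /= nN.
have [k kk0 ->] : exists2 k, (k0 <= k)%N & N = (n + k)%N.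
  by exists (N - n)%N; [rewrite leq_subRL// (leq_trans _ nN)// leq_addr|
     rewrite subnKC// (leq_trans _ nN)// leq_addr].
have {hk0} := hk0 k kk0; rewrite /=.
have [s1 s2] := generation_law_multistep P pm pM2 m0 m1 n k x mA nA.
rewrite /scaled_law /scaled_stationary; move: s1 s2; rewrite -/(I k).
rewrite -(fineK (If k)) -(fineK (generation_law_fin_num p P (n + k) [:: x] mA)) /=.
rewrite -!EFinM -!EFinD !lee_fin => s1 s2.
set a := fine (gl _ _ _) in s1 s2 *; set b := fine (I k) in s1 s2 *.
set q := fine (stationary_law _ _) => h.
(* First half of the triangle inequality: the cost of the [k] steps, uniform in [k]. The second
   half, [h3], is the distance to stationarity. *)
have h2 : (`|a / m ^+ (n + k) - b / m ^+ n| <= C0 * m ^+ n)%R.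
  have -> : (a / m ^+ (n + k) - b / m ^+ n = (a - m ^+ k * b) / m ^+ (n + k))%R.
    by rewrite exprD; field; rewrite !gt_eqF.
  rewrite normrM (gtr0_norm (x := (m ^+ (n + k))^-1%R)) ?invr_gt0//.
  rewrite ler_pdivrMr//.
  have -> : (C0 * m ^+ n * m ^+ (n + k) = C0 * (m ^+ n) ^+ 2 * m ^+ k)%R.
    by rewrite exprD; ring.
  have T0 : (0 <= C0 * (m ^+ n) ^+ 2 * m ^+ k)%R.
    have m_ge0 := ltW m0; apply: mulr_ge0; last exact: exprn_ge0.
    by apply: mulr_ge0; [exact: (tail_const_ge0 pM2 m0 m1)|rewrite exprn_ge0// exprn_ge0].
  have Tk : (C0 * (m ^+ n) ^+ 2 * m ^+ k * (1 - m ^+ k) <= C0 * (m ^+ n) ^+ 2 * m ^+ k)%R.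
    by rewrite ler_piMr// gerBl ltW.
  by rewrite ler_norml; apply/andP; split; lra.
have h3 : (`|b / m ^+ n - q / m ^+ n| <= e)%R.
  rewrite -mulrBl normrM (gtr0_norm (x := (m ^+ n)^-1%R)) ?invr_gt0//.
  by rewrite ler_pdivrMr// distrC.
rewrite -(subrKA (b / m ^+ n)%R) (le_trans (ler_normD _ _))// lerD//.
Qed.

(** The limit obtained from a starting point [x] lies within [C0 * m ^ n] of
    [scaled_stationary A n], which does not involve [x]. It is therefore the limit of the latter,
    common to all starting points. *)
Lemma scaled_stationary_cvg (A : set plist) : measurable A -> ~ A [::] ->
  [/\ scaled_stationary A n @[n --> \oo] --> limn (scaled_stationary A),
      forall n, (`|limn (scaled_stationary A) - scaled_stationary A n| <= C0 * m ^+ n)%R,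
      forall x, scaled_law A n [:: x] @[n --> \oo] --> limn (scaled_stationary A) &
      (0 <= limn (scaled_stationary A))%R].
Proof.
move=> mA nA.
have lamc c : (forall n, `|c - scaled_stationary A n| <= C0 * m ^+ n)%R ->
    scaled_stationary A n @[n --> \oo] --> c.
  move=> h; apply/cvgrPdist_le => e e0.
  have [n0 _ hn0] := ((cvgrPdist_le _ _).1 cvg_geometric_tail _ e0).
  exists n0 => // n nn0; rewrite (le_trans (h n))//.
  by have := hn0 _ nn0; rewrite sub0r normrN => /(le_trans (ler_norm _)).
have [c [wc h]] := scaled_law_cvg_exists 0%R mA nA.
have limE := cvg_lim (@Rhausdorff R) (lamc _ h); rewrite limE; split => //.
- exact: lamc.
- move=> x; have [c' [wc' h']] := scaled_law_cvg_exists x mA nA.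
  by rewrite -limE (cvg_lim (@Rhausdorff R) (lamc _ h')).
rewrite -(cvg_lim (@Rhausdorff R) wc); apply: limr_ge; first by apply/cvg_ex; exists c.
by apply: nearW => n; rewrite /scaled_law divr_ge0 ?fine_ge0// exprn_ge0// ltW.
Qed.

(** Each ancestor contributes the same limit; the defect of additivity, of order [m ^ (2n)],
    vanishes after division by [m ^ n]. *)
Lemma scaled_law_cvg (A : set plist) s : measurable A -> ~ A [::] ->
  scaled_law A n s @[n --> \oo] --> ((size s)%:R * limn (scaled_stationary A))%R.
Proof.
move=> mA nA; have [_ _ wc _] := scaled_stationary_cvg mA nA.
set c := limn _ in wc *.
have sumc : (\sum_(x <- s) scaled_law A n [:: x])%R @[n --> \oo] --> ((size s)%:R * c)%R.
  elim: s => [|x s ih] /=.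
    under eq_fun do rewrite big_nil.
    by rewrite mul0r; exact: cvg_cst.
  under eq_fun do rewrite big_cons.
  rewrite -natr1 mulrDl mul1r addrC; apply: cvgD => //; exact: wc.
pose del n := (2 * (size s)%:R ^+ 2 * m ^+ n)%R.
have del0 : del n @[n --> \oo] --> (0%R : R).
  by apply: cvg_geometric; rewrite ger0_norm// ltW.
have bnd n : (`|scaled_law A n s - \sum_(x <- s) scaled_law A n [:: x]| <= del n)%R.
  have [aa lb] := generation_law_additive P pm m0 n mA nA.
  have C2 : (0 <= 2 * (m ^+ n) ^+ 2 :> R)%R by rewrite mulr_ge0// exprn_ge0// exprn_ge0 ?ltW.
  have Vnil : gl n [::] A = 0.
    by apply/eqP; rewrite eq_le; have /andP[-> h] := lb [::]; rewrite (le_trans h)//= mulr0.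
  have [s1 s2] := almost_additive_sum s C2 Vnil aa.
  rewrite /scaled_law -mulr_suml -mulrBl normrM (gtr0_norm (x := (m ^+ n)^-1%R)); last first.
    by rewrite invr_gt0 exprn_gt0.
  rewrite ler_pdivrMr ?exprn_gt0//.
  have -> : (del n * m ^+ n = 2 * (m ^+ n) ^+ 2 * (size s)%:R ^+ 2)%R by rewrite /del; ring.
  have E : \sum_(x <- s) gl n [:: x] A = (\sum_(x <- s) fine (gl n [:: x] A))%R%:E.
    rewrite -sumEFin; apply: eq_bigr => x _; rewrite fineK//.
    exact: generation_law_fin_num.
  move: s1 s2; rewrite E -(fineK (generation_law_fin_num p P n s mA)) -!EFinD !lee_fin => s1 s2.
  by rewrite ler_norml; apply/andP; split; lra.
apply/cvgrPdist_le => e e0; have e2 : (0 < e / 2)%R by rewrite divr_gt0.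
near=> n.
have h1 : (`|(size s)%:R * c - \sum_(x <- s) scaled_law A n [:: x]| <= e / 2)%R.
  by near: n; exact: ((cvgrPdist_le _ _).1 sumc _ e2).
have h2 : (del n <= e / 2)%R.
  apply: le_trans (ler_norm _) _; rewrite -normrN -sub0r.
  by near: n; exact: ((cvgrPdist_le _ _).1 del0 _ e2).
rewrite -(subrKA (\sum_(x <- s) scaled_law A n [:: x])%R) (le_trans (ler_normD _ _))//.
rewrite [leRHS](splitr e) lerD// distrC (le_trans (bnd n))//.
Unshelve. all: by end_near. Qed.

Lemma scaled_law_le (A : set plist) n s : measurable A -> ~ A [::] ->
  (0 <= scaled_law A n s <= (size s)%:R)%R.
Proof.
move=> mA nA; have [_ lb] := generation_law_additive P pm m0 n mA nA.
have /andP[_] := lb s; rewrite -(fineK (generation_law_fin_num p P n s mA)) lee_fin => h.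
rewrite /scaled_law divr_ge0 ?fine_ge0 ?exprn_ge0 ?(ltW m0)//=.
by rewrite ler_pdivrMr ?exprn_gt0// mulrC.
Qed.

End limit_measure.

Section yaglom_measure.
Context {R : realType}.
Local Notation plist := (plist R).
Local Notation RR := (measurableTypeR R).
Local Open Scope ereal_scope.
Variables (p : probability nat R) (P : R.-pker RR ~> RR).
Local Notation gl := (generation_law p P).
Variables (m M2 : R).
Hypothesis pm : \int[p]_j j%:R%:E = m%:E.
Hypothesis pM2 : \int[p]_j (j%:R ^+ 2)%:E = M2%:E.
Hypotheses (m0 : (0 < m)%R) (m1 : (m < 1)%R).
Variable pi : probability RR R.
Hypothesis Ppi : forall (x : R) (h : R -> R), Bbp h ->
  \int[nstep P n x]_y (h y)%:E @[n --> \oo] --> \int[pi]_y (h y)%:E.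
Local Notation C0 := (tail_const m M2).
Local Notation Lam := (scaled_stationary p P m pi).
Local Notation lam A := (limn (Lam A)).
Let slc := scaled_stationary_cvg pm pM2 m0 m1 Ppi.

Lemma measurable_set_nil : measurable ([set [::]] : set plist).
Proof.
rewrite (_ : [set _] = [set s : plist | size s = 0%N]); first exact: measurable_size_eq.
by apply/seteqP; split => s /=; [move=> ->|move/size0nil].
Qed.

(** The empty list asymptotically carries all the mass, so that its scaled mass diverges; only the
    rest of [A] has a finite limit. *)
Let D (A : set plist) := A `\ ([::] : plist).

Let mD A : measurable A -> measurable (D A).
Proof. by move=> mA; apply: measurableD => //; exact: measurable_set_nil. Qed.

Let nD A : ~ D A [::]. Proof. by move=> [_]; exact. Qed.

Let Lam_fin n A : measurable A -> stationary_law p P pi n A \is a fin_num.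
Proof.
move=> mA; rewrite ge0_fin_numE//; apply: (@le_lt_trans _ _ 1); last exact: ltry.
apply: (@le_trans _ _ (stationary_law p P pi n setT)); last exact: sprobability_setT.
by apply: le_measure; rewrite ?inE.
Qed.

Let lam_setU (A B : set plist) : measurable A -> measurable B -> ~ A [::] -> ~ B [::] ->
  A `&` B = set0 -> lam (A `|` B) = (lam A + lam B)%R.
Proof.
move=> mA mB nA nB AB; apply: cvg_lim => //.
rewrite (_ : Lam (A `|` B) = fun n => (Lam A n + Lam B n)%R).
  by apply: cvgD; [have [] := slc mA nA|have [] := slc mB nB].
apply/funext => n; rewrite /scaled_stationary -mulrDl; congr (_ / _)%R.
by rewrite measureU// fineD ?Lam_fin.
Qed.

Let lam0 : lam set0 = 0%R.
Proof.
apply: cvg_lim => //; rewrite (_ : Lam _ = cst 0%R); first exact: cvg_cst.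
by apply/funext => n; rewrite /scaled_stationary measure0 mul0r.
Qed.

(* The maximum with [0] only matters on non-measurable sets, where [lam] is a
   junk limit. *)
Let f (A : set plist) : \bar R := (Num.max 0%R (lam (D A)))%:E.

Let fE A : measurable A -> f A = (lam (D A))%:E.
Proof.
by move=> mA; rewrite /f; have [_ _ _ h] := slc (mD mA) (@nD A); rewrite max_r.
Qed.

Let f0 : f set0 = 0.
Proof. by rewrite fE// /D set0D lam0. Qed.

Let f_ge0 A : 0 <= f A.
Proof. by rewrite lee_fin le_max lexx. Qed.

Let f_bigsetU (F : (set plist)^nat) n : (forall i, measurable (F i)) ->
  trivIset setT F -> \sum_(0 <= i < n) f (F i) = f (\big[setU/set0]_(i < n) F i).
Proof.
move=> mF tF; elim: n => [|n ih]; first by rewrite big_geq// big_ord0 f0.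
rewrite big_nat_recr//= ih big_ord_recr/= !fE//; last 2 first.
- by apply: measurableU => //; exact: bigsetU_measurable.
- exact: bigsetU_measurable.
rewrite -EFinD -lam_setU//; last 3 first.
- by apply: mD; exact: bigsetU_measurable.
- exact: mD.
- apply/seteqP; split => // s [[Us _] [Fs _]].
  move: Us; rewrite -bigcup_mkord => -[k /= kn Fks].
  move/trivIsetP : tF => /(_ k n I I); rewrite ltn_eqF// => /(_ isT) /seteqP[+ _].
  by move=> /(_ s); apply; split.
by rewrite /D setDUl.
Qed.

(** Finite additivity passes to the limit, and continuity from below follows by a three-epsilon
    argument. The bound [C0 * m ^ k] on the distance from [lam] to [Lam] at rank [k] is the same for
    all sets, so [k] can be fixed first, and at rank [k] the law is a genuine measure. *)
Let f_sigma_additive : semi_sigma_additive f.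
Proof.
move=> F mF tF mUF; rewrite (_ : (fun n => _) = fun n =>
  (lam (D (\big[setU/set0]_(i < n) F i)))%:E); last first.
  by apply/funext => n; rewrite f_bigsetU// fE//; exact: bigsetU_measurable.
rewrite fE//; apply: cvg_EFin; first by apply: nearW.
rewrite /comp /=; set G := fun n => D (\big[setU/set0]_(i < n) F i).
set Goo := D (\bigcup_n F n).
have mG n : measurable (G n) by apply: mD; exact: bigsetU_measurable.
have mGoo : measurable Goo by exact: mD.
have UG : \bigcup_n G n = Goo.
  rewrite /G /Goo /D -setD_bigcupl; congr (_ `\` _).
  apply/seteqP; split => s [k _].
    by rewrite -bigcup_mkord => -[i _ Fis]; exists i.
  by move=> Fks; exists k.+1 => //; rewrite -bigcup_mkord; exists k => /=.
apply/cvgrPdist_le => e e0; have e3 : (0 < e / 3)%R by rewrite divr_gt0.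
have [k _ hk] := ((cvgrPdist_le _ _).1 (cvg_geometric_tail M2 m0 m1) _ e3).
have {}hk : (C0 * m ^+ k <= e / 3)%R.
  by have := hk k (leqnn k); rewrite sub0r normrN => /(le_trans (ler_norm _)).
have Gcvg : Lam (G n) k @[n --> \oo] --> Lam Goo k.
  apply: cvgMl; apply: fine_cvg; rewrite fineK ?Lam_fin// -UG.
  apply: nondecreasing_cvg_mu => //; first by rewrite UG.
  move=> a b ab; apply/subsetPset => s [Us s0]; split => //.
  by move: Us; apply: subset_bigsetU.
near=> n.
have h1 : (`|Lam Goo k - Lam (G n) k| <= e / 3)%R.
  by near: n; exact: ((cvgrPdist_le _ _).1 Gcvg _ e3).
have [_ /(_ k) h2 _ _] := slc (mG n) (@nD _).
have [_ /(_ k) h3 _ _] := slc mGoo (@nD _).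
move: h1 h2 h3; set a := lam Goo; set b := lam (G n).
set a' := Lam Goo k; set b' := Lam (G n) k.
rewrite !ler_norml => /andP[? ?] /andP[? ?] /andP[? ?]; apply/andP; split; lra.
Unshelve. all: by end_near. Qed.

Lemma yaglom_measure_exists : exists c : {measure set plist -> \bar R},
  forall A, measurable A -> c A = (lam (A `\ ([::] : plist)))%:E.
Proof.
pose M := isMeasure.Build _ _ _ f f0 f_ge0 f_sigma_additive.
by exists (HB.pack_for (Measure.type plist R) f M) => A mA; exact: fE.
Qed.

End yaglom_measure.

(** * Generating functions and survival probabilities *)

Section generating_function.
Context {R : realType}.
Local Open Scope ereal_scope.
Variable p : probability nat R.

Lemma integral_pmf (phi : nat -> \bar R) : (forall j, 0 <= phi j) ->
  \int[p]_j phi j = \sum_(0 <= j <oo) phi j * (offspring_prob p j)%:E.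
Proof.
move=> phi0; have UN : \bigcup_k [set k] = [set: nat].
  by apply/seteqP; split => // k _; exists k.
rewrite -UN ge0_integral_bigcup//; last first.
  by apply/trivIsetP => i j _ _ ij; apply/seteqP; split => // k [/= -> ji]; rewrite ji eqxx in ij.
apply: eq_eseriesr => k _.
rewrite (eq_integral (cst (phi k))); last by move=> x; rewrite inE/= => ->.
by rewrite integral_cst// /offspring_prob fineK// fin_num_measure.
Qed.

Lemma integral_offspring_mean : \int[p]_j j%:R%:E = mean p.
Proof.
rewrite integral_pmf; last by move=> j; rewrite lee_fin.
by apply: eq_eseriesr => k _; rewrite EFinM.
Qed.

Lemma integral_genfun (a : R) : (0 <= a <= 1)%R ->
  \int[p]_j (a ^+ j)%:E = (genfun p a)%:E /\ (0 <= genfun p a <= 1)%R.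
Proof.
move=> /andP[a0 a1].
have aj0 j : 0 <= (a ^+ j)%:E by rewrite lee_fin exprn_ge0.
have If : \int[p]_j (a ^+ j)%:E \is a fin_num.
  apply: (fin_num_prob_integral (probability_le1 p measurableT)) => // j.
  by rewrite aj0 lee_fin exprn_ile1.
have E : \int[p]_j (a ^+ j)%:E = (genfun p a)%:E.
  rewrite -(fineK If); congr EFin; apply/esym; apply: cvg_lim => //.
  have h : \sum_(0 <= j < n) (a ^+ j)%:E * (offspring_prob p j)%:E @[n --> \oo] -->
      \int[p]_j (a ^+ j)%:E.
    rewrite integral_pmf//; apply: is_cvg_nneseries => j _ _.
    by rewrite mule_ge0// lee_fin fine_ge0.
  rewrite (_ : series _ = fun n => fine (\sum_(0 <= j < n) (a ^+ j)%:E * (offspring_prob p j)%:E)).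
    by apply: fine_cvg; rewrite fineK.
  apply/funext => n; rewrite /series/=.
  under [in RHS]eq_bigr do rewrite -EFinM mulrC.
  by rewrite sumEFin.
split=> //; rewrite -!lee_fin -E integral_ge0//=.
rewrite -[leRHS](integral_mass1 1 (probability_setT p)).
by apply: ge0_le_integral => // j _; rewrite lee_fin exprn_ile1.
Qed.

Lemma genfun_iter01 n : (0 <= genfun_iter p n 0 <= 1)%R.
Proof.
elim: n => [|n ih]; first by rewrite /genfun_iter /= lexx ler01.
by have [] := integral_genfun ih.
Qed.

Section branch.
Variable P : R.-pker (measurableTypeR R) ~> (measurableTypeR R).
Local Notation K := (branch_law p P).
Local Notation gl := (generation_law p P).

Lemma integral_branch_genfun s (a : R) : (0 <= a <= 1)%R ->
  \int[K s]_t (a ^+ size t)%:E = (genfun p a ^+ size s)%:E.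
Proof.
move=> a01; have [Ef /andP[g0 g1]] := integral_genfun a01.
have /andP[a0 _] := a01.
have mf : measurable_fun setT (fun t : plist R => (a ^+ size t)%:E).
  exact: (measurable_fun_size (fun n => (a ^+ n)%:E)).
have f0 (t : plist R) : 0 <= (a ^+ size t)%:E by rewrite lee_fin exprn_ge0.
elim: s => [|x s ih]; first by rewrite /= integral_ret_nil.
have := integral_branch_law_cat p P [:: x] s mf f0; rewrite cat1s => ->.
transitivity (\int[K [:: x]]_t ((genfun p a ^+ size s)%:E * (a ^+ size t)%:E)).
  apply: eq_integral => t _; under eq_integral do rewrite size_cat exprD EFinM.
  by rewrite ge0_integralZl_EFin// ?exprn_ge0// ih muleC.
rewrite ge0_integralZl_EFin// ?exprn_ge0// integral_branch_law1//.
rewrite (integral_offspring_size p P x (phi := fun n => (a ^+ n)%:E)); last first.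
  by move=> n; rewrite lee_fin exprn_ge0.
by rewrite Ef -EFinM exprS mulrC.
Qed.

(** All families of the initial particles must die out independently; conditioning on the first
    generation composes one more generating function. *)
Lemma generation_law_set_nil n s :
  gl n s [set [::]] = (genfun_iter p n 0 ^+ size s)%:E.
Proof.
elim: n s => [|n ih] s.
  rewrite /= diracE; case: s => [|x s]; first by rewrite mem_set.
  by rewrite memNset// expr0n.
rewrite generation_lawSr; last exact: measurable_set_nil.
rewrite -[RHS](integral_branch_genfun s (genfun_iter01 n)).
by apply: eq_integral => t _; exact: ih.
Qed.

Lemma generation_law_nonnil n s :
  gl n s (~` [set [::]]) = (1 - genfun_iter p n 0 ^+ size s)%:E.
Proof.
have gT k : gl k s setT = 1.
  elim: k s => [|k ih] s; first by rewrite /= diracT.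
  rewrite generation_lawSr//.
  under eq_integral do rewrite ih.
  by rewrite (integral_mass1 _ (branch_law_mass1 p P s)).
have mN := measurable_set_nil (R := R).
have E : gl n s setT = gl n s [set [::]] + gl n s (~` [set [::]]).
  by rewrite -(setUv [set [::]]); exact: (measureU (gl n s) mN (measurableC mN) (setICr _)).
move: E; rewrite gT generation_law_set_nil => E.
by rewrite EFinB E addeAC subee// add0e.
Qed.

End branch.

(* Kolmogorov's estimate [1 - f (1 - q) >= m q - M2 q ^ 2]. *)
Lemma genfun_lower (q : R) : (0 <= q <= 1)%R -> forall m M2 : R,
  \int[p]_j j%:R%:E = m%:E -> \int[p]_j (j%:R ^+ 2)%:E = M2%:E ->
  (genfun p (1 - q) + m * q <= 1 + M2 * q ^+ 2)%R.
Proof.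
move=> /andP[q0 q1] m M2 pm pM2.
have a01 : (0 <= 1 - q <= 1)%R by rewrite subr_ge0 q1 gerBl.
have /andP[a0 a1] := a01.
have [Ef _] := integral_genfun a01.
have bern j : (1 - j%:R * q <= (1 - q) ^+ j)%R.
  elim: j => [|j ih]; first by rewrite mul0r subr0 expr0.
  have jq : (0 <= j%:R * q ^+ 2)%R by rewrite mulr_ge0// exprn_ge0.
  rewrite exprS; apply: (@le_trans _ _ ((1 - q) * (1 - j%:R * q))%R); last first.
    by rewrite ler_wpM2l.
  by rewrite -natr1; lra.
(* Integrated against [p], this is the claim. In the induction, the increment
   [q * (1 - (1 - q) ^ j)] is at most [j * q ^ 2] by Bernoulli's inequality [bern]. *)
have pw j : ((1 - q) ^+ j + j%:R * q <= 1 + j%:R ^+ 2 * q ^+ 2)%R.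
  elim: j => [|j ih]; first by rewrite expr0 mul0r expr0n mul0r.
  have := bern j; rewrite exprS -natr1 => b.
  have jq : (0 <= j%:R * q ^+ 2)%R by rewrite mulr_ge0// exprn_ge0.
  have q2 : (0 <= q ^+ 2)%R by rewrite exprn_ge0.
  have qb : (0 <= q * ((1 - q) ^+ j - (1 - j%:R * q)))%R.
    by rewrite mulr_ge0// subr_ge0.
  by lra.
rewrite -lee_fin !EFinD [(m * q)%:E]EFinM [(M2 * q ^+ 2)%:E]EFinM -pm -pM2 -Ef.
rewrite -[1%:E](integral_mass1 1 (probability_setT p)).
have t1 (j : nat) : 0 <= j%:R%:E * q%:E by rewrite mule_ge0// lee_fin.
have t2 j : 0 <= ((1 - q) ^+ j)%:E by rewrite lee_fin exprn_ge0.
have t3 (j : nat) : 0 <= (j%:R ^+ 2)%:E * (q ^+ 2)%:E by rewrite mule_ge0// lee_fin exprn_ge0.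
have Q2 : 0 <= (q ^+ 2)%:E by rewrite lee_fin exprn_ge0.
have J2 (j : nat) : [set: nat] j -> 0 <= (j%:R ^+ 2)%:E :> \bar R.
  by rewrite lee_fin exprn_ge0.
rewrite -ge0_integralZr// -ge0_integralZr//.
rewrite -ge0_integralD// -ge0_integralD//.
apply: ge0_le_integral => //.
  by move=> j _; rewrite adde_ge0.
by move=> j _; rewrite -!EFinM -!EFinD lee_fin.
Qed.

(** A positive mean provides some [j > 0] of positive probability, and [1 - genfun p a] is at least
    its contribution [(1 - a ^ j) * p_j]. *)
Lemma genfun_lt1 (a : R) : (0 <= a < 1)%R -> 0 < mean p -> (genfun p a < 1)%R.
Proof.
move=> /andP[a0 a1] mean0.
have a01 : (0 <= a <= 1)%R by rewrite a0 ltW.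
have [Ef _] := integral_genfun a01.
have [j [j1 pj]] : exists j, (0 < j)%N /\ (0 < offspring_prob p j)%R.
  apply: contrapT => h; move: mean0; rewrite /mean eseries0 ?ltxx// => j _ _.
  have [->|j0] := posnP j; first by rewrite mul0r.
  suff -> : offspring_prob p j = 0%R by rewrite mulr0.
  apply/eqP; rewrite eq_le fine_ge0// andbT leNgt; apply/negP => pj.
  by apply: h; exists j.
have E : (genfun p a)%:E + \int[p]_k (1 - a ^+ k)%:E = 1.
  rewrite -Ef -ge0_integralD//.
  - under eq_integral do rewrite -EFinD addrC subrK.
    exact: (integral_mass1 _ (probability_setT p)).
  - by move=> k _; rewrite lee_fin exprn_ge0.
  - by move=> k _; rewrite lee_fin subr_ge0 exprn_ile1// ltW.
have lo : ((1 - a ^+ j) * offspring_prob p j)%:E <= \int[p]_k (1 - a ^+ k)%:E.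
  rewrite integral_pmf; last by move=> k; rewrite lee_fin subr_ge0 exprn_ile1// ltW.
  apply: le_trans (nneseries_lim_ge j.+1 _); last first.
    move=> k _ _; rewrite mule_ge0// lee_fin ?fine_ge0//.
    by rewrite subr_ge0 exprn_ile1// ltW.
  rewrite big_nat_recr//= -EFinM leeDr// sume_ge0// => k _.
  rewrite mule_ge0// lee_fin ?fine_ge0//.
  by rewrite subr_ge0 exprn_ile1// ltW.
have pos : (0 < (1 - a ^+ j) * offspring_prob p j)%R.
  by rewrite mulr_gt0// subr_gt0 exprn_ilt1// -lt0n.
rewrite -lte_fin -E lteDl//; apply: lt_le_trans lo; rewrite lte_fin//.
Qed.

Lemma genfun_iter_lt1 n : 0 < mean p -> (genfun_iter p n 0 < 1)%R.
Proof.
move=> mean0; elim: n => [|n ih]; first by rewrite /genfun_iter/= ltr01.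
by apply: genfun_lt1 => //; rewrite ih andbT; have /andP[] := genfun_iter01 n.
Qed.

End generating_function.

Section kolmogorov.
Context {R : realType}.

(** The ratio [w n = q n / m ^ n] loses at most a factor [1 - C' * m ^ n] at each step, and the
    infinite product of these factors, taken from a late enough rank, is at least [1 / 2]. *)
Lemma almost_geometric_lower_bound (q : nat -> R) (m C : R) : 0 < m -> m < 1 -> 0 <= C ->
  (forall n, 0 < q n) -> (forall n, m * q n <= q n.+1 + C * m ^+ n * q n) ->
  exists2 delta, 0 < delta & \forall n \near \oo, delta <= q n / m ^+ n.
Proof.
move=> m0 m1 C0 q0 qS.
have mn0 k : 0 < m ^+ k by rewrite exprn_gt0.
pose w n := q n / m ^+ n.
have w0 n : 0 < w n by rewrite divr_gt0.
pose C' := C / m; have C'0 : 0 <= C' by rewrite divr_ge0// ltW.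
have wS n : w n * (1 - C' * m ^+ n) <= w n.+1.
  rewrite /w ler_pdivlMr//.
  have -> : q n / m ^+ n * (1 - C' * m ^+ n) * m ^+ n.+1 = m * q n - C * m ^+ n * q n.
    by rewrite /C' exprS; field; rewrite !gt_eqF.
  by have := qS n; lra.
have tail : C' / (1 - m) * m ^+ n @[n --> \oo] --> (0 : R).
  by apply: cvg_geometric; rewrite gtr0_norm.
have h2 : 0 < 1 / 2 :> R by rewrite divr_gt0.
(* From rank [N] on, the sum of all the terms [C' * m ^ n] is at most [1 / 2]. *)
have [N _ hN] := ((cvgrPdist_le _ _).1 tail _ h2).
have {}hN : C' / (1 - m) * m ^+ N <= 1 / 2.
  by have := hN N (leqnn N); rewrite sub0r normrN => /(le_trans (ler_norm _)).
exists (w N / 2); first by rewrite divr_gt0.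
have m1' : 0 < 1 - m by rewrite subr_gt0.
pose T := C' / (1 - m) * m ^+ N.
have T0 : 0 <= T by rewrite mulr_ge0 ?exprn_ge0 ?divr_ge0// ltW.
(* A product of factors [1 - a_i] is at least [1] minus the sum of the [a_i]; here the partial sum
   of [C' * m ^ (N + i)] over [i < k] is [T * (1 - m ^ k)]. *)
have claim k : w N * (1 - T * (1 - m ^+ k)) <= w (N + k)%N.
  elim: k => [|k ih]; first by rewrite addn0 expr0 subrr mulr0 subr0 mulr1.
  rewrite addnS; apply: le_trans (wS _).
  have mk1 : m ^+ k <= 1 by rewrite exprn_ile1// ltW.
  have E : C' * m ^+ (N + k) = T * (m ^+ k * (1 - m)).
    by rewrite /T exprD; field; rewrite gt_eqF.
  have small : 0 <= 1 - C' * m ^+ (N + k).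
    rewrite E subr_ge0; apply: (@le_trans _ _ (T * 1)); last by rewrite mulr1 /T; lra.
    by apply: ler_wpM2l => //; have := mn0 k; nra.
  apply: le_trans (ler_wpM2r small ih).
  rewrite -[leRHS]mulrA; apply: ler_wpM2l; first exact: ltW.
  rewrite E exprS.
  have A0 : 0 <= T * (1 - m ^+ k) by rewrite mulr_ge0// subr_ge0.
  have B0 : 0 <= T * (m ^+ k * (1 - m)).
    by apply: mulr_ge0 => //; apply: mulr_ge0; exact: ltW.
  have : 0 <= T * (1 - m ^+ k) * (T * (m ^+ k * (1 - m))) by rewrite mulr_ge0.
  lra.
exists N => // n /= Nn; rewrite -/(w n) -(subnKC Nn); apply: le_trans (claim _).
apply: ler_wpM2l; first exact: ltW.
have hT : T <= 1 / 2 by [].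
have hM : T * (1 - m ^+ (n - N)) <= T by rewrite ler_piMr// gerBl ltW.
lra.
Qed.

End kolmogorov.

(** * Integrals under setwise convergence *)

Section setwise_convergence.
Context d (T : measurableType d) {R : realType}.
Local Open Scope ereal_scope.

(** The sum counts the levels [i + 1 <= N * y], hence equals the integer part of [N * y]. *)
Lemma staircase_approx (y : R) (N : nat) : (0 < N)%N -> (0 <= y <= 1)%R ->
  ((\sum_(i < N) (i.+1%:R <= N%:R * y)%R%:R) / N%:R <= y <=
   ((\sum_(i < N) (i.+1%:R <= N%:R * y)%R%:R) + 1) / N%:R)%R.
Proof.
move=> N0 /andP[y0 y1]; have N0' : (0 < N%:R :> R)%R by rewrite ltr0n.
have Ny0 : (0 <= N%:R * y)%R by rewrite mulr_ge0.
set k := Num.truncn (N%:R * y)%R.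
have kN : (k <= N)%N.
  have tk : (k%:R <= N%:R * y)%R by rewrite truncn_le.
  by rewrite -(ler_nat R) (le_trans tk)// ler_piMr// ltW.
have E M : (\sum_(i < M) (i.+1%:R <= N%:R * y)%R%:R = (minn M k)%:R :> R)%R.
  elim: M => [|M ih]; first by rewrite big_ord0 min0n.
  rewrite big_ord_recr/= ih -truncn_ge_nat// -/k -natrD; congr (_%:R)%R.
  by lia.
rewrite E (minn_idPr kN) ler_pdivrMr// ler_pdivlMr// [(y * N%:R)%R]mulrC.
by rewrite truncn_le Ny0/= natr1 ltW// truncnS_gt.
Qed.

(** The integral is compared with finitely many measures of level sets, with an error controlled by
    the total mass alone; setwise convergence then yields convergence of integrals. *)
Lemma integral_staircase (mu : {measure set T -> \bar R}) (F : T -> R) (N : nat) :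
  mu setT < +oo -> measurable_fun setT F -> (forall x, (0 <= F x <= 1)%R) -> (0 < N)%N ->
  (`|fine (\int[mu]_x (F x)%:E) -
     (\sum_(i < N) fine (mu [set x | i.+1%:R <= N%:R * F x])) / N%:R|
    <= fine (mu setT) / N%:R)%R.
Proof.
move=> muoo mF F01 N0; have N0' : (0 < N%:R :> R)%R by rewrite ltr0n.
pose A i := [set x | (i.+1%:R <= N%:R * F x)%R].
have mA i : measurable (A i).
  rewrite (_ : A i = (fun x => (i.+1%:R <= N%:R * F x)%R) @^-1` [set true]).
    rewrite -[X in measurable X]setTI; apply: measurable_fun_ler => //.
    exact: measurable_funM.
  by apply/seteqP; split => x /=.
have mufin B : measurable B -> mu B \is a fin_num.
  move=> mB; rewrite ge0_fin_numE//; apply: le_lt_trans muoo.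
  by apply: le_measure; rewrite ?inE.
pose S x := ((\sum_(i < N) (\1_(A i) x : R)) / N%:R)%R.
have SE x : (S x = (\sum_(i < N) (i.+1%:R <= N%:R * F x)%R%:R) / N%:R)%R.
  congr (_ / _)%R; apply: eq_bigr => i _; rewrite indicE; congr (_%:R)%R.
  by case: (boolP (_ <= _)%R) => h; [rewrite mem_set|rewrite memNset//; apply/negP].
have mS : measurable_fun setT (fun x => (S x)%:E).
  apply/measurable_EFinP; apply: measurable_funM => //.
  by apply: measurable_sum => i; exact: measurable_indic.
have S0 x : (0 <= S x)%R.
  by rewrite divr_ge0// sumr_ge0.
have IS : \int[mu]_x (S x)%:E = ((\sum_(i < N) fine (mu (A i))) / N%:R)%R%:E.
  rewrite (_ : (fun x => _) = fun x => (N%:R^-1)%:E * \sum_(i < N) (\1_(A i) x)%:E); last first.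
    by apply/funext => x; rewrite sumEFin -EFinM mulrC.
  rewrite ge0_integralZl_EFin ?invr_ge0//; last 2 first.
  - by move=> x _; rewrite sume_ge0// => i _; rewrite lee_fin.
  - by apply: emeasurable_sum => i; exact/measurable_EFinP/measurable_indic.
  rewrite ge0_integral_sum//; last by move=> i; exact/measurable_EFinP/measurable_indic.
  rewrite [in RHS]mulrC EFinM -sumEFin; congr (_ * _); apply: eq_bigr => i _.
  by rewrite integral_indicE// fineK// mufin.
have mF' : measurable_fun setT (fun x => (F x)%:E) by exact/measurable_EFinP.
have F0 x : 0 <= (F x)%:E by rewrite lee_fin; have /andP[] := F01 x.
have hlo : \int[mu]_x (S x)%:E <= \int[mu]_x (F x)%:E.
  apply: ge0_le_integral => // x _; rewrite lee_fin ?S0// SE.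
  by have /andP[] := staircase_approx N0 (F01 x).
have hup : \int[mu]_x (F x)%:E <= \int[mu]_x (S x)%:E + (N%:R^-1)%:E * mu setT.
  have c0 (x : T) : 0 <= (N%:R^-1)%:E :> \bar R by rewrite lee_fin invr_ge0.
  have S0' x : [set: T] x -> 0 <= (S x)%:E by rewrite lee_fin.
  rewrite -(integral_cst _ measurableT) -ge0_integralD//; last by move=> x _; exact: c0.
  apply: ge0_le_integral => //; first exact: emeasurable_funD.
  move=> x _; rewrite -EFinD lee_fin SE.
  by have /andP[_] := staircase_approx N0 (F01 x); rewrite mulrDl mul1r.
have Ifin : \int[mu]_x (F x)%:E \is a fin_num.
  rewrite ge0_fin_numE; last exact: integral_ge0.
  apply: (le_lt_trans hup); rewrite IS -(fineK (mufin _ measurableT)) -EFinM -EFinD.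
  exact: ltry.
move: hlo hup; rewrite IS -(fineK Ifin) -(fineK (mufin _ measurableT)) -EFinM -EFinD !lee_fin.
set a := fine (\int[mu]_x _); set b := (_ / N%:R)%R => lo up.
by rewrite ger0_norm ?subr_ge0// lerBlDl [X in (_ <= _ + X)%R]mulrC.
Qed.

Lemma setwise_integral_cvg (mu : nat -> {measure set T -> \bar R})
    (nu : {measure set T -> \bar R}) (F : T -> R) :
  (forall n, mu n setT < +oo) -> nu setT < +oo ->
  (forall A, measurable A -> fine (mu n A) @[n --> \oo] --> fine (nu A)) ->
  measurable_fun setT F -> (forall x, (0 <= F x <= 1)%R) ->
  fine (\int[mu n]_x (F x)%:E) @[n --> \oo] --> fine (\int[nu]_x (F x)%:E).
Proof.
move=> muoo nuoo munu mF F01; apply/cvgrPdist_le => e e0.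
set t := fine (nu setT).
have t0 : (0 <= t)%R by rewrite fine_ge0.
(* This [N] makes both staircase errors at most [e / 4]: the mass of [mu n] is eventually at most
   [t + 1]. *)
pose N := (Num.truncn (4 * (t + 1) / e)%R).+1.
have N0 : (0 < N)%N by [].
have N0' : (0 < N%:R :> R)%R by rewrite ltr0n.
have tN : ((t + 1) / N%:R <= e / 4)%R.
  rewrite ler_pdivrMr// -ler_pdivrMl ?divr_gt0//.
  rewrite invf_div; apply: ltW; apply: le_lt_trans (truncnS_gt _).
  by rewrite le_eqVlt; apply/orP; left; apply/eqP; field; rewrite gt_eqF.
pose S n := ((\sum_(i < N) fine (mu n [set x | i.+1%:R <= N%:R * F x])) / N%:R)%R.
pose Soo := ((\sum_(i < N) fine (nu [set x | i.+1%:R <= N%:R * F x])) / N%:R)%R.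
have mA i : measurable [set x | (i.+1%:R <= N%:R * F x)%R].
  rewrite (_ : [set x | _] = (fun x => (i.+1%:R <= N%:R * F x)%R) @^-1` [set true]).
    rewrite -[X in measurable X]setTI; apply: measurable_fun_ler => //.
    exact: measurable_funM.
  by apply/seteqP; split => x /=.
have Scvg : S n @[n --> \oo] --> Soo.
  suff sumcvg M : (\sum_(i < M) fine (mu n [set x | i.+1%:R <= N%:R * F x]))%R @[n --> \oo]
      --> (\sum_(i < M) fine (nu [set x | i.+1%:R <= N%:R * F x]))%R.
    by apply: cvgMl; exact: sumcvg.
  elim: M => [|M ih].
    by rewrite big_ord0; under eq_fun do rewrite big_ord0; exact: cvg_cst.
  rewrite big_ord_recr/=; under eq_fun do rewrite big_ord_recr/=.
  by apply: cvgD => //; exact: munu.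
have h1 := integral_staircase nuoo mF F01 N0; rewrite -/Soo -/t in h1.
have e4 : (0 < e / 4)%R by rewrite divr_gt0.
near=> n.
have h2 := integral_staircase (muoo n) mF F01 N0; rewrite -/(S n) in h2.
have h3 : (`|Soo - S n| <= e / 4)%R.
  by near: n; exact: ((cvgrPdist_le _ _).1 Scvg _ e4).
have h4 : (`|t - fine (mu n setT)| <= 1)%R.
  by near: n; exact: ((cvgrPdist_le _ _).1 (munu _ measurableT) _ ltr01).
have h5 : (fine (mu n setT) / N%:R <= e / 4)%R.
  apply: le_trans tN; rewrite ler_pM2r ?invr_gt0//.
  by move: h4; rewrite ler_norml => /andP[? ?]; lra.
have h6 : (t / N%:R <= e / 4)%R.
  by apply: le_trans tN; rewrite ler_pM2r ?invr_gt0// lerDl.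
have h7 := le_trans h1 h6; have h8 := le_trans h2 h5.
move: h3 h7 h8; rewrite !ler_norml => /andP[? ?] /andP[? ?] /andP[? ?].
by apply/andP; split; lra.
Unshelve. all: by end_near. Qed.

End setwise_convergence.

(** * From the branching Markov chain to the kernel *)

(* The ways to distribute [J] children among [n] parents. *)
Fixpoint compositions (n J : nat) : seq (seq nat) :=
  if n is n'.+1 then
    flatten [seq [seq k :: c | c <- compositions n' (J - k)] | k <- iota 0 J.+1]
  else if J == 0%N then [:: [::]] else [::].

Lemma compositionsS n J : compositions n.+1 J =
  flatten [seq [seq k :: c | c <- compositions n (J - k)] | k <- iota 0 J.+1].
Proof. by []. Qed.

Lemma mem_compositions n J c :
  (c \in compositions n J) = (size c == n) && (sumn c == J).
Proof.
elim: n J c => [|n ih] J c.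
  by case: J => [|J]; case: c.
rewrite compositionsS.
apply/idP/andP => [/flattenP[_ /mapP[k + ->]]|[]].
  rewrite mem_iota add0n ltnS => /= kJ /mapP[c' + ->] /=.
  by rewrite ih => /andP[/eqP <- /eqP ->]; rewrite subnKC.
case: c => [//|k c] /eqP[cn] /eqP kc; rewrite [sumn _]/= in kc.
have kJ : (k <= J)%N by rewrite -kc leq_addr.
apply/flattenP; exists [seq k :: c' | c' <- compositions n (J - k)].
  by apply/mapP; exists k; rewrite // mem_iota add0n ltnS.
by apply/mapP; exists c => //; rewrite ih cn eqxx/= -kc addKn.
Qed.

Lemma uniq_compositions n J : uniq (compositions n J).
Proof.
elim: n J => [|n ih] J; first by rewrite /=; case: eqP.
rewrite compositionsS.
have := @allpairs_uniq_dep _ (fun=> seq nat) _ (fun k c => k :: c)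
  (iota 0 J.+1) (fun k => compositions n (J - k)).
apply; first exact: iota_uniq.
- by move=> k _; exact: ih.
- by move=> [k1 c1] [k2 c2] _ _ /= [-> ->].
Qed.

Section branch_law_boxes.
Context {R : realType}.
Local Notation plist := (plist R).
Local Notation RR := (measurableTypeR R).
Local Open Scope ereal_scope.
Variables (p : probability nat R) (P : R.-pker RR ~> RR).
Local Notation K := (branch_law p P).
Local Notation offs := (offspring_law p P).

Lemma hbox_cat J (b : nat -> R) (a t : seq R) :
  hbox J b (a ++ t) <-> [/\ (size a <= J)%N, hbox (size a) b a &
    hbox (J - size a) (fun i => b (size a + i)%N) t].
Proof.
split=> [[sz h]|[aJ [_ ha] [st ht]]].
  rewrite size_cat in sz; split.
  - by rewrite -sz leq_addr.
  - split=> // i ia; have := h i; rewrite nth_cat ia; apply.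
    by rewrite -sz ltn_addr.
  - split=> [|i it]; first by rewrite -sz addKn.
    have := h (size a + i)%N.
    rewrite nth_cat [(size a + i < size a)%N]ltnNge leq_addr/= addKn; apply.
    by rewrite -ltn_subRL.
split=> [|i iJ]; first by rewrite size_cat st subnKC.
rewrite nth_cat; case: ltnP => ai; first exact: ha.
by have := ht (i - size a)%N; rewrite subnKC//; apply; rewrite ltn_sub2r// (leq_ltn_trans ai).
Qed.

(** The length of [a] decides how many of the [J] bounds it consumes, so at most one term of the sum
    is nonzero. *)
Lemma cat_hbox_indic J (b : nat -> R) (nu : giry plist R) (a : plist) :
  nu [set t | hbox J b (a ++ t)] =
  \sum_(k < J.+1) (\1_(hbox k b) a)%:E * nu (hbox (J - k) (fun i => b (k + i)%N)).
Proof.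
have [[aJ ha]|H] := pselect ((size a <= J)%N /\ hbox (size a) b a).
  rewrite (bigD1 (Ordinal (aJ : (size a < J.+1)%N)))//= big1 ?adde0; last first.
    move=> k ka; rewrite indicE memNset ?mul0e// => -[sk _].
    by move: ka; rewrite -val_eqE /= sk eqxx.
  rewrite indicE mem_set// mul1e; congr (nu _); apply/seteqP; split => t /=.
    by move=> /hbox_cat[].
  by move=> ht; apply/hbox_cat.
rewrite big1 => [|k _]; last first.
  rewrite indicE memNset ?mul0e// => hk; apply: H; have [sk _] := hk.
  by rewrite sk; split => //; rewrite -ltnS.
rewrite (_ : [set t | _] = set0) ?measure0//; apply/seteqP; split => // t /=.
by move=> /hbox_cat[? ? _]; exact: H.
Qed.

Lemma measurable_cat_preimage (a : plist) (A : set plist) : measurable A ->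
  measurable ([set t | A (a ++ t)] : set plist).
Proof.
move=> mA; have m2 : measurable_fun setT (fun b : plist => (a, b)).
  by apply: measurable_fun_pair => //; exact: measurable_cst.
by have := (measurableT_comp measurable_cat m2) measurableT _ mA; rewrite setTI.
Qed.

Lemma giry_cat_set (mu nu : giry plist R) (A : set plist) : measurable A ->
  giry_cat mu nu A = \int[mu]_a nu [set t | A (a ++ t)].
Proof.
move=> mA; have mA1 : measurable_fun setT (fun s : plist => (\1_A s)%:E : \bar R).
  exact/measurable_EFinP/measurable_indic.
rewrite -[LHS]integral_indicE// integral_giry_cat//.
apply: eq_integral => a _; rewrite -integral_indicE//.
exact: measurable_cat_preimage.
Qed.

Lemma giry_cat_hbox (mu nu : giry plist R) J (b : nat -> R) :
  giry_cat mu nu (hbox J b) =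
  \sum_(k < J.+1) mu (hbox k b) * nu (hbox (J - k) (fun i => b (k + i)%N)).
Proof.
rewrite giry_cat_set; last exact: measurable_hbox.
under eq_integral do rewrite cat_hbox_indic.
have m1 (k : nat) : measurable_fun setT (fun a : plist => (\1_(hbox k b) a)%:E : \bar R).
  by apply/measurable_EFinP/measurable_indic; exact: measurable_hbox.
rewrite (ge0_integral_sum mu measurableT (f := fun (k : 'I_J.+1) a =>
  (\1_(hbox k b) a)%:E * nu (hbox (J - k) (fun i => b (k + i)%N)))); last 2 first.
- by move=> k; exact: emeasurable_funM.
- by move=> k a _; rewrite mule_ge0// lee_fin.
apply: eq_bigr => k _; rewrite ge0_integralZr//.
by rewrite integral_indicE//; exact: measurable_hbox.
Qed.

Lemma litter_law_hbox x j k (b : nat -> R) :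
  litter_law P x j (hbox k b) = if j == k then \prod_(i < k) P x `]-oo, b i]%classic else 0.
Proof.
elim: j k b => [|j ih] k b /=.
  rewrite diracE; case: k => [|k]; first by rewrite big_ord0 mem_set.
  by rewrite memNset// => -[].
rewrite giry_cat_set; last exact: measurable_hbox.
have mg : measurable_fun setT
    (fun a : plist => litter_law P x j [set t | hbox k b (a ++ t)]).
  under eq_fun do rewrite cat_hbox_indic.
  apply: emeasurable_sum => i; apply: emeasurable_funM; last exact: measurable_cst.
  by apply/measurable_EFinP/measurable_indic; exact: measurable_hbox.
rewrite integral_child_law//.
case: k mg => [|k] mg.
  rewrite integral0_eq// => y _.
  rewrite (_ : [set t | _] = set0) ?measure0//; apply/seteqP; split => // t.
  by move=> /hbox_cat[].
rewrite eqSS.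
transitivity (\int[P x]_y
    ((\1_(`]-oo, b 0%N]%classic) y)%:E * litter_law P x j (hbox k (b \o succn)))).
  apply: eq_integral => y _; rewrite indicE; case: (boolP (y \in _)) => yb.
    rewrite mul1e; congr (litter_law P x j _); apply/seteqP; split => t.
      by move=> /hbox_cat[_ _]; rewrite /= subn1.
    move=> ht; apply/hbox_cat; split => //=; last by rewrite subn1.
    split => // -[|//] _; move/set_mem: yb; rewrite /= in_itv//.
  rewrite mul0e (_ : [set t | _] = set0) ?measure0//; apply/seteqP; split => // t.
  move=> /hbox_cat[_ [_ /(_ 0%N isT) /= yb0] _].
  by move/negP: yb; apply; apply: mem_set; rewrite /= in_itv.
rewrite ge0_integralZr//; last first.
  exact/measurable_EFinP/measurable_indic.
rewrite integral_indicE// ih; case: eqP => _; last by rewrite mule0.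
by rewrite big_ord_recl.
Qed.

Lemma offspring_law_hbox x k (b : nat -> R) :
  offs x (hbox k b) = p [set k] * \prod_(i < k) P x `]-oo, b i]%classic.
Proof.
have mh := measurable_hbox k b.
have m1 : measurable_fun setT (fun s : plist => (\1_(hbox k b) s)%:E : \bar R).
  exact/measurable_EFinP/measurable_indic.
rewrite -[LHS]integral_indicE// integral_offspring_law//.
transitivity (\int[p]_j ((\1_[set k] j)%:E * \prod_(i < k) P x `]-oo, b i]%classic)).
  apply: eq_integral => j _.
  transitivity (litter_law P x j (hbox k b)); first exact: integral_indicE.
  rewrite litter_law_hbox indicE.
  case: eqP => [->|jk]; first by rewrite mem_set// mul1e.
  by rewrite memNset// mul0e.
have pr0 : 0 <= \prod_(i < k) P x `]-oo, b i]%classic by rewrite prode_ge0.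
by rewrite ge0_integralZr// integral_indicE.
Qed.

(** The integrand of [branching_property] for half-lines, with positions instead of labels; the
    bounds [b] are consumed litter after litter. The value for lists of different lengths is junk,
    since compositions have as many parts as there are parents. *)
Fixpoint litters_weight (xs : seq R) (ks : seq nat) (b : nat -> R) : \bar R :=
  match xs, ks with
  | x :: xs', k :: ks' => p [set k] * (\prod_(i < k) P x `]-oo, b i]%classic) *
      litters_weight xs' ks' (fun i => b (k + i)%N)
  | _, _ => 1
  end.

Lemma branch_law_hbox xs J (b : nat -> R) :
  K xs (hbox J b) = \sum_(ks <- compositions (size xs) J) litters_weight xs ks b.
Proof.
elim: xs J b => [|x xs ih] J b.
  rewrite /= diracE; case: J => [|J] /=; first by rewrite big_seq1 mem_set.
  by rewrite big_nil memNset// => -[].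
rewrite [K _]/= giry_cat_hbox compositionsS big_flatten big_map.
rewrite -(big_mkord xpredT (fun k => offs x (hbox k b) *
  K xs (hbox (J - k) (fun i => b (k + i)%N)))) /index_iota subn0.
apply: eq_bigr => k _; rewrite offspring_law_hbox ih big_map.
rewrite ge0_sume_distrr// => ks _.
elim: xs ks (fun i => b (k + i)%N) {ih} => [|y ys ih] [|j js] b'//=.
by rewrite mule_ge0// mule_ge0// prode_ge0.
Qed.

End branch_law_boxes.

(** * Family trees and their labels *)

Section labels.

(** [children] with litter sizes given by a plain function instead of a point of the probability
    space, so that the next generation is constant on each event fixing the parents and their litter
    sizes. *)
Definition children_of (k : seq nat -> nat) (s : seq (seq nat)) : seq (seq nat) :=
  flatten [seq [seq i :: u | i <- iota 0 (k u)] | u <- s].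

Lemma children_of_cons k u s :
  children_of k (u :: s) = [seq i :: u | i <- iota 0 (k u)] ++ children_of k s.
Proof. by []. Qed.

Lemma mem_children_of k s c :
  (c \in children_of k s) <-> exists2 u, u \in s & exists2 i, (i < k u)%N & c = i :: u.
Proof.
split.
  move=> /flattenP[_ /mapP[u us ->] /mapP[i]]; rewrite mem_iota => ik ->.
  by exists u => //; exists i.
move=> [u us [i ik ->]]; apply/flattenP; exists [seq j :: u | j <- iota 0 (k u)].
  by apply/mapP; exists u.
by apply/mapP; exists i => //; rewrite mem_iota.
Qed.

Lemma uniq_children_of k s : uniq s -> uniq (children_of k s).
Proof.
elim: s => [//|u s ih] /= /andP[us uniqs]; rewrite children_of_cons cat_uniq ih// andbT.
rewrite map_inj_uniq ?iota_uniq/=; last by move=> i j [].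
apply/hasPn => c /mem_children_of[v vs [i _ ->]]; apply/mapP => -[j _ [_ vu]].
by move: us; rewrite -vu vs.
Qed.

Lemma size_children_of k s : size (children_of k s) = sumn [seq k u | u <- s].
Proof.
by elim: s => [//|u s ih] /=; rewrite children_of_cons size_cat size_map size_iota ih.
Qed.

Lemma eq_in_children_of k k' s : {in s, k =1 k'} -> children_of k s = children_of k' s.
Proof. by move=> kk'; congr flatten; apply/eq_in_map => u us; rewrite kk'. Qed.

End labels.

Section litters_product.
Context {R : realType}.
Local Open Scope ereal_scope.
Variables (p : probability nat R) (P : R.-pker (measurableTypeR R) ~> (measurableTypeR R)).

(** Labels are distinct, so [index] recovers the rank of a child among all children: bounds indexed
    by rank become sets indexed by labels. *)
Lemma litters_weightE U (k : seq nat -> nat) (y : seq nat -> R) (b : nat -> R) : uniq U ->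
  \prod_(u <- U) (p [set k u] *
    \prod_(i < k u) P (y u) `]-oo, b (index (val i :: u) (children_of k U))]%classic) =
  litters_weight p P (map y U) (map k U) b.
Proof.
elim: U b => [|u U ih] b /=; first by rewrite big_nil.
move=> /andP[uU uniqU]; rewrite big_cons children_of_cons.
set fam := [seq i :: u | i <- iota 0 (k u)].
have sf : size fam = k u by rewrite size_map size_iota.
have uf : uniq fam by rewrite map_inj_uniq ?iota_uniq// => i j [].
congr (_ * _ * _).
  apply: eq_bigr => i _; rewrite index_cat.
  have ni : nth [::] fam i = val i :: u by rewrite (nth_map 0%N) ?size_iota// nth_iota.
  have -> : val i :: u \in fam by rewrite -ni mem_nth// sf.
  by rewrite -[in index _ fam]ni index_uniq// sf.
rewrite -ih//; apply: eq_big_seq => v vU; congr (_ * _); apply: eq_bigr => i _.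
rewrite index_cat sf.
have -> : (val i :: v \in fam) = false.
  apply/mapP => -[j _ [_ vu]]; by move: uU; rewrite -vu vU.
by [].
Qed.

End litters_product.

Section family_tree.
Context {R : realType} (p : probability nat R).
Variable P : R.-pker (measurableTypeR R) ~> (measurableTypeR R).
Context d (Omega : measurableType d).
Variables (nchild : seq nat -> Omega -> nat) (pos : seq nat -> Omega -> R).
Hypothesis mnchild : forall u, measurable_fun setT (nchild u).
Hypothesis mpos : forall u, measurable_fun setT (pos u : Omega -> measurableTypeR R).
Local Open Scope ereal_scope.
Local Notation plist := (plist R).
Local Notation gen := (generation nchild).
Local Notation hist := (history nchild pos).

Definition positions (n : nat) (w : Omega) : plist := [seq pos u w | u <- gen n w].

Lemma generationS n w :
  gen n.+1 w = children_of (fun u => nchild u w) (gen n w).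
Proof. by []. Qed.

Lemma uniq_generation n w : uniq (gen n w).
Proof.
suff : forall k, uniq (iter k (children nchild w) [:: [::]]) by apply.
by elim=> [//|k ih] /=; exact: uniq_children_of.
Qed.

Lemma measurable_litter_sizes V ks :
  measurable [set w | [seq nchild u w | u <- V] = ks].
Proof.
elim: V ks => [|u V ih] [|k ks].
- by rewrite (_ : [set _ | _] = setT)//; apply/seteqP.
- by rewrite (_ : [set _ | _] = set0)//; apply/seteqP; split.
- by rewrite (_ : [set _ | _] = set0)//; apply/seteqP; split.
rewrite (_ : [set _ | _] = nchild u @^-1` [set k] `&` [set w | [seq nchild u w | u <- V] = ks]).
  apply: measurableI => //; rewrite -[X in measurable X]setTI; exact: mnchild.
by apply/seteqP; split => w /= [-> ->].
Qed.

Lemma measurable_generation n U : measurable [set w | gen n w = U].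
Proof.
rewrite /generation; elim: n.+1 U => [|k ih] U.
  have [<-|neq] := eqVneq [:: [::]] U.
    by rewrite (_ : [set _ | _] = setT)//; apply/seteqP.
  by rewrite (_ : [set _ | _] = set0)//; apply/seteqP; split => w //= /eqP; rewrite (negbTE neq).
(* [c V ks] is the generation that follows [V] when its litter sizes are [ks]; there are only
   countably many such pairs. *)
pose c V ks := children_of (fun u => nth 0%N ks (index u V)) V.
rewrite (_ : [set _ | _] = \bigcup_(Vks : seq (seq nat) * seq nat)
    ([set w | uniq Vks.1 /\ iter k (children nchild w) [:: [::]] = Vks.1] `&`
     [set w | [seq nchild u w | u <- Vks.1] = Vks.2] `&`
     [set w | c Vks.1 Vks.2 = U])).
  apply: countable_bigcupT_measurable; first exact: countableP.
  move=> [V ks] /=; apply: measurableI; last first.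
    have [<-|neq] := eqVneq (c V ks) U.
      by rewrite (_ : [set _ | _] = setT)//; apply/seteqP.
    by rewrite (_ : [set _ | _] = set0)//; apply/seteqP; split => w //= /eqP; rewrite (negbTE neq).
  apply: measurableI; last exact: measurable_litter_sizes.
  have [uV|uV] := boolP (uniq V).
    by rewrite (_ : [set _ | _] = [set w | iter k (children nchild w) [:: [::]] = V])//;
       apply/seteqP; split => w /=; [case|split].
  rewrite (_ : [set _ | _] = set0)//; apply/seteqP; split => // w /= [uV' _].
  by move/negP: uV; apply.
have cE V w : uniq V -> children nchild w V = c V [seq nchild u w | u <- V].
  move=> uV; apply: eq_in_children_of => u uV'.
  by rewrite (nth_map [::]) ?index_mem// nth_index.
apply/seteqP; split => [w /= wU|w [[V ks] _ /= [[[uV wV] <-] cU]]]; last first.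
  by rewrite wV cE.
have uk : uniq (iter k (children nchild w) [:: [::]]).
  by elim: (k) => [//|j ihj] /=; exact: uniq_children_of.
exists (iter k (children nchild w) [:: [::]],
  [seq nchild u w | u <- iter k (children nchild w) [:: [::]]]) => //=.
by split => //; rewrite -cE.
Qed.

Lemma measurable_all_pos (U : seq (seq nat)) (A : seq nat -> set R) :
  (forall u, measurable (A u)) ->
  measurable [set w | forall u, u \in U -> A u (pos u w)].
Proof.
move=> mA; elim: U => [|u U ih].
  by rewrite (_ : [set _ | _] = setT)//; apply/seteqP.
rewrite (_ : [set _ | _] = pos u @^-1` A u `&` [set w | forall u, u \in U -> A u (pos u w)]).
  apply: measurableI => //; rewrite -[X in measurable X]setTI; exact: (mpos u measurableT (mA u)).
apply/seteqP; split => w /=.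
  by move=> h; split => [|v vU]; apply: h; rewrite inE ?eqxx// vU orbT.
by move=> [h1 h2] v; rewrite inE => /orP[/eqP->//|]; exact: h2.
Qed.

Lemma history_measurable n E : hist n E -> measurable E.
Proof.
apply: smallest_sub; first exact: sigma_algebra_measurable.
move=> _ [k [U [A [_ mA ->]]]].
rewrite (_ : [set _ | _] =
  [set w | gen k w = U] `&` [set w | forall u, u \in U -> A u (pos u w)])//.
apply: measurableI; first exact: measurable_generation.
exact: measurable_all_pos.
Qed.

Lemma history_le n n' : (n <= n')%N -> hist n `<=` hist n'.
Proof.
move=> nn'; apply: smallest_sub; first exact: smallest_sigma_algebra.
move=> _ [k [U [A [kn mA ->]]]]; apply: sub_sigma_algebra.
by exists k, U, A; split => //; exact: leq_trans nn'.
Qed.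

Lemma history_positions n (B : set plist) : measurable B ->
  hist n (positions n @^-1` B).
Proof.
apply: (@smallest_sub _ _ _ [set B | hist n (positions n @^-1` B)]).
  split => /=.
  - by rewrite preimage_set0; exact: sigma_algebra0.
  - by move=> A hA; rewrite setTD preimage_setC -setTD; exact: sigma_algebraCD.
  - by move=> F hF; rewrite preimage_bigcup; exact: sigma_algebra_bigcup.
move=> _ [->|[J [b ->]]] /=; first by rewrite preimage_set0; exact: sigma_algebra0.
(* The box is cut according to the value [U] of the generation, among countably many. On each piece
   the rank of a particle is a function of its label, which gives a generator of the history. *)
pose C U := [set w | gen n w = U /\
  forall u, u \in U -> `]-oo, b (index u U)]%classic (pos u w)].
pose F (k : nat) :=
  if unpickle k is Some U then if uniq U && (size U == J) then C U else set0 else set0.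
rewrite (_ : _ @^-1` _ = \bigcup_k F k).
  suff hF k : hist n (F k) by exact: sigma_algebra_bigcup.
  rewrite /F; case: (unpickle k) => [U|]; last exact: sigma_algebra0.
  case: ifP => _; last exact: sigma_algebra0.
  apply: sub_sigma_algebra; exists n, U, (fun u => `]-oo, b (index u U)]%classic).
  by split => //= u; exact: measurable_itv.
apply/seteqP; split => w.
  rewrite /hbox /= /positions size_map => -[sJ hw].
  exists (pickle (gen n w)) => //; rewrite /F pickleK uniq_generation sJ eqxx /=.
  split => // u ug; rewrite /= in_itv/=.
  have := hw (index u (gen n w)); rewrite -sJ index_mem => /(_ ug).
  by rewrite (nth_map [::]) ?index_mem// nth_index.
move=> [k _]; rewrite /F; case: (unpickle k) => [U|//]; case: ifP => // /andP[uU /eqP sU] [gU hU].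
rewrite /hbox /positions /= size_map gU; split => // i iJ.
rewrite (nth_map [::]) ?sU//.
have := hU (nth [::] U i); rewrite mem_nth ?sU// => /(_ isT).
by rewrite /= in_itv/= index_uniq ?sU.
Qed.

Lemma measurable_positions n : measurable_fun setT (positions n).
Proof.
move=> _ B mB; rewrite setTI; apply: (@history_measurable n).
exact: history_positions.
Qed.

End family_tree.

Section partitions.
Context {R : realType} d (T : measurableType d).
Local Open Scope ereal_scope.

Lemma measure_partition_seq (mu : {measure set T -> \bar R}) (I : eqType) (g : T -> I)
    (L : seq I) (S : set T) : uniq L -> (forall i, measurable (S `&` [set w | g w = i])) ->
  (forall w, S w -> g w \in L) -> mu S = \sum_(i <- L) mu (S `&` [set w | g w = i]).
Proof.
move=> + mS; elim: L S mS => [|i L ih] S mS.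
  move=> _ h; rewrite big_nil (_ : S = set0) ?measure0//.
  by apply/seteqP; split => // w /h.
move=> /= /andP[iL uL] h.
have E : S = (S `&` [set w | g w = i]) `|` (S `&` [set w | g w \in L]).
  rewrite -setIUr; apply/esym/setIidPl => w Sw; have := h w Sw.
  by rewrite inE => /orP[/eqP|]; [left|right].
have EL : S `&` [set w | g w \in L] = \bigcup_(j in [set` L]) (S `&` [set w | g w = j]).
  apply/seteqP; split => [w [Sw gL]|w [j jL [Sw /= gj]]]; first by exists (g w).
  by split => //=; rewrite gj.
have mL : measurable (S `&` [set w | g w \in L]).
  by rewrite EL; apply: fin_bigcup_measurable => //; exact: finite_seq.
have sub j : j \in L -> (S `&` [set w | g w \in L]) `&` [set w | g w = j] = S `&` [set w | g w = j].
  move=> jL; rewrite -setIA; congr (_ `&` _); apply/setIidPr => w /= ->; exact: jL.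
rewrite big_cons [in LHS]E measureU//; last first.
  apply/seteqP; split => // w [[_ /= gi] [_ /= gL]].
  by move: iL; rewrite -gi gL.
congr (_ + _).
transitivity (\sum_(j <- L) mu ((S `&` [set w | g w \in L]) `&` [set w | g w = j])).
  apply: ih => // [j|w []//].
   have [jL|jL] := boolP (j \in L); first by rewrite sub.
  rewrite (_ : _ `&` _ = set0)//; apply/seteqP; split => // w [[_ /= gL] /= gj].
  by move: jL; rewrite -gj gL.
by apply: eq_big_seq => j jL; rewrite sub.
Qed.

Lemma measure_integral_partition (mu : {measure set T -> \bar R}) (I : countType)
    (g : T -> I) (S D : set T) (f : T -> \bar R) :
  measurable S -> measurable D -> (forall i, measurable [set w | g w = i]) ->
  measurable_fun D f -> (forall w, 0 <= f w) ->
  (forall i, mu (S `&` [set w | g w = i]) = \int[mu]_(w in D `&` [set w | g w = i]) f w) ->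
  mu S = \int[mu]_(w in D) f w.
Proof.
move=> mS mD mg mf f0 H.
pose F (k : nat) : set T := [set w | pickle (g w) = k].
have FE k : F k = set0 \/ exists i, F k = [set w | g w = i].
  have [[i <-]|H'] := pselect (exists i : I, pickle i = k).
    right; exists i; apply/seteqP; split => w; rewrite /F /=; last by move=> ->.
    exact: (pcan_inj pickleK).
  by left; apply/seteqP; split => // w /= gk; apply: H'; exists (g w).
have mF k : measurable (F k) by have [->|[i ->]] := FE k.
have FT (A : set T) : A = \bigcup_k (A `&` F k).
  by rewrite -setI_bigcupr; apply/esym/setIidPl => w Aw; exists (pickle (g w)).
have tF (A : set T) : trivIset setT (fun k => A `&` F k).
  apply/trivIsetP => i j _ _ ij; apply/seteqP; split => // w [[_ /= Fi] [_ /= Fj]].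
  by move: ij; rewrite -Fi -Fj eqxx.
rewrite [in LHS](FT S) measure_semi_bigcup//; last 2 first.
- by move=> k; exact: measurableI.
- by rewrite -FT.
rewrite [in RHS](FT D) ge0_integral_bigcup//; last 2 first.
- by move=> k; exact: measurableI.
- by rewrite -FT.
apply: eq_eseriesr => k _; have [->|[i ->]] := FE k; last exact: H.
by rewrite !setI0 measure0 integral_set0.
Qed.

End partitions.

(** * The Markov property of the lists of positions *)

Section markov_property.
Context {R : realType} (p : probability nat R).
Variable P : R.-pker (measurableTypeR R) ~> (measurableTypeR R).
Context d (Omega : measurableType d).
Variables (nchild : seq nat -> Omega -> nat) (pos : seq nat -> Omega -> R).
Hypothesis mnchild : forall u, measurable_fun setT (nchild u).
Hypothesis mpos : forall u, measurable_fun setT (pos u : Omega -> measurableTypeR R).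
Variable Q : probability Omega R.
Hypothesis Qbr : branching_property p P nchild pos Q.
Local Open Scope ereal_scope.
Local Notation plist := (plist R).
Local Notation gen := (generation nchild).
Local Notation hist := (history nchild pos).
Local Notation Z := (positions nchild pos).
Local Notation K := (branch_law p P).

Lemma measurable_litters_weight U ks (b : nat -> R) :
  measurable_fun setT (fun w => litters_weight p P [seq pos u w | u <- U] ks b).
Proof.
elim: U ks b => [|u U ih] [|k ks] b /=; do ?exact: measurable_cst.
apply: emeasurable_funM; last exact: ih.
apply: emeasurable_funM; first exact: measurable_cst.
elim: k b => [|k ihk] b.
  by under eq_fun do rewrite big_ord0; exact: measurable_cst.
under eq_fun do rewrite big_ord_recl.
apply: emeasurable_funM; last exact: (ihk (b \o succn)).
exact: (measurableT_comp (measurable_kernel P _ (measurable_itv _)) (mpos u)).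
Qed.

Lemma litters_weight_ge0 xs ks (b : nat -> R) : 0 <= litters_weight p P xs ks b.
Proof.
elim: xs ks b => [|x xs ih] [|k ks] b //=.
by rewrite mule_ge0// mule_ge0// prode_ge0.
Qed.

(** When generation [n] is [U], the prescribed number [J] of children leaves finitely many vectors
    of litter sizes. Fixing one of them turns the box into an event of [branching_property]. *)
Lemma branching_box_piece n E U J (b : nat -> R) : hist n E ->
  Q ((E `&` Z n.+1 @^-1` hbox J b) `&` [set w | gen n w = U]) =
  \int[Q]_(w in E `&` [set w | gen n w = U]) K (Z n w) (hbox J b).
Proof.
move=> hE; have mE := history_measurable mnchild mpos hE.
have mU := measurable_generation mnchild n U.
have mZ k (B : set plist) : measurable B -> measurable (Z k @^-1` B).
  by move=> mB; rewrite -[X in measurable X]setTI; apply: measurable_positions.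
have [uU|uU] := boolP (uniq U); last first.
  have U0 : [set w | gen n w = U] = set0.
    apply/seteqP; split => // w /= gU; move/negP: uU; apply.
    by rewrite -gU uniq_generation.
  by rewrite U0 !setI0 measure0 integral_set0.
set S := _ `&` _ `&` _.
have mS : measurable S.
  apply: measurableI => //; apply: measurableI => //.
  by apply: mZ; exact: measurable_hbox.
rewrite (@measure_partition_seq _ _ _ Q _ (fun w => [seq nchild u w | u <- U])
  (compositions (size U) J)); last 3 first.
- exact: uniq_compositions.
- by move=> ks; apply: measurableI => //; exact: measurable_litter_sizes.
- move=> w [[_ [+ _]] gU]; rewrite /positions size_map generationS gU size_children_of => <-.
  by rewrite mem_compositions size_map !eqxx.
transitivity (\sum_(ks <- compositions (size U) J)
    \int[Q]_(w in E `&` [set w | gen n w = U]) litters_weight p P [seq pos u w | u <- U] ks b);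
  last first.
  rewrite -ge0_integral_sum//.
  - apply: eq_integral => w /set_mem[_ gU].
    by rewrite branch_law_hbox /positions gU size_map.
  - exact: measurableI.
  - by move=> ks; apply: measurable_funTS; exact: measurable_litters_weight.
  - by move=> ks w _; exact: litters_weight_ge0.
apply: eq_big_seq => ks; rewrite mem_compositions => /andP[/eqP sks /eqP Jks].
(* [k], [ch] and [A] translate the composition [ks] and the bounds [b] into functions of the labels;
   outside [U] the value of [k] is an irrelevant default. *)
pose k u := nth 0%N ks (index u U).
have kE : [seq k u | u <- U] = ks.
  apply: (@eq_from_nth _ 0%N); first by rewrite size_map.
  by move=> i; rewrite size_map => iU; rewrite (nth_map [::])// /k index_uniq.
pose ch := children_of k U.
have sch : size ch = J by rewrite size_children_of kE.
have uch : uniq ch by exact: uniq_children_of.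
pose A c := `]-oo, b (index c ch)]%classic.
have -> : S `&` [set w | [seq nchild u w | u <- U] = ks] =
    E `&` [set w | gen n w = U /\ forall u, u \in U -> nchild u w = k u /\
          forall i, (i < k u)%N -> A (i :: u) (pos (i :: u) w)].
  apply/seteqP; split => w /=.
    move=> [[[Ew [_ hb]] gU] nk]; split => //; split => // u uU'.
    have nE : {in U, forall v, nchild v w = k v}.
      by apply/eq_in_map; rewrite kE.
    split; first exact: nE.
    move=> i ik; rewrite /A /= in_itv/=.
    have ciu : (i :: u) \in ch by apply/mem_children_of; exists u => //; exists i.
    have := hb (index (i :: u) ch); rewrite -sch index_mem => /(_ ciu).
    rewrite /positions generationS gU (eq_in_children_of nE).
    by rewrite (nth_map [::]) ?index_mem// nth_index.
  move=> [Ew [gU h]].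
  have nE : {in U, forall v, nchild v w = k v} by move=> u /h[].
  have zE : Z n.+1 w = [seq pos c w | c <- ch].
    by rewrite /positions generationS gU (eq_in_children_of nE).
  split; last by rewrite -[RHS]kE; apply/eq_in_map.
  split=> //; split => //; rewrite /preimage /hbox /= zE size_map; split => // j jJ.
  have jch : (j < size ch)%N by rewrite sch.
  have /mem_children_of[u uU' [i ik cE]] := mem_nth [::] jch.
  have [_ /(_ _ ik)] := h u uU'; rewrite /A /= in_itv/= -cE index_uniq//.
  by rewrite (nth_map [::]).
have mA u : measurable (A u) by exact: measurable_itv.
apply: etrans; first exact: (Qbr U k hE mA).
apply: eq_integral => w _; rewrite -[in RHS]kE -litters_weightE//.
Qed.

Lemma branching_box n E J (b : nat -> R) : hist n E ->
  Q (E `&` Z n.+1 @^-1` hbox J b) = \int[Q]_(w in E) K (Z n w) (hbox J b).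
Proof.
move=> hE; have mE := history_measurable mnchild mpos hE.
apply: (measure_integral_partition (g := gen n)) => //.
- apply: measurableI => //; rewrite -[X in measurable X]setTI.
  by apply: measurable_positions => //; exact: measurable_hbox.
- exact: measurable_generation.
- apply: measurable_funTS.
  exact: (measurableT_comp (measurableT_comp (measurable_giry_ev (measurable_hbox J b))
    (measurable_branch_law p P)) (measurable_positions mnchild mpos n)).
- by move=> U; exact: branching_box_piece.
Qed.

End markov_property.

Section restrict_law.
Context {R : realType} d (T : measurableType d).
Local Open Scope ereal_scope.
Variables (Q : probability T R) (E : set T) (mE : measurable E).

(** Restriction instead of conditioning: the result is a sub-probability, hence a point of the Giry
    space, even when [E] is null. *)
Definition restrict_law : set T -> \bar R := mrestr Q mE.

HB.instance Definition _ := Measure.copy restrict_law (mrestr Q mE).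

Let restrict_law_setT : restrict_law setT <= 1.
Proof. by rewrite /restrict_law /mrestr; apply: probability_le1; exact: measurableI. Qed.

HB.instance Definition _ := Measure_isSubProbability.Build _ _ _ restrict_law restrict_law_setT.

Lemma integral_restrict_law (f : T -> \bar R) : measurable_fun setT f ->
  (forall x, 0 <= f x) -> \int[restrict_law]_x f x = \int[Q]_(x in E) f x.
Proof.
move=> mf f0; rewrite (ge0_negligible_integral (N := ~` E))//.
- rewrite setTD setCK; apply: eq_measure_integral => A mA AE.
  by rewrite /= /restrict_law /mrestr; congr (Q _); apply/setIidPl.
- exact: measurableC.
- by rewrite /= /restrict_law /mrestr setICl measure0.
Qed.

End restrict_law.

Section markov_steps.
Context {R : realType} (p : probability nat R).
Variable P : R.-pker (measurableTypeR R) ~> (measurableTypeR R).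
Context d (Omega : measurableType d).
Variables (nchild : seq nat -> Omega -> nat) (pos : seq nat -> Omega -> R).
Hypothesis mnchild : forall u, measurable_fun setT (nchild u).
Hypothesis mpos : forall u, measurable_fun setT (pos u : Omega -> measurableTypeR R).
Variable Q : probability Omega R.
Hypothesis Qbr : branching_property p P nchild pos Q.
Local Open Scope ereal_scope.
Local Notation plist := (plist R).
Local Notation hist := (history nchild pos).
Local Notation Z := (positions nchild pos).
Local Notation K := (branch_law p P).
Local Notation gl := (generation_law p P).

(** [m1] is the law of the next generation on [E], and [m2] is that of the present one pushed
    through the kernel. They agree on boxes by [branching_box], and boxes determine finite measures
    on lists. *)
Lemma integral_positionsS n E (f : plist -> \bar R) : hist n E ->
  measurable_fun setT f -> (forall s, 0 <= f s) ->
  \int[Q]_(w in E) f (Z n.+1 w) = \int[Q]_(w in E) \int[K (Z n w)]_s f s.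
Proof.
move=> hE mf f0; have mE := history_measurable mnchild mpos hE.
have mZ k := measurable_positions mnchild mpos k.
have mK := measurable_branch_law p P.
pose m1 : giry plist R := giry_map (mZ n.+1) (restrict_law Q mE : giry Omega R).
pose m2 : giry plist R := giry_bind (giry_map (mZ n) (restrict_law Q mE : giry Omega R)) mK.
have m2E (g : plist -> \bar R) : measurable_fun setT g -> (forall s, 0 <= g s) ->
    \int[m2]_s g s = \int[Q]_(w in E) \int[K (Z n w)]_s g s.
  move=> mg g0; rewrite [LHS]giry_int_bind//.
  have mKg := measurable_integral_giry mK mg g0.
  rewrite [LHS](giry_int_map (mZ n))//; last by move=> s; exact: integral_ge0.
  rewrite [LHS]integral_restrict_law//; first exact: (measurableT_comp mKg (mZ n)).
  by move=> w; exact: integral_ge0.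
have m1E (g : plist -> \bar R) : measurable_fun setT g -> (forall s, 0 <= g s) ->
    \int[m1]_s g s = \int[Q]_(w in E) g (Z n.+1 w).
  move=> mg g0; rewrite [LHS](giry_int_map (mZ n.+1))//.
  have mgZ := measurableT_comp mg (mZ n.+1).
  by rewrite [LHS]integral_restrict_law//= => w; exact: g0.
rewrite -m1E// -m2E//; apply: eq_measure_integral => A mA _.
apply: plist_measure_unique => //.
  move=> J b; have mB := measurable_hbox J b.
  have mB1 : measurable_fun setT (fun s : plist => (\1_(hbox J b) s)%:E : \bar R).
    exact/measurable_EFinP/measurable_indic.
  transitivity (Q (E `&` Z n.+1 @^-1` hbox J b)).
    by rewrite /m1 /= /pushforward /restrict_law /mrestr setIC.
  rewrite (branching_box mnchild mpos Qbr J b hE) -[RHS]integral_indicE// m2E//.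
  by apply: eq_integral => w _; rewrite integral_indicE.
by apply: (@le_lt_trans _ _ 1); [exact: sprobability_setT|exact: ltry].
Qed.

Lemma integral_positions_steps n l E (f : plist -> \bar R) : hist n E ->
  measurable_fun setT f -> (forall s, 0 <= f s) ->
  \int[Q]_(w in E) f (Z (n + l)%N w) = \int[Q]_(w in E) \int[gl l (Z n w)]_s f s.
Proof.
move=> hE; elim: l f => [|l ih] f mf f0.
  by rewrite addn0; apply: eq_integral => w _; rewrite integral_generation_law0.
rewrite addnS integral_positionsS//; last exact: (history_le (leq_addr l n) hE).
have mKf := measurable_integral_giry (measurable_branch_law p P) mf f0.
rewrite (ih _ mKf)//; last by move=> s; exact: integral_ge0.
by apply: eq_integral => w _; rewrite integral_generation_lawS.
Qed.

Lemma history_setT n : hist n setT.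
Proof.
by rewrite -(preimage_setT (Z n)); exact: history_positions.
Qed.

Lemma measurable_positions_preimage n (A : set plist) : measurable A ->
  measurable (Z n @^-1` A).
Proof.
by move=> mA; rewrite -[X in measurable X]setTI; apply: measurable_positions.
Qed.

Lemma positions_law n (A : set plist) : measurable A ->
  Q (Z n @^-1` A) = \int[Q]_w gl n (Z 0%N w) A.
Proof.
move=> mA; have mA1 : measurable_fun setT (fun s : plist => (\1_A s)%:E : \bar R).
  exact/measurable_EFinP/measurable_indic.
rewrite -integral_indicE; last exact: measurable_positions_preimage.
transitivity (\int[Q]_(w in setT) (\1_A (Z (0 + n)%N w))%:E) => //.
rewrite (integral_positions_steps (f := fun s => (\1_A s)%:E) n (@history_setT 0%N))//.
by apply: eq_integral => w _; rewrite integral_indicE.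
Qed.

Lemma positions_joint_law n l (A B : set plist) : measurable A -> measurable B ->
  Q (Z n @^-1` A `&` Z (n + l)%N @^-1` B) = \int[Q]_(w in Z n @^-1` A) gl l (Z n w) B.
Proof.
move=> mA mB; have mB1 : measurable_fun setT (fun s : plist => (\1_B s)%:E : \bar R).
  exact/measurable_EFinP/measurable_indic.
have mZA := measurable_positions_preimage n mA.
have mZB := measurable_positions_preimage (n + l) mB.
transitivity (\int[Q]_(w in Z n @^-1` A) (\1_B (Z (n + l)%N w))%:E).
  by rewrite setIC -integral_indic.
rewrite (integral_positions_steps (f := fun s => (\1_B s)%:E) l (history_positions mA))//.
by apply: eq_integral => w _; rewrite integral_indicE.
Qed.

End markov_steps.

Lemma fine_scale {R : realType} (r : R) (x : \bar R) : 0 <= r ->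
  fine (r%:E * x) = r * fine x.
Proof.
rewrite le_eqVlt => /orP[/eqP <-|r0]; first by rewrite mul0e mul0r.
by case: x => [//||] /=; [rewrite gt0_muley|rewrite gt0_muleNy]; rewrite ?lte_fin// mulr0.
Qed.

Lemma eq_cvgn {T : topologicalType} (f g : nat -> T) (l : T) : f =1 g ->
  f n @[n --> \oo] --> l -> g n @[n --> \oo] --> l.
Proof. by move=> /funext ->. Qed.

(** * Scaled limits of population and survival events *)

Section survival.
Context {R : realType} (p : probability nat R).
Variable P : R.-pker (measurableTypeR R) ~> (measurableTypeR R).
Local Open Scope ereal_scope.
Local Notation RR := (measurableTypeR R).
Local Notation plist := (plist R).
Local Notation gl := (generation_law p P).
Variables (m M2 : R).
Hypothesis pm : \int[p]_j j%:R%:E = m%:E.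
Hypothesis pM2 : \int[p]_j (j%:R ^+ 2)%:E = M2%:E.
Hypotheses (m0 : (0 < m)%R) (m1 : (m < 1)%R).
Variable pi : probability RR R.
Hypothesis Ppi : forall (x : R) (h : R -> R), Bbp h ->
  \int[nstep P n x]_y (h y)%:E @[n --> \oo] --> \int[pi]_y (h y)%:E.
Local Notation lam A := (limn (scaled_stationary p P m pi A)).
Variable c : {measure set plist -> \bar R}.
Hypothesis cE : forall A, measurable A -> c A = (lam (A `\ ([::] : plist)))%:E.
Context d (Omega : measurableType d).
Variables (nchild : seq nat -> Omega -> nat) (pos : seq nat -> Omega -> R).
Hypothesis mnchild : forall u, measurable_fun setT (nchild u).
Hypothesis mpos : forall u, measurable_fun setT (pos u : Omega -> measurableTypeR R).
Variable Q : probability Omega R.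
Hypothesis Qbr : branching_property p P nchild pos Q.
Local Notation Z := (positions nchild pos).
Variable k : nat.
Hypothesis Zk : {ae Q, forall w, size (Z 0%N w) = k}.
Local Notation nonnil := (~` [set ([::] : plist)]).

Let mnonnil : measurable (nonnil : set plist).
Proof. by apply: measurableC; exact: measurable_set_nil. Qed.

Lemma prob_fin_num (A : set Omega) : measurable A -> Q A \is a fin_num.
Proof. by move=> mA; rewrite fin_num_measure. Qed.

(** The initial measure fixes the list [Z 0] only up to a possibly random order, but the limit of
    [scaled_law] depends only on its size [k], which also dominates the integrands. *)
Lemma positions_scaled_cvg (A : set plist) : measurable A -> ~ A [::] ->
  (fine (Q (Z n @^-1` A)) / m ^+ n)%R @[n --> \oo] --> (k%:R * lam A)%R.
Proof.
move=> mA nA.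
pose f n w := (scaled_law p P m A n (Z 0%N w))%:E.
have mgl n : measurable_fun setT (fun w => gl n (Z 0%N w) A).
  exact: (measurableT_comp (measurable_generation_law_ev p P n mA)
    (measurable_positions mnchild mpos 0)).
have fE n w : f n w = (m ^- n)%:E * gl n (Z 0%N w) A.
  rewrite /f /scaled_law -[in RHS](fineK (generation_law_fin_num p P n (Z 0%N w) mA)).
  by rewrite -EFinM mulrC.
have mf n : measurable_fun setT (f n).
  rewrite (_ : f n = fun w => (m ^- n)%:E * gl n (Z 0%N w) A); last exact/funext.
  exact: measurable_funeM.
have If n : \int[Q]_w f n w = (fine (Q (Z n @^-1` A)) / m ^+ n)%R%:E.
  under eq_integral do rewrite fE.
  rewrite ge0_integralZl_EFin//; last by rewrite invr_ge0 exprn_ge0// ltW.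
  rewrite -(positions_law mnchild mpos Qbr n mA).
  rewrite -[in LHS](fineK (prob_fin_num (measurable_positions_preimage mnchild mpos n mA))).
  by rewrite -EFinM mulrC.
have [] := @dominated_convergence _ _ _ Q setT measurableT f
  (cst (k%:R * lam A)%:E) (cst k%:R%:E) mf.
- exact: measurable_cst.
- apply: filterS Zk => w sz _; apply: cvg_EFin; first by apply: nearW.
  by have := scaled_law_cvg pm pM2 m0 m1 Ppi (s := Z 0%N w) mA nA; rewrite sz.
- exact: finite_measure_integrable_cst.
- apply: filterS Zk => w sz n _; rewrite /f /= lee_fin -sz.
  by have /andP[? ?] := scaled_law_le P pm m0 n (Z 0%N w) mA nA; rewrite ger0_norm.
move=> _ _; rewrite integral_mass1; last exact: probability_setT.
move=> h; apply: (@eq_cvgn R (fun n => fine (\int[Q]_w f n w))); last exact: fine_cvg h.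
by move=> n; rewrite If.
Qed.

Lemma positions_integral_cvg (F : plist -> R) : measurable_fun setT F ->
  (forall s, (0 <= F s <= 1)%R) ->
  (fine (\int[Q]_(w in Z n @^-1` nonnil) (F (Z n w))%:E) / m ^+ n)%R @[n --> \oo] -->
  (k%:R * fine (\int[c]_s (F s)%:E))%R.
Proof.
move=> mF F01.
have mZ n := measurable_positions mnchild mpos n.
have mE n := measurable_positions_preimage mnchild mpos n mnonnil.
have mn0 n : (0 <= m ^- n)%R by rewrite invr_ge0 exprn_ge0// ltW.
pose mu n : {measure set plist -> \bar R} :=
  mscale (NngNum (mn0 n)) (giry_map (mZ n) (restrict_law Q (mE n) : giry Omega R)).
pose nu : {measure set plist -> \bar R} := mscale (NngNum (ler0n R k)) c.
have mF' : measurable_fun setT (fun s : plist => (F s)%:E) by exact/measurable_EFinP.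
have F0 s : 0 <= (F s)%:E by rewrite lee_fin; have /andP[] := F01 s.
have muF n : \int[mu n]_s (F s)%:E =
    (m ^- n)%:E * \int[Q]_(w in Z n @^-1` nonnil) (F (Z n w))%:E.
  rewrite ge0_integral_mscale//=; congr (_ * _).
  rewrite [LHS](giry_int_map (mZ n))// [LHS]integral_restrict_law//.
    exact: (measurableT_comp mF' (mZ n)).
  by move=> w; exact: F0.
have nuF : \int[nu]_s (F s)%:E = k%:R%:E * \int[c]_s (F s)%:E.
  by rewrite ge0_integral_mscale.
have nuE A : nu A = k%:R%:E * c A by [].
have muE n A : mu n A = (m ^- n)%:E * Q (Z n @^-1` (A `\ ([::] : plist))).
  by rewrite /mu /mscale/=.
have mZA n (A : set plist) : measurable A -> measurable (Z n @^-1` A).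
  by move=> mA; exact: measurable_positions_preimage.
have mD (A : set plist) : measurable A -> measurable (A `\ ([::] : plist)).
  by move=> mA; apply: measurableD => //; exact: measurable_set_nil.
have cvgA A : measurable A -> fine (mu n A) @[n --> \oo] --> fine (nu A).
  move=> mA; have nD : ~ (A `\ ([::] : plist)) [::] by move=> [_]; exact.
  have := positions_scaled_cvg (mD A mA) nD; rewrite nuE cE// fine_scale//=.
  apply: eq_cvgn => n.
  by rewrite muE fine_scale// mulrC.
have muoo n : mu n setT < +oo.
  have mZD : measurable (Z n @^-1` ([set: plist] `\ ([::] : plist))) by apply: mZA; exact: mD.
  by rewrite muE -(fineK (prob_fin_num mZD)) -EFinM ltry.
have nuoo : nu setT < +oo.
  by rewrite /nu /mscale /= lte_mul_pinfty// ?lee_fin// cE// ltry.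
have := setwise_integral_cvg muoo nuoo cvgA mF F01.
rewrite nuF fine_scale//; apply: eq_cvgn => n.
by rewrite muF fine_scale// mulrC.
Qed.

Lemma survival_cvg l (A : set plist) : measurable A ->
  (fine (Q (Z n @^-1` A `&` Z (n + l)%N @^-1` nonnil)) / m ^+ n)%R @[n --> \oo] -->
  (k%:R * fine (\int[c]_(s in A) gl l s nonnil))%R.
Proof.
move=> mA.
pose F (s : plist) : R := (\1_A s * fine (gl l s nonnil))%R.
have mgl := measurable_generation_law_ev p P l mnonnil.
have g01 s : (0 <= fine (gl l s nonnil) <= 1)%R.
  rewrite fine_ge0//= -lee_fin fineK; first exact: generation_law_le1.
  exact: generation_law_fin_num.
have mF : measurable_fun setT F.
  apply: measurable_funM; first exact: measurable_indic.
  exact: (measurableT_comp (fine_measurable measurableT) mgl).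
have F01 s : (0 <= F s <= 1)%R.
  rewrite /F indicE; case: (_ \in _); rewrite ?mul1r ?mul0r//.
  by rewrite lexx ler01.
have FE s : (F s)%:E = ((fun t => gl l t nonnil) \_ A) s.
  rewrite /F patchE indicE; case: (s \in A); rewrite ?mul0r// mul1r fineK//.
  exact: generation_law_fin_num.
(* An extinct population does not survive: the integrand vanishes at the empty list, so integrating
   over [A] or over its nonempty part is the same. *)
have glnil : gl l ([::] : plist) nonnil = 0.
  by rewrite generation_law_nonnil expr0 subrr.
have := positions_integral_cvg mF F01.
have -> : \int[c]_s (F s)%:E = \int[c]_(s in A) gl l s nonnil.
  by rewrite [RHS]integral_mkcond; apply: eq_integral => s _; exact: FE.
apply: eq_cvgn => n.
congr (fine _ / _)%R.
rewrite (positions_joint_law mnchild mpos Qbr n l mA mnonnil).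
rewrite [LHS]integral_mkcond [RHS]integral_mkcond; apply: eq_integral => w _.
rewrite !patchE FE patchE.
have -> : (w \in Z n @^-1` A) = (Z n w \in A) by apply/idP/idP; rewrite !inE.
case: ifPn => wn //; case: ifPn => // _.
move: wn; rewrite notin_setE /= => /contrapT ->; by rewrite glnil.
Qed.

(** The probability of survival up to [n + l], divided by [m ^ n], has a limit computed in two ways:
    by the Markov property at time [n], and by shifting the index in the limit of the survival
    probabilities. The common factor [k] is then cancelled. *)
Lemma survival_mass l : (0 < k)%N ->
  fine (\int[c]_s gl l s nonnil) = (m ^+ l * lam nonnil)%R.
Proof.
move=> k0; have nN : ~ nonnil ([::] : plist) by apply.
have h1 := survival_cvg (l := l) (A := setT) measurableT.
have h2 : (m ^+ l * (fine (Q (Z (n + l)%N @^-1` nonnil)) / m ^+ (n + l)))%R @[n --> \oo] -->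
    (m ^+ l * (k%:R * lam nonnil))%R.
  apply: cvgMr; have := positions_scaled_cvg mnonnil nN.
  by rewrite -(cvg_shiftn l).
have {}h2 : (fine (Q (Z n @^-1` [set: plist] `&` Z (n + l)%N @^-1` nonnil)) / m ^+ n)%R
    @[n --> \oo] --> (m ^+ l * (k%:R * lam nonnil))%R.
  apply: eq_cvgn h2 => n; rewrite preimage_setT setTI exprD; field.
  by rewrite !expf_neq0// gt_eqF.
have := cvg_unique _ h1 h2 => /(_ (@Rhausdorff R)) E.
have k0' : (k%:R != 0 :> R)%R by rewrite pnatr_eq0 -lt0n.
by apply: (mulfI k0'); rewrite E mulrCA.
Qed.

End survival.

Section nonnil_mass.
Context {R : realType} (p : probability nat R).
Variable P : R.-pker (measurableTypeR R) ~> (measurableTypeR R).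
Local Open Scope ereal_scope.
Local Notation RR := (measurableTypeR R).
Local Notation plist := (plist R).
Variables (m M2 : R).
Hypothesis pm : \int[p]_j j%:R%:E = m%:E.
Hypothesis pM2 : \int[p]_j (j%:R ^+ 2)%:E = M2%:E.
Hypotheses (m0 : (0 < m)%R) (m1 : (m < 1)%R).
Variable pi : probability RR R.
Hypothesis Ppi : forall (x : R) (h : R -> R), Bbp h ->
  \int[nstep P n x]_y (h y)%:E @[n --> \oo] --> \int[pi]_y (h y)%:E.

(** For a single ancestor the scaled law is [q n / m ^ n]. The bound [q n <= m ^ n] replaces the
    quadratic loss [M2 * q n ^ 2] of Kolmogorov's estimate by [M2 * m ^ n * q n], which is summable
    relative to [q n]. *)
Lemma nonnil_mass_gt0 :
  (0 < limn (scaled_stationary p P m pi (~` [set ([::] : plist)])))%R.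
Proof.
have mN : measurable (~` [set ([::] : plist)]).
  by apply: measurableC; exact: measurable_set_nil.
have nN : ~ (~` [set ([::] : plist)]) [::] by apply.
have [_ _ wc _] := scaled_stationary_cvg pm pM2 m0 m1 Ppi mN nN.
pose q n := (1 - genfun_iter p n 0)%R.
have qE n : scaled_law p P m (~` [set ([::] : plist)]) n [:: 0%R] = (q n / m ^+ n)%R.
  by rewrite /scaled_law generation_law_nonnil/= expr1.
have mean0 : 0 < mean p by rewrite -integral_offspring_mean pm lte_fin.
have q0 n : (0 < q n)%R by rewrite subr_gt0 genfun_iter_lt1.
have q1 n : (q n <= 1)%R by rewrite gerBl; have /andP[] := genfun_iter01 p n.
have qm n : (q n <= m ^+ n)%R.
  have [_ /(_ [:: 0%R])/andP[_]] := generation_law_additive P pm m0 n mN nN.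
  by rewrite generation_law_nonnil/= expr1 lee_fin mulr1.
have M20 := M2_ge0 pM2.
have qS n : (m * q n <= q n.+1 + M2 * m ^+ n * q n)%R.
  have q01 : (0 <= q n <= 1)%R by rewrite ltW//=.
  have := genfun_lower q01 pm pM2.
  have -> : genfun p (1 - q n) = (1 - q n.+1)%R by rewrite /q !subKr.
  have : (M2 * q n ^+ 2 <= M2 * m ^+ n * q n)%R.
    by rewrite expr2 -mulrA ler_wpM2l// ler_wpM2r// ltW.
  by lra.
have [delta d0 hd] := almost_geometric_lower_bound m0 m1 M20 q0 qS.
apply: (lt_le_trans d0); rewrite -(cvg_lim (@Rhausdorff R) (wc 0%R)).
apply: limr_ge; first by apply/cvg_ex; eexists; exact: wc.
by apply: filterS hd => n; rewrite qE.
Qed.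

End nonnil_mass.

(** * Point measures and lists *)

Section point_measure_of_list.
Variable R : realType.
Local Notation plist := (plist R).
Local Notation pm := (@pmeasure_of_seq R).

Lemma pmeasure_of_seqE (s : seq R) (A : set R) :
  pm s A = (\sum_(x <- s) (x \in A)%:R)%:E :> \bar R.
Proof.
rewrite /= /msum -sumEFin (big_nth 0) big_mkord; apply: eq_bigr => i _.
exact: diracE.
Qed.

Lemma pmeasure_of_seqT (s : seq R) : pm s setT = (size s)%:R%:E :> \bar R.
Proof.
rewrite pmeasure_of_seqE; congr EFin.
under eq_bigr do rewrite in_setT.
by rewrite -natr_sum sum1_size.
Qed.

Lemma ge0_integral_pmeasure_of_seq (s : seq R) (f : measurableTypeR R -> \bar R) :
  measurable_fun setT f -> (forall x, 0 <= f x)%E ->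
  (\int[pm s]_x f x = \sum_(x <- s) f x)%E.
Proof.
move=> mf f0; rewrite ge0_integral_measure_sum// (big_nth 0%R) big_mkord.
by apply: eq_bigr => i _; rewrite integral_dirac// diracT mul1e.
Qed.

Lemma integral_pmeasure_of_seq (s : seq R) (f : measurableTypeR R -> R) :
  measurable_fun setT f -> (\int[pm s]_x (f x)%:E = (\sum_(x <- s) f x)%:E)%E.
Proof.
move=> mf; have mfE : measurable_fun setT (EFin \o f) by exact/measurable_EFinP.
rewrite integralE funerpos funerneg.
rewrite !ge0_integral_pmeasure_of_seq; last 4 first.
- by rewrite -funerneg; exact: measurable_funeneg.
- by move=> x; rewrite lee_fin.
- by rewrite -funerpos; exact: measurable_funepos.
- by move=> x; rewrite lee_fin.
rewrite !sumEFin -EFinB -sumrB; congr EFin; apply: eq_bigr => x _.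
exact: (congr1 (fun g => g x) (funrposBneg f)).
Qed.

Lemma continuous_pmeasure (T : topologicalType) (g : T -> pmeasure R) :
  (forall f : R -> R, continuous f -> bounded_fun f ->
    continuous (fun x => \int[g x]_y f y)) -> continuous g.
Proof.
move=> h; apply: continuous_comp_initial => x; apply/cvg_sup => f; move: x.
apply/(@continuousP _ (initial_topology (@^~ f))) => A [B oB <-].
have [cf bf] := set_valP f.
by have /continuousP/(_ B oB) := h _ cf bf.
Qed.

Lemma continuous_pmeasure_of_seq k :
  continuous ((fun x : 'rV[R]_k => pm [seq x 0 i | i <- enum 'I_k])).
Proof.
apply: continuous_pmeasure => f cf _ x.
have mf : measurable_fun setT f by exact: continuous_measurable_fun.
have E (y : 'rV[R]_k) : \int[pm [seq y 0 i | i <- enum 'I_k]]_z f z =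
    \sum_(i < k) f (y 0 i).
  by rewrite /Rintegral integral_pmeasure_of_seq//= big_map big_enum.
rewrite /continuous_at E; under eq_fun do rewrite E.
apply: (@cvg_big _ _ _ _ xpredT _ _ (nbhs x) _ _ _ (nbhs_filter x)) => [|i _].
  exact: add_continuous.
apply: (@continuous_comp _ _ _ (fun M : 'rV[R]_k => M 0 i) f x).
  exact: coord_continuous.
exact: cf.
Qed.

(** An open set of rows is a countable union of balls with rational centres and radii [1 / (n + 1)],
    and such balls are products of intervals. *)
Lemma measurable_open_row k (O : set 'rV[R]_k) : open O ->
  measurable ([set s | size s = k /\ O (\row_i nth 0 s i)] : set plist).
Proof.
move=> oO.
pose B (cn : seq rat * nat) : set plist := [set s | size s = k /\
  forall i, (i < k)%N -> ball (ratr (nth 0 cn.1 i) : R) cn.2.+1%:R^-1 (nth 0 s i)].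
pose good (cn : seq rat * nat) := forall y : 'rV[R]_k,
  (forall i : 'I_k, ball (ratr (nth 0 cn.1 i) : R) cn.2.+1%:R^-1 (y 0 i)) -> O y.
rewrite (_ : [set _ | _] = \bigcup_cn (if `[< good cn >] then B cn else set0)).
  apply: countable_bigcupT_measurable; first exact: countableP.
  move=> cn; case: ifPn => // _.
  by apply: (@measurable_box _ _ (fun i => ball _ _)) => i; exact: measurable_ball.
apply/seteqP; split => [s [sk Os]|s [cn _]]; last first.
  case: asboolP => // gcn [sk h]; split => //; apply: gcn => i.
  by rewrite mxE; exact: h.
have /nbhs_ballP[e /= e0 eO] : nbhs (\row_(i < k) nth 0 s i) O by exact: open_nbhs_nbhs.
(* Twice the radius is below [e], so that a ball whose centre is within one radius of the point
   stays in its [e]-ball. *)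
have [n ne] : exists n : nat, n.+1%:R^-1 + n.+1%:R^-1 < e.
  have e20 : 0 < e / 2 by rewrite divr_gt0.
  exists (Num.truncn (e / 2)^-1).
  rewrite [ltRHS](splitr e) ltrD// invf_plt ?posrE// ?truncnS_gt//.
have nn0 : 0 < n.+1%:R^-1 :> R by rewrite invr_gt0.
have /choice[q hq] : forall x : R, exists q : rat, ball (ratr q : R) n.+1%:R^-1 x.
  move=> x; have xx : x - n.+1%:R^-1 < x + n.+1%:R^-1.
    by rewrite ltrD2l (lt_trans _ nn0)// oppr_lt0.
  have [q] := rat_in_itvoo xx.
  rewrite in_itv/= => /andP[h1 h2]; exists q.
  by rewrite /ball/= ltr_distlC ltrBlDr h2 -ltrBlDr h1.
exists ([seq q x | x <- s], n) => //.
have h i : (i < k)%N -> nth 0 [seq q x | x <- s] i = q (nth 0 s i).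
  by move=> ik; rewrite (nth_map 0)// sk.
rewrite (asboolT (P := good _)).
  by split => // i ik; rewrite /= h.
move=> y /= hy; apply: eO; split => // i j; rewrite ord1 mxE.
apply: (le_ball (ltW ne)); apply: ball_triangle.
  by apply: ball_sym; exact: hq.
by have := hy j; rewrite h.
Qed.

Lemma measurable_pmeasure_of_seq_preimage (O : set (pmeasure R)) : open O ->
  measurable ([set s | O (pm s)] : set plist).
Proof.
move=> oO.
rewrite (_ : [set _ | _] = \bigcup_k [set s : plist | size s = k /\
   ((fun x : 'rV[R]_k => pm [seq x 0 i | i <- enum 'I_k]) @^-1` O) (\row_i nth 0 s i)]).
  apply: bigcup_measurable => k _; apply: measurable_open_row.
  by have /continuousP/(_ O oO) := @continuous_pmeasure_of_seq k.
have E (s : plist) : [seq (\row_(i < size s) nth 0 s i) 0 i | i <- enum 'I_(size s)] = s.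
  under eq_map do rewrite mxE.
  by rewrite (map_comp (nth 0 s) val) val_enum_ord map_nth_iota0// take_size.
apply/seteqP; split => [s Os|s [k _ [<-]]]; last by rewrite /= E.
by exists (size s) => //; split => //=; rewrite E.
Qed.

(* The empty list, which is not a point of the space, is sent to a junk value. *)
Definition pm0 (s : plist) : pmeasure0 R :=
  insubd ((point : pmeasure0 R) : set_type (@nonnull R)) (pm s).

Lemma pm0E (s : plist) : s != [::] -> pmeasure0_val (pm0 s) = pm s.
Proof.
move=> s0; rewrite /pmeasure0_val /pm0; apply: insubdK.
rewrite inE /nonnull /=; have /= -> := pmeasure_of_seqT s.
by rewrite eqe pnatr_eq0 size_eq0.
Qed.

Lemma measurable_pm0 : measurable_fun setT (pm0 : plist -> borel_pmeasure0 R).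
Proof.
apply: (@measurability _ _ plist (borel_pmeasure0 R) setT pm0 (@open (pmeasure0 R))) => //.
move=> _ [_ [V oV <-] <-]; rewrite setTI.
rewrite (_ : _ @^-1` _ = ([set s | V (pm s)] `&` ~` [set [::]]) `|`
   (if `[< V (set_val (pm0 [::])) >] then [set [::]] else set0)).
  apply: measurableU.
    apply: measurableI; first exact: measurable_pmeasure_of_seq_preimage.
    by apply: measurableC; exact: measurable_set_nil.
  by case: ifPn => // _; exact: measurable_set_nil.
apply/seteqP; split => [s /= Vs|s].
  have [s0|s0] := eqVneq s [::]; first by right; rewrite asboolT -?s0.
  by left; split; [rewrite -(pm0E s0)|exact/eqP].
case=> [[Vs /eqP s0]|]; first by rewrite /= -/(pmeasure0_val _) pm0E.
by case: asboolP => // h ->.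
Qed.

End point_measure_of_list.

(** * Atoms of a point measure in increasing order *)

Section quantiles.
Variable R : realType.
Local Notation plist := (plist R).
Local Notation pm := (@pmeasure_of_seq R).
Implicit Types (nu : pmeasure R) (x : R) (i : nat).

Definition pcount nu (A : set R) : nat := Num.truncn (fine (nu A)).

Lemma pcountE nu A : measurable (A : set (measurableTypeR R)) ->
  nu A = (pcount nu A)%:R%:E.
Proof. by move=> mA; rewrite /pcount; have [k ->] := pmeasure_nat nu mA; rewrite /= natrK. Qed.

Lemma pcount_le nu (A B : set R) : measurable (A : set (measurableTypeR R)) ->
  measurable (B : set (measurableTypeR R)) -> A `<=` B -> (pcount nu A <= pcount nu B)%N.
Proof.
move=> mA mB AB; rewrite -(ler_nat R) -lee_fin -!pcountE//.
by apply: le_measure; rewrite ?inE.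
Qed.

Lemma pmeasure_fin nu (A : set (measurableTypeR R)) : measurable A -> (nu A < +oo)%E.
Proof. by move=> mA; rewrite pcountE// ltry. Qed.

(** Masses are natural numbers, so a sequence that comes within distance less than [1] of its limit
    has reached it. *)
Lemma pcount_cvg nu (A : (set R)^nat) (B : set R) :
  (forall n, measurable (A n : set (measurableTypeR R))) ->
  measurable (B : set (measurableTypeR R)) ->
  (nu \o A) n @[n --> \oo] --> nu B ->
  exists n, pcount nu (A n) = pcount nu B.
Proof.
move=> mA mB; rewrite (pcountE nu mB) => /fine_cvgP[_ /cvgrPdist_lt/(_ 1 ltr01)].
move=> [n _ /(_ n (leqnn n))] /=; rewrite pcountE//= => h; exists n.
apply/eqP; apply: contraTT h; rewrite -leNgt neq_ltn => /orP[|] ab; last rewrite distrC;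
  by rewrite -natrB 1?ltnW// normr_nat ler1n subn_gt0.
Qed.

Lemma quantile_nonempty nu i : (i < pcount nu setT)%N ->
  exists x, (i < pcount nu `]-oo, x])%N.
Proof.
move=> iN; have h : \bigcup_n `]-oo, n%:R]%classic = [set: R].
  apply/seteqP; split => // x _; exists (Num.truncn `|x|).+1 => //=.
  by rewrite in_itv/= (le_trans (ler_norm _))// ltW// truncnS_gt.
have /pcount_cvg : (nu \o (fun n : nat => `]-oo, n%:R : R]%classic)) n @[n --> \oo] --> nu setT.
  rewrite -h; apply: nondecreasing_cvg_mu => //.
    by rewrite h.
  move=> n m nm; apply/subsetPset => x /=; rewrite !in_itv/= => /le_trans; apply.
  by rewrite ler_nat.
by move=> /(_ (fun=> measurable_itv _) measurableT)[n nN]; exists n%:R; rewrite nN.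
Qed.

(** The generalised inverse of the distribution function: the atom of rank [i], counted from [0]
    with multiplicity. *)
Definition quantile nu i : R := inf [set x | (i < pcount nu `]-oo, x])%N].

Lemma pcount_itv_mono nu x y : x <= y ->
  (pcount nu `]-oo, x] <= pcount nu `]-oo, y])%N.
Proof.
move=> xy; apply: pcount_le => // z /=; rewrite !in_itv/= => /le_trans; exact.
Qed.

Lemma quantile_has_inf nu i : (i < pcount nu setT)%N ->
  has_inf [set x | (i < pcount nu `]-oo, x])%N].
Proof.
move=> iN; split; first by have [x] := quantile_nonempty iN; exists x.
have h : \bigcap_n `]-oo, - n%:R]%classic = set0 :> set R.
  apply/seteqP; split => // x /(_ (Num.truncn `|x|).+1 Logic.I)/=.
  rewrite in_itv/= lerNr; apply/negP; rewrite -ltNge.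
  by rewrite (le_lt_trans _ (truncnS_gt _))// -normrN ler_norm.
have hc : (nu \o (fun n : nat => `]-oo, - n%:R : R]%classic)) n @[n --> \oo] --> (0 : \bar R).
  rewrite -(measure0 nu) -h; apply: nonincreasing_cvg_mu => //.
  - exact: pmeasure_fin.
  - exact: bigcap_measurable.
  move=> n m nm; apply/subsetPset => x /=; rewrite !in_itv/= => /le_trans; apply.
  by rewrite lerN2 ler_nat.
rewrite -(measure0 nu) in hc.
have [n n0] := pcount_cvg (fun=> measurable_itv _) measurable0 hc.
rewrite [RHS]/pcount measure0 /= truncn0 in n0.
exists (- n%:R) => y /= iy; rewrite leNgt; apply/negP => /ltW /(pcount_itv_mono nu).
by rewrite n0 leqn0 => /eqP y0; rewrite y0 in iy.
Qed.

(** The distribution function is right-continuous, so the infimum that defines the quantile is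
    attained. *)
Lemma quantile_le nu i x : (i < pcount nu setT)%N ->
  (quantile nu i <= x) = (i < pcount nu `]-oo, x])%N.
Proof.
move=> iN; have hi := quantile_has_inf iN; apply/idP/idP => [qx|ix]; last first.
  by apply: ge_inf => //; case: hi.
rewrite ltnNge; apply/negP => hx.
have h : \bigcap_n `]-oo, x + n.+1%:R^-1]%classic = `]-oo, x]%classic :> set R.
  apply/seteqP; split => y /=; last first.
    rewrite in_itv/= => yx n _ /=; rewrite in_itv/= (le_trans yx)// lerDl invr_ge0//.
  move=> hy; rewrite in_itv/=; apply/ler_addgt0Pr => e e0.
  have := hy (Num.truncn e^-1) Logic.I; rewrite /= in_itv/= => /le_trans; apply.
  by rewrite lerD2l invf_ple ?posrE// ltW// truncnS_gt.
have hc : (nu \o (fun n : nat => `]-oo, x + n.+1%:R^-1]%classic)) n @[n --> \oo] -->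
    nu `]-oo, x]%classic.
  rewrite -h; apply: nonincreasing_cvg_mu => //.
  - exact: pmeasure_fin.
  - exact: bigcap_measurable.
  move=> n m nm; apply/subsetPset => y /=; rewrite !in_itv/= => /le_trans; apply.
  by rewrite lerD2l lef_pV2 ?posrE// ler_nat.
have [n nx] := pcount_cvg (fun=> measurable_itv _) (measurable_itv _) hc.
have [y /= iy yx] : exists2 y, [set x | (i < pcount nu `]-oo, x])%N] y & y < x + n.+1%:R^-1.
  apply: (inf_lt hi.1); apply: (le_lt_trans qx); rewrite ltrDl invr_gt0//.
move: hx; apply/negP; rewrite -ltnNge -nx.
by apply: (leq_trans iy); apply: pcount_itv_mono; exact: ltW.
Qed.

(* The atoms in increasing order: a measurable section of [pmeasure_of_seq]. *)
Definition quantiles nu : plist := mkseq (quantile nu) (pcount nu setT).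

Lemma count_quantiles nu x :
  count (<= x) (quantiles nu) = pcount nu `]-oo, x].
Proof.
have le : (pcount nu `]-oo, x] <= pcount nu setT)%N by exact: pcount_le.
rewrite /quantiles count_map (@eq_in_count _ _ (fun i => (i < pcount nu `]-oo, x])%N)).
  by rewrite -size_filter (filter_iota_ltn 0 le) size_iota.
by move=> i; rewrite mem_iota add0n => /= iN; rewrite quantile_le.
Qed.

(** A finite integer-valued measure is a sum of Dirac masses. Both sides have the same distribution
    function and the same finite mass, hence agree on the half-lines []x, +oo[], which form a
    generating pi-system. *)
Lemma pmeasure_of_quantiles nu (A : set (measurableTypeR R)) : measurable A ->
  nu A = pm (quantiles nu) A.
Proof.
move=> mA.
have ET : nu setT = pm (quantiles nu) setT.
  by rewrite pcountE// pmeasure_of_seqT size_mkseq.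
have E x : nu `]-oo, x]%classic = pm (quantiles nu) `]-oo, x]%classic.
  rewrite pcountE// pmeasure_of_seqE -count_quantiles -sum1_count natr_sum big_mkcond/=.
  by congr EFin; apply: eq_bigr => y _; rewrite mem_setE in_itv/=; case: ifP.
have EU (m : {measure set (measurableTypeR R) -> \bar R}) x :
    (m setT = m `]-oo, x]%classic + m `]x, +oo[%classic)%E.
  rewrite -measureU//.
    by congr (m _); apply/seteqP; split => y //= _; rewrite !in_itv/= andbT; case: leP; auto.
  apply/seteqP; split => y //= []; rewrite !in_itv/= andbT => yx /(le_lt_trans yx).
  by rewrite ltxx.
refine (@measure_unique _ R (measurableTypeR R) (@RGenOInfty.G R)
  (fun n => `]- n%:R, +oo[%classic) _ _ _ _ nu (pm (quantiles nu)) _ _ A mA).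
- exact: RGenOInfty.measurableE.
- move=> _ _ [x ->] [y ->]; exists (Num.max x y).
  apply/seteqP; split => z /=; rewrite !in_itv/= !andbT gt_max.
    by move=> [-> ->].
  by move/andP.
- by move=> n; exists (- n%:R).
- apply/seteqP; split => // x _; exists (Num.truncn `|x|).+1 => //=.
  by rewrite in_itv/= andbT ltrNl (le_lt_trans _ (truncnS_gt _))// -normrN ler_norm.
- move=> _ [x ->]; have := ET; rewrite (EU nu x) (EU (pm _) x) E.
  have [k ->] := pmeasure_nat (pm (quantiles nu)) (measurable_itv `]-oo, x]).
  by move/(congr1 (fun z => z - k%:R%:E)%E); rewrite ![(k%:R%:E + _)%E]addeC !addeK.
- by move=> n; exact: pmeasure_fin.
Qed.

Lemma hbox_quantiles nu k (b : nat -> R) :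
  hbox k b (quantiles nu) <->
  pcount nu setT = k /\ forall i, (i < k)%N -> (i < pcount nu `]-oo, b i])%N.
Proof.
rewrite /hbox /= size_mkseq.
split => -[Ek h]; split => // i ik; have := h i ik;
  by rewrite nth_mkseq ?Ek// quantile_le// Ek.
Qed.

End quantiles.

(** * The weak topology *)

Section weak_topology.
Variable R : realType.
Local Notation plist := (plist R).
Local Notation pm := (@pmeasure_of_seq R).
Local Notation point_measure := (pmeasure0 R).
Local Notation pval := (@pmeasure0_val R).

Definition weak_integral (f : R -> R) (nu : point_measure) : R := \int[pval nu]_x f x.

Lemma continuous_weak_integral f : continuous f -> bounded_fun f ->
  continuous (weak_integral f).
Proof.
move=> cf bf.
have fP : f \in @cbfun R by rewrite inE.
pose F : set_type (@cbfun R) := SigSub fP.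
have c1 : continuous (pval : point_measure -> pmeasure R) by exact: initial_continuous.
have c2 : continuous (@integral_cbfun R) by exact: initial_continuous.
have c3 : continuous (fun g : {ptws set_type (@cbfun R) -> R} => g F).
  exact: (@proj_continuous _ (fun=> R) F).
move=> nu; apply: (@continuous_comp _ _ _ pval (fun nu => integral_cbfun nu F)).
  exact: c1.
by apply: (@continuous_comp _ _ _ (@integral_cbfun R) (fun g => g F)); [exact: c2|exact: c3].
Qed.

Lemma measurable_continuous_borel (F : point_measure -> R) : continuous F ->
  measurable_fun setT (F : borel_pmeasure0 R -> R).
Proof.
move=> /continuousP cF.
apply: (measurability _ (RGenOpens.measurableE R)) => _ [_ [a [b ->]] <-]; rewrite setTI.
by apply: sub_sigma_algebra; apply: cF; exact: interval_open.
Qed.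

Lemma weak_integral_quantiles f nu :
  measurable_fun setT (f : measurableTypeR R -> R) ->
  weak_integral f nu = \sum_(x <- quantiles (pval nu)) f x.
Proof.
move=> mf; rewrite /weak_integral /Rintegral.
rewrite (eq_measure_integral (pm (quantiles (pval nu)))); last first.
  by move=> A mA _; exact: pmeasure_of_quantiles.
by rewrite integral_pmeasure_of_seq.
Qed.

(** On a difference of two natural numbers [clip] is the indicator of positivity, which makes strict
    inequalities between counts continuous in the measure. *)
Definition clip (t : R) : R := Num.max 0 (Num.min 1 t).

Lemma clip01 t : 0 <= clip t <= 1.
Proof. by rewrite /clip le_max lexx /= ge_max ler01 ge_min lexx. Qed.

Lemma clip_ge1 t : 1 <= t -> clip t = 1.
Proof. by move=> t1; rewrite /clip (min_idPl t1); apply/max_idPr; exact: ler01. Qed.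

Lemma clip_le0 t : t <= 0 -> clip t = 0.
Proof.
move=> t0; rewrite /clip (min_idPr _) ?(le_trans t0)//; exact/max_idPl.
Qed.

Lemma continuous_clip : continuous clip.
Proof.
move=> t; apply: (@continuous_max R R (fun=> 0) (fun t => Num.min 1 t)).
  exact: cst_continuous.
by apply: (@continuous_min R R (fun=> 1) id); [exact: cst_continuous|].
Qed.

(** A continuous version of the indicator of []-oo, b]]: for [n > 0] it is [1] up to [b] and [0]
    from [b + 1 / n] on. *)
Definition ramp (b : R) (n : nat) (x : R) : R := clip (1 - n%:R * (x - b)).

Lemma continuous_ramp b n : continuous (ramp b n).
Proof.
move=> x; apply: (@continuous_comp _ _ _ (fun x => 1 - n%:R * (x - b)) clip).
  apply: cvgB; first exact: cvg_cst.
  by apply: cvgM; [exact: cvg_cst|apply: cvgB; [exact: cvg_id|exact: cvg_cst]].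
exact: continuous_clip.
Qed.

Lemma bounded_ramp b n : bounded_fun (ramp b n).
Proof.
exists 1; split => // M M1 x _ /=; have /andP[? ?] := clip01 (1 - n%:R * (x - b)).
by rewrite ger0_norm// (le_trans _ (ltW M1)).
Qed.

Lemma measurable_ramp b n :
  measurable_fun setT (ramp b n : measurableTypeR R -> R).
Proof. exact: (continuous_measurable_fun (@continuous_ramp b n)). Qed.

Lemma ramp_cvg b x : ramp b n x @[n --> \oo] --> ((x <= b)%R%:R : R).
Proof.
apply: cvg_near_cst.
have [xb|bx] := leP x b.
  apply: nearW => n; rewrite /ramp clip_ge1//.
  by rewrite lerDl oppr_ge0 mulr_ge0_le0// subr_le0.
have d0 : 0 < x - b by rewrite subr_gt0.
exists (Num.truncn (x - b)^-1).+1 => // n /= nN.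
apply: clip_le0; rewrite subr_le0 -ler_pdivrMr// div1r.
by rewrite (le_trans (ltW (truncnS_gt _)))// ler_nat.
Qed.

Lemma weak_integral_ramp_cvg b nu :
  weak_integral (ramp b n) nu @[n --> \oo] --> ((pcount (pval nu) `]-oo, b])%:R : R).
Proof.
under eq_fun do (rewrite weak_integral_quantiles; last exact: measurable_ramp).
rewrite -count_quantiles -sum1_count natr_sum big_mkcond/=.
apply: cvg_big => [|x _]; first exact: add_continuous.
by have := @ramp_cvg b x; case: ifP.
Qed.

Lemma weak_integral1 nu : weak_integral (fun=> 1) nu = (pcount (pval nu) setT)%:R.
Proof.
by rewrite weak_integral_quantiles// -[1]/1%:R -natr_sum sum1_size size_mkseq.
Qed.

(* At an integer [N], the first two factors are [1] if [N = k] and one of them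
   vanishes otherwise. *)
Definition hbox_approx (k : nat) (b : nat -> R) (n : nat) (nu : point_measure) : R :=
  clip (k%:R + 1 - weak_integral (fun=> 1) nu) *
  clip (weak_integral (fun=> 1) nu - k%:R + 1) *
  \prod_(i < k) clip (weak_integral (ramp (b i) n) nu - i%:R).

Lemma continuous_hbox_approx k b n : continuous (hbox_approx k b n).
Proof.
have c1 : continuous (weak_integral (fun=> 1)).
  apply: continuous_weak_integral; first by move=> x; exact: cvg_cst.
  by exists 1; split => // M M1 x _ /=; rewrite normr1 ltW.
have cc (g : point_measure -> R) : continuous g -> continuous (fun nu => clip (g nu)).
  by move=> cg nu; apply: (@continuous_comp _ _ _ g clip); [exact: cg|exact: continuous_clip].
have h1 : continuous (fun nu => clip (k%:R + 1 - weak_integral (fun=> 1) nu)).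
  by apply: cc => nu; exact: (cvgB (cvg_cst _) (c1 nu)).
have h2 : continuous (fun nu => clip (weak_integral (fun=> 1) nu - k%:R + 1)).
  by apply: cc => nu; exact: (cvgD (cvgB (c1 nu) (cvg_cst _)) (cvg_cst _)).
have h3 : continuous (fun nu => \prod_(i < k) clip (weak_integral (ramp (b i) n) nu - i%:R)).
  move=> nu.
  apply: (@cvg_big _ _ _ _ xpredT _ _ (nbhs nu) _ _ _ (nbhs_filter nu)) => [|i _].
    exact: mul_continuous.
  have ci := continuous_weak_integral (@continuous_ramp (b i) n) (bounded_ramp (b i) n).
  by apply: cc => nu'; exact: (cvgB (ci nu') (cvg_cst _)).
by move=> nu; exact: (cvgM (cvgM (h1 nu) (h2 nu)) (h3 nu)).
Qed.

Lemma hbox_approx01 k b n nu : 0 <= hbox_approx k b n nu <= 1.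
Proof.
have c0 t : 0 <= clip t by case/andP: (clip01 t).
have c1 t : clip t <= 1 by case/andP: (clip01 t).
rewrite /hbox_approx; apply/andP; split.
  by rewrite !mulr_ge0// prodr_ge0.
rewrite mulr_ile1 ?mulr_ge0 ?prodr_ge0 ?mulr_ile1//.
by apply: prodr_ile1 => i _; rewrite c0 c1.
Qed.

Lemma hbox_approx_cvg k b nu :
  hbox_approx k b n nu @[n --> \oo] --> (\1_(hbox k b) (quantiles (pval nu)) : R).
Proof.
set N := pcount (pval nu) setT.
have -> : \1_(hbox k b) (quantiles (pval nu)) = clip (k%:R + 1 - N%:R) *
  clip (N%:R - k%:R + 1) *
  \prod_(i < k) clip ((pcount (pval nu) `]-oo, b i])%:R - i%:R) :> R.
  have clipn (m i : nat) : clip (m%:R - i%:R) = (i < m)%N%:R.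
    case: ltnP => mi; first by rewrite clip_ge1// -natrB 1?ltnW// ler1n subn_gt0.
    by rewrite clip_le0// subr_le0 ler_nat.
  have -> : k%:R + 1 - N%:R = k.+1%:R - N%:R :> R by rewrite natr1.
  have -> : N%:R - k%:R + 1 = N.+1%:R - k%:R :> R by rewrite -natr1 addrAC.
  under eq_bigr do rewrite clipn.
  rewrite !clipn !ltnS -!natrM mulnb -eqn_leq indicE.
  have [Nk|Nk] := eqVneq N k; last first.
    by rewrite mul0r memNset// => /hbox_quantiles[/eqP]; rewrite (negbTE Nk).
  rewrite mul1r.
  have [/existsP[i iN]|] := boolP [exists i : 'I_k, (pcount (pval nu) `]-oo, b i] <= i)%N].
    rewrite (bigD1 i)//= ltnNge iN mul0r memNset// => /hbox_quantiles[_ /(_ _ (ltn_ord i))].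
    by rewrite ltnNge iN.
  move=> /existsPn h; rewrite mem_set ?big1// => [i _|]; first by rewrite ltnNge h.
  apply/hbox_quantiles; split => // i ik.
  by rewrite ltnNge; exact: (h (Ordinal ik)).
rewrite /hbox_approx weak_integral1; apply: cvgM; first exact: cvg_cst.
apply: cvg_big => [|i _]; first exact: mul_continuous.
apply: (@cvg_comp _ _ _ _ clip _ _ _ _ (@continuous_clip _)).
exact: (cvgB (@weak_integral_ramp_cvg (b i) nu) (cvg_cst _)).
Qed.

Lemma measurable_hbox_approx k b n :
  measurable_fun setT (hbox_approx k b n : borel_pmeasure0 R -> R).
Proof. by apply: measurable_continuous_borel; exact: continuous_hbox_approx. Qed.

Definition point_quantiles (nu : borel_pmeasure0 R) : plist := quantiles (pval nu).

Lemma measurable_point_quantiles : measurable_fun setT point_quantiles.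
Proof.
apply: (@measurability _ _ (borel_pmeasure0 R) plist setT point_quantiles (@hboxes R)) => //.
move=> _ [_ [->|[k [b ->]]] <-]; rewrite setTI; first by rewrite preimage_set0.
have mi : measurable_fun setT (fun nu => \1_(hbox k b) (point_quantiles nu) : R).
  apply: (measurable_fun_cvg (fun n => measurable_hbox_approx k b n)) => nu _.
  exact: hbox_approx_cvg.
have := mi measurableT _ (measurable_set1 (1 : R)); rewrite setTI.
congr measurable; apply/seteqP; split => nu /=; rewrite indicE.
  by case: (boolP (_ \in _)) => [/set_mem//|_ /esym/eqP]; rewrite oner_eq0.
by move=> /mem_set ->.
Qed.

(* The topology does not separate point measures that agree on Borel sets. *)
Lemma borel_indistinguishable (A : set (borel_pmeasure0 R)) : measurable A ->
  forall nu nu' : point_measure,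
  (forall B, measurable (B : set (measurableTypeR R)) -> pval nu B = pval nu' B) ->
  A nu -> A nu'.
Proof.
move=> mA nu nu' nunu'; suff : A nu <-> A nu' by case.
move: A mA; apply: (@smallest_sub _ _ _ [set A | A nu <-> A nu']).
  split => //= [A /= AA|F FF]; first by split=> -[_ h]; split => // /AA.
  by split => -[i _ /FF]; exists i.
move=> _ [_ [V oV <-] <-] /=.
suff -> : integral_cbfun (set_val nu) = integral_cbfun (set_val nu') by [].
apply/funext => f; rewrite /integral_cbfun /Rintegral; congr fine.
by apply: eq_measure_integral => B mB _; exact: nunu'.
Qed.

(** Rebuilding a point measure from its quantiles may give another term, but one that agrees with it
    on Borel sets, and no Borel set of point measures separates the two. *)
Lemma borel_quantiles (A : set (borel_pmeasure0 R)) : measurable A ->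
  A = point_quantiles @^-1` (@pm0 R @^-1` A).
Proof.
move=> mA.
have E nu B : measurable (B : set (measurableTypeR R)) ->
    pval nu B = pval (pm0 (point_quantiles nu)) B.
  move=> mB; rewrite pm0E; first exact: pmeasure_of_quantiles.
  have /= nu0 := set_valP nu; rewrite -size_eq0 size_mkseq.
  by apply/negP => /eqP N0; move/negP: nu0; apply; rewrite pcountE// N0.
by apply/seteqP; split => nu /=; apply: borel_indistinguishable => // B mB;
  rewrite -E.
Qed.

(** By [borel_quantiles] a law is determined by its image on lists; the images agree on boxes by
    dominated convergence along [hbox_approx]. *)
Lemma probability_weak_unique (Q Q' : probability (borel_pmeasure0 R) R) :
  (forall F : point_measure -> R, continuous F -> bounded_fun F ->
     (\int[Q]_nu (F nu)%:E = \int[Q']_nu (F nu)%:E)%E) ->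
  forall A, measurable A -> Q A = Q' A.
Proof.
move=> QQ' A mA; rewrite (borel_quantiles mA).
have mq := measurable_point_quantiles.
have h (P : probability (borel_pmeasure0 R) R) k b :
    (\int[P]_nu (hbox_approx k b n nu)%:E @[n --> \oo] -->
     P (point_quantiles @^-1` hbox k b))%E.
  have mB : measurable (point_quantiles @^-1` hbox k b).
    by rewrite -[X in measurable X]setTI; apply: mq => //; exact: measurable_hbox.
  have mi : measurable_fun setT
      (fun nu => (\1_(point_quantiles @^-1` hbox k b) nu : R)%:E).
    exact/measurable_EFinP/measurable_indic.
  rewrite -integral_indicE//.
  have mf n : measurable_fun setT (fun nu : borel_pmeasure0 R => (hbox_approx k b n nu)%:E).
    by apply/measurable_EFinP; exact: measurable_hbox_approx.
  have [] // := @dominated_convergence _ _ _ P setT measurableT _ _ (cst 1%E) mf mi.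
  - apply: aeW => nu _; apply: cvg_EFin; first exact: nearW.
    exact: hbox_approx_cvg.
  - exact: finite_measure_integrable_cst.
  - apply: aeW => nu n _ /=; have /andP[h0 h1] := hbox_approx01 k b n nu.
    by rewrite ger0_norm// lee_fin.
have : forall B : set plist, measurable B ->
    pushforward Q point_quantiles B = pushforward Q' point_quantiles B.
  apply: (plist_measure_unique (m1 := pushforward Q point_quantiles)
    (m2 := pushforward Q' point_quantiles)).
    move=> k b; rewrite /pushforward; have := h Q' k b.
    have -> : (fun n => \int[Q']_nu (hbox_approx k b n nu)%:E)%E =
        (fun n => \int[Q]_nu (hbox_approx k b n nu)%:E)%E.
      apply/funext => n; rewrite QQ'//; first exact: continuous_hbox_approx.
      exists 1; split => // M M1 nu _ /=; have /andP[h0 h1] := hbox_approx01 k b n nu.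
      by rewrite ger0_norm// (le_trans h1)// ltW.
    by move=> hQ'; exact: (cvg_unique _ (h Q k b) hQ').
  by rewrite /= /pushforward preimage_setT probability_setT ltry.
by apply; rewrite -[X in measurable X]setTI; apply: measurable_pm0.
Qed.

End weak_topology.

(** * Densities and bounded integrands *)

Section monotone_limit.
Context d (T : measurableType d) (R : realType).
Local Open Scope ereal_scope.

Lemma monotone_integral_cvg (m : {measure set T -> \bar R}) (u : nat -> T -> \bar R)
    (v : T -> \bar R) :
  (forall n, measurable_fun setT (u n)) -> (forall n x, 0 <= u n x) ->
  (forall x, nondecreasing_seq (u ^~ x)) -> (forall x, u n x @[n --> \oo] --> v x) ->
  \int[m]_x u n x @[n --> \oo] --> \int[m]_x v x.
Proof.
move=> mu0 u0 und uv.
have -> : v = fun x => limn (u ^~ x).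
  by apply/funext => x; apply/esym/cvg_lim => //; exact: uv.
by apply: (cvg_monotone_convergence measurableT) => // x _ a b; exact: und.
Qed.

End monotone_limit.

Section density.
Context d d' (T : measurableType d) (U : measurableType d') (R : realType).
Local Open Scope ereal_scope.
Import HBNNSimple.

Lemma integral_pushforward_density (mu : {measure set T -> \bar R})
    (nu : {measure set U -> \bar R}) (phi : T -> U) (g : T -> \bar R) (f : U -> \bar R) :
  measurable_fun setT phi ->
  measurable_fun setT g -> (forall x, 0 <= g x) -> (forall x, g x \is a fin_num) ->
  (forall A, measurable A -> nu A = \int[mu]_(x in phi @^-1` A) g x) ->
  measurable_fun setT f -> (forall y, 0 <= f y) ->
  \int[nu]_y f y = \int[mu]_x (f (phi x) * g x).
Proof.
move=> mphi mg g0 gfin nuE mf f0.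
have mpre (A : set U) : measurable A -> measurable (phi @^-1` A).
  by move=> mA; rewrite -[X in measurable X]setTI; exact: mphi.
pose h := nnsfun_approx measurableT mf.
have hf x : EFin (h n x) @[n --> \oo] --> f x by exact: cvg_nnsfun_approx.
have mh n : measurable_fun setT (EFin \o h n) by exact/measurable_EFinP.
have nd x : nondecreasing_seq (fun n => EFin (h n x)).
  by move=> a b ab; rewrite lee_fin; exact/lefP/nd_nnsfun_approx.
have h0 n y : 0 <= (EFin \o h n) y by rewrite lee_fin.
have c1 := @monotone_integral_cvg _ _ _ nu _ _ mh h0 nd hf.
have c2 : \int[mu]_x ((EFin \o h n) (phi x) * g x) @[n --> \oo] --> \int[mu]_x (f (phi x) * g x).
  apply: (@monotone_integral_cvg _ _ _ mu (fun n x => (EFin \o h n) (phi x) * g x)).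
  - by move=> n; apply: emeasurable_funM => //; exact: (measurableT_comp (mh n) mphi).
  - by move=> n x; rewrite mule_ge0// lee_fin.
  - by move=> x a b ab; rewrite lee_wpmul2r//; exact: nd.
  - by move=> x; apply: cvgeZr => //; exact: hf.
suff E n : \int[nu]_x (EFin \o h n) x = \int[mu]_x ((EFin \o h n) (phi x) * g x).
  by move: c1; under eq_fun do rewrite E; move=> c1; exact: (cvg_unique _ c1 c2).
rewrite integralT_nnsfun sintegralE.
transitivity (\int[mu]_x (\sum_(y \in range (h n)) (y * \1_(h n @^-1` [set y]) (phi x))%:E * g x)).
  rewrite ge0_integral_fsum//; last 2 first.
  - move=> y; apply: emeasurable_funM => //; apply/measurable_EFinP.
    by apply: measurable_funM => //; exact: (measurableT_comp _ mphi).
  - by move=> y x _; rewrite mule_ge0// nnfun_muleindic_ge0.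
  apply: eq_fsbigr => y /set_mem[x _ <-].
  rewrite nuE//.
  under [RHS]eq_integral do rewrite EFinM -muleA.
  have mi : measurable_fun setT (fun x0 => (\1_(h n @^-1` [set h n x]) (phi x0))%:E * g x0).
    apply: emeasurable_funM => //; apply/measurable_EFinP.
    exact: (measurableT_comp _ mphi).
  rewrite ge0_integralZl//; last first.
  - by rewrite lee_fin.
  - by move=> z _; rewrite mule_ge0// lee_fin.
  congr (_ * _); rewrite integral_mkcond; apply: eq_integral => z _.
  by rewrite epatch_indic muleC.
apply: eq_integral => x _ /=.
rewrite -ge0_mule_fsuml => [|y]; last exact: nnfun_muleindic_ge0.
by rewrite fsumEFin// -fimfunE.
Qed.

End density.

Section bounded_convergence.
Context d (T : measurableType d) (R : realType).
Local Open Scope ereal_scope.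

Lemma setwise_bounded_integral_cvg (mu : nat -> {measure set T -> \bar R})
    (nu : {measure set T -> \bar R}) (F : T -> R) :
  (forall n, mu n setT < +oo) -> nu setT < +oo ->
  (forall A, measurable A -> fine (mu n A) @[n --> \oo] --> fine (nu A)) ->
  measurable_fun setT F -> bounded_fun F ->
  \int[mu n]_x (F x)%:E @[n --> \oo] --> \int[nu]_x (F x)%:E.
Proof.
move=> muoo nuoo munu mF [M0 [_ /(_ (Num.max M0 1 + 1)%R)]].
set M := (Num.max M0 1 + 1)%R => h.
have M1 : (1 <= M)%R.
  by rewrite /M (@le_trans _ _ (Num.max M0 1)%R)// ?le_max ?lexx ?orbT// lerDl.
have FM x : (`|F x| <= M)%R.
  by apply: h => //; rewrite /M (@le_lt_trans _ _ (Num.max M0 1)%R)// ?le_max ?lexx// ltrDl.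
have M0' : (0 < M)%R by rewrite (lt_le_trans ltr01).
(* An affine change brings [F] into [[0, 1]]; the constant it introduces is handled by the
   convergence of the total masses. *)
pose G x := ((F x + M) / (2 * M))%R.
have G01 x : (0 <= G x <= 1)%R.
  have := FM x; rewrite ler_norml => /andP[? ?].
  rewrite /G divr_ge0 ?mulr_ge0//; [|lra|lra].
  by rewrite ler_pdivrMr ?mulr_gt0// mul1r; lra.
have mG : measurable_fun setT G by apply: measurable_funM => //; exact: measurable_funD.
have fineT (m : {measure set T -> \bar R}) : m setT < +oo -> m setT \is a fin_num.
  by move=> moo; rewrite ge0_fin_numE.
have E (m : {measure set T -> \bar R}) : m setT < +oo ->
    \int[m]_x (F x)%:E = (2 * M * fine (\int[m]_x (G x)%:E) - M * fine (m setT))%:E.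
  move=> moo.
  have iG : m.-integrable setT (EFin \o G).
    apply/integrableP; split; first exact/measurable_EFinP.
    apply: (@le_lt_trans _ _ (\int[m]_x 1)).
      apply: ge0_le_integral => //.
        by do 2 apply: measurableT_comp => //.
      by move=> x _ /=; have /andP[? ?] := G01 x; rewrite ger0_norm// lee_fin.
    by rewrite integral_cst// mul1e.
  have fG := integrable_fin_num measurableT iG.
  have ic : m.-integrable setT (fun=> M%:E).
    apply/integrableP; split=> //=.
    by rewrite integral_cst// lte_mul_pinfty ?lee_fin.
  have -> : (fun x => (F x)%:E) = (fun x => (2 * M)%:E * (G x)%:E - M%:E).
    apply/funext => x; rewrite -EFinM -EFinB; congr EFin.
    by rewrite /G mulrC divfK ?addrK// mulf_neq0// gt_eqF.
  rewrite integralB//; last exact: integrableZl.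
  rewrite integralZl// integral_cst// EFinB !EFinM !fineK// fineT//.
rewrite E//; under eq_fun do rewrite E//.
apply: cvg_EFin; first exact: nearW.
apply: cvgB; apply: cvgMr; last exact: munu.
exact: setwise_integral_cvg.
Qed.

End bounded_convergence.

(** * Conditional laws and their limits *)

Section conditional_laws.
Context {R : realType} (p : probability nat R).
Variable P : R.-pker (measurableTypeR R) ~> (measurableTypeR R).
Context d (Omega : measurableType d).
Variables (nchild : seq nat -> Omega -> nat) (pos : seq nat -> Omega -> R).
Variable Pr : pmeasure0 R -> probability Omega R.
Hypothesis hZ : branching_markov_chain p P nchild pos Pr.
Local Open Scope ereal_scope.
Local Notation plist := (plist R).
Local Notation Z := (positions nchild pos).
Local Notation nonnil := (~` [set ([::] : plist)]).
Local Notation pm0 := (@pm0 R).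

Let mnonnil : measurable (nonnil : set plist).
Proof. by apply: measurableC; exact: measurable_set_nil. Qed.

Let mZ n : measurable_fun setT (Z n).
Proof. exact: (measurable_positions (measurable_nchild hZ) (measurable_pos hZ)). Qed.

Let mpZ n : measurable_fun setT (pm0 \o Z n : Omega -> borel_pmeasure0 R).
Proof. exact: (measurableT_comp (@measurable_pm0 R) (mZ n)). Qed.

Lemma initial_size mu : exists2 k, (0 < k)%N & {ae Pr mu, forall w, size (Z 0%N w) = k}.
Proof.
exists (pcount (pmeasure0_val mu) setT).
  rewrite lt0n; apply/negP => /eqP k0; have /negP := set_valP mu; apply.
  by apply/eqP; have := pcountE (pmeasure0_val mu) measurableT; rewrite k0.
have := initial_state hZ mu; apply: filterS => w /(_ setT measurableT).
rewrite (pcountE (pmeasure0_val mu) measurableT) /population pmeasure_of_seqT => -[].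
by move/eqP; rewrite eqr_nat => /eqP.
Qed.

Lemma aliveE n : alive nchild pos n = Z n @^-1` nonnil.
Proof.
apply/seteqP; split => w; rewrite /alive /= /population pmeasure_of_seqT lte_fin ltr0n.
  by move=> + w0; rewrite -[[seq _ | _ <- _]]/(Z n w) w0.
by move=> w0; rewrite lt0n size_eq0; exact/eqP.
Qed.

Lemma measurable_alive n : measurable (alive nchild pos n).
Proof. by rewrite aliveE -[X in measurable X]setTI; exact: mZ. Qed.

Lemma positions_nil n l w : Z n w = [::] -> Z (n + l) w = [::].
Proof.
move=> zn; suff : generation nchild (n + l) w = [::].
  by rewrite /positions => ->.
have {}zn : generation nchild n w = [::].
  by move: zn => /(congr1 size)/eqP; rewrite size_map size_eq0 => /eqP.
elim: l => [|l ih]; first by rewrite addn0.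
by rewrite addnS /generation iterS -/(generation nchild (n + l) w) ih.
Qed.

(** Survival up to [n + l] forces [Z n] to be nonempty, so the population is the point [pm0 (Z n)],
    and the direct image of [A] becomes a preimage under a measurable map. *)
Lemma conditioned_event n l (A : set (borel_pmeasure0 R)) :
  alive nchild pos (n + l) `&` population nchild pos n @^-1` (@pmeasure0_val R @` A) =
  (pm0 \o Z n) @^-1` A `&` alive nchild pos (n + l).
Proof.
rewrite setIC aliveE; apply/seteqP; split => w [/=].
  move=> [nu Anu nuE] w0; split => //.
  rewrite (_ : pm0 _ = nu)//; apply: val_inj.
  rewrite -[val _]/(pmeasure0_val _) pm0E; first exact: (esym nuE).
  by apply/eqP => /(@positions_nil n l).
move=> Aw w0; split => //; exists (pm0 (Z n w)) => //.
by rewrite pm0E//; apply/eqP => /(@positions_nil n l).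
Qed.

(* When [alive (n + l)] is null, the quotient may be [+oo] on non-measurable sets,
   so it cannot be identified with a restricted measure. *)
Lemma cond_law_measure mu n l : exists M : {measure set (borel_pmeasure0 R) -> \bar R},
  [/\ cond_law nchild pos Pr mu n (n + l) = M,
      M setT < +oo &
      forall A, measurable A -> M A = ((fine (Pr mu (alive nchild pos (n + l))))^-1)%:E *
        Pr mu (Z n @^-1` (pm0 @^-1` A) `&` Z (n + l) @^-1` nonnil)].
Proof.
have ma := measurable_alive (n + l).
set f := cond_law nchild pos Pr mu n (n + l).
set y := Pr mu (alive nchild pos (n + l)).
have yfin : y \is a fin_num by exact: prob_fin_num.
have r0 : (0 <= (fine y)^-1)%R by rewrite invr_ge0 fine_ge0// measure_ge0.
pose g1 : {measure set (borel_pmeasure0 R) -> \bar R} := mscale (NngNum r0)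
  (pushforward (mrestr (Pr mu) ma) (pm0 \o Z n : Omega -> borel_pmeasure0 R)).
pose g : {measure set (borel_pmeasure0 R) -> \bar R} := g1 (mpZ n).
have gE A : g A =
  ((fine y)^-1)%:E * Pr mu ((pm0 \o Z n) @^-1` A `&` alive nchild pos (n + l)) by [].
have fg A : measurable A -> f A = g A.
  move=> mA; rewrite gE /f /cond_law conditioned_event -/y.
  have mA' : measurable ((pm0 \o Z n) @^-1` A).
    by rewrite -[X in measurable X]setTI; exact: mpZ.
  set x := Pr mu _.
  (* If the conditioning event is null, the numerator vanishes too, and the quotient is [0] whatever
     the conventional inverse of [0]. *)
  have [y0|y0] := eqVneq (fine y) 0%R; last by rewrite -(fineK yfin) inver (negbTE y0) muleC.
  rewrite y0 invr0 mul0e; suff -> : x = 0 by rewrite mul0e.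
  apply/eqP; rewrite eq_le measure_ge0 andbT -[leRHS](_ : y = 0); last by rewrite -(fineK yfin) y0.
  by apply: le_measure; rewrite ?inE//; exact: measurableI.
have f0 : f set0 = 0.
  by rewrite fg; [exact: (measure0 g)|exact: measurable0].
have f_ge0 A : 0 <= f A.
  by rewrite /f /cond_law mule_ge0 ?inve_ge0.
have f_add : semi_sigma_additive f.
  move=> F mF tF mUF; rewrite fg//.
  under eq_fun do under eq_bigr do rewrite fg//.
  exact: measure_semi_sigma_additive.
pose M := isMeasure.Build _ _ _ f f0 f_ge0 f_add.
exists (HB.pack_for (Measure.type (borel_pmeasure0 R) R) f M); split => //.
- rewrite /= fg// gE lte_mul_pinfty ?lee_fin// ltey_eq prob_fin_num//.
  by apply: measurableI => //; rewrite preimage_setT.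
- by move=> A mA /=; rewrite fg// gE aliveE.
Qed.

End conditional_laws.

Section limit_law.
Context {R : realType} (p : probability nat R).
Variable P : R.-pker (measurableTypeR R) ~> (measurableTypeR R).
Context d (Omega : measurableType d).
Variables (nchild : seq nat -> Omega -> nat) (pos : seq nat -> Omega -> R).
Variable Pr : pmeasure0 R -> probability Omega R.
Hypothesis hZ : branching_markov_chain p P nchild pos Pr.
Local Open Scope ereal_scope.
Local Notation RR := (measurableTypeR R).
Local Notation plist := (plist R).
Local Notation Z := (positions nchild pos).
Local Notation gl := (generation_law p P).
Local Notation nonnil := (~` [set ([::] : plist)]).
Local Notation pm0 := (@pm0 R).
Local Notation borel := (borel_pmeasure0 R).
Variables (m M2 : R).
Hypothesis pm : \int[p]_j j%:R%:E = m%:E.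
Hypothesis pM2 : \int[p]_j (j%:R ^+ 2)%:E = M2%:E.
Hypotheses (m0 : (0 < m)%R) (m1 : (m < 1)%R).
Variable pi : probability RR R.
Hypothesis Ppi : forall (x : R) (h : R -> R), Bbp h ->
  \int[nstep P n x]_y (h y)%:E @[n --> \oo] --> \int[pi]_y (h y)%:E.
Local Notation lam A := (limn (scaled_stationary p P m pi A)).
Variable c : {measure set plist -> \bar R}.
Hypothesis cE : forall A, measurable A -> c A = (lam (A `\ ([::] : plist)))%:E.

Let kap l : R := (m ^+ l * lam nonnil)%R.

Let kap_gt0 l : (0 < kap l)%R.
Proof. by rewrite mulr_gt0 ?exprn_gt0// (nonnil_mass_gt0 pm pM2 m0 m1 Ppi). Qed.

Let mnonnil : measurable (nonnil : set plist).
Proof. by apply: measurableC; exact: measurable_set_nil. Qed.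

Let mpm0 (A : set borel) : measurable A -> measurable (pm0 @^-1` A : set plist).
Proof. by move=> mA; rewrite -[X in measurable X]setTI; apply: measurable_pm0. Qed.

Let mgl l : measurable_fun setT (fun s : plist => gl l s nonnil).
Proof. exact: measurable_generation_law_ev. Qed.

(** The statement does not mention the chain, but [survival_mass] needs one: it is started from the
    arbitrary point measure [point]. *)
Lemma limit_mass l : \int[c]_s gl l s nonnil = (kap l)%:E.
Proof.
have [k k0 Zk] := initial_size hZ point.
rewrite /kap -(survival_mass pm pM2 m0 m1 Ppi cE (measurable_nchild hZ) (measurable_pos hZ)
  (branching_step hZ point) Zk l k0) fineK// ge0_fin_numE; last exact: integral_ge0.
apply: (@le_lt_trans _ _ (\int[c]_s 1)).
  by apply: ge0_le_integral => // s _; exact: generation_law_le1.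
by rewrite integral_cst// mul1e cE// ltry.
Qed.

(** The density vanishes at the empty list, so the junk value of [pm0] there does not contribute. *)
Lemma limit_law_exists l : exists Q : probability borel R, forall A, measurable A ->
  Q A = ((kap l)^-1)%:E * \int[c]_(s in pm0 @^-1` A) gl l s nonnil.
Proof.
pose f (A : set borel) := ((kap l)^-1)%:E * \int[c]_(s in pm0 @^-1` A) gl l s nonnil.
have f0 : f set0 = 0 by rewrite /f preimage_set0 integral_set0 mule0.
have k0 : 0 <= ((kap l)^-1)%:E by rewrite lee_fin invr_ge0 ltW.
have f_ge0 A : 0 <= f A by rewrite /f mule_ge0// integral_ge0.
have f_add : semi_sigma_additive f.
  move=> F mF tF mUF; rewrite /f preimage_bigcup ge0_integral_bigcup//.
  - rewrite -nneseriesZl//; last by move=> n _; exact: integral_ge0.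
    by apply: is_cvg_nneseries => n _ _; exact: f_ge0.
  - by move=> n; exact: mpm0.
  - exact: measurable_funTS.
  - apply/trivIsetP => i j _ _ ij; rewrite -preimage_setI.
    by have /trivIsetP -> := tF; rewrite ?preimage_set0.
pose M := isMeasure.Build _ _ _ f f0 f_ge0 f_add.
pose Mf : {measure set borel -> \bar R} := HB.pack_for (Measure.type borel R) f M.
have fT : Mf setT = 1.
  by rewrite /= /f preimage_setT limit_mass -EFinM mulVf// gt_eqF.
pose Mp := Measure_isProbability.Build _ _ _ Mf fT.
by exists (HB.pack_for (probability borel R) (Measure.sort Mf) Mp).
Qed.

(** Numerator and denominator are both divided by [m ^ n]; the number [k] of ancestors, the only
    trace of [mu] in the limits, cancels in the quotient. *)
Lemma cond_law_setwise_cvg l (mu : pmeasure0 R) (A : set borel) : measurable A ->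
  (fine ((((fine (Pr mu (alive nchild pos (n + l))))^-1)%:E *
     Pr mu (Z n @^-1` (pm0 @^-1` A) `&` Z (n + l) @^-1` nonnil)))) @[n --> \oo] -->
  fine (((kap l)^-1)%:E * \int[c]_(s in pm0 @^-1` A) gl l s nonnil).
Proof.
move=> mA; have [k k0 Zk] := initial_size hZ mu.
have sc B (mB : measurable B) := survival_cvg pm pM2 m0 m1 Ppi cE
  (measurable_nchild hZ) (measurable_pos hZ) (branching_step hZ mu) Zk (l := l) mB.
have hA := sc _ (mpm0 mA); have hT := sc _ measurableT.
rewrite limit_mass//= in hT.
have kk0 : (k%:R * kap l != 0 :> R)%R by rewrite mulf_neq0 ?pnatr_eq0 -?lt0n// gt_eqF.
have := cvgM (cvgV kk0 hT) hA.
have -> : ((k%:R * kap l)^-1 * (k%:R * fine (\int[c]_(s in pm0 @^-1` A) gl l s nonnil)))%R =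
   fine (((kap l)^-1)%:E * \int[c]_(s in pm0 @^-1` A) gl l s nonnil).
  rewrite fine_scale; last by rewrite invr_ge0 ltW.
  by rewrite invfM mulrACA mulVf ?mul1r// pnatr_eq0 -lt0n.
move=> hcv; rewrite (_ : (fun n => fine _) = (fun n =>
   ((fine (Pr mu (Z n @^-1` setT `&` Z (n + l) @^-1` nonnil)) / m ^+ n)^-1 *
   (fine (Pr mu (Z n @^-1` (pm0 @^-1` A) `&` Z (n + l) @^-1` nonnil)) / m ^+ n))%R)).
  exact: hcv.
apply/funext => n; rewrite [LHS]fine_scale; last by rewrite invr_ge0 fine_ge0.
rewrite aliveE preimage_setT setTI invf_div [RHS]mulrC mulrA divfK 1?mulrC//.
by rewrite expf_neq0// gt_eqF.
Qed.

End limit_law.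

Lemma measurable_expeR {R : realType} : measurable_fun setT (@expeR R).
Proof.
rewrite (_ : @expeR R = fun x => maxe 0%E (er_map expR x)).
  apply: measurable_maxe; first exact: measurable_cst.
  exact: (@measurable_er_map _ (measurableTypeR R) R expR (@measurable_expR R)).
apply/funext => -[r| |] /=; first by apply/esym/max_idPr; rewrite lee_fin expR_ge0.
  by apply/esym/max_idPr.
by apply/esym/max_idPl; rewrite leNye.
Qed.

(** * Laplace functionals *)

Section laplace_functional.
Context {R : realType}.
Local Open Scope ereal_scope.
Local Notation plist := (plist R).
Local Notation borel := (borel_pmeasure0 R).
Local Notation pval := (@pmeasure0_val R).

Lemma ge0_integral_quantiles (nu : pmeasure0 R) (h : measurableTypeR R -> \bar R) :
  measurable_fun setT h -> (forall x, 0 <= h x) ->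
  \int[pval nu]_x h x = \sum_(x <- point_quantiles nu) h x.
Proof.
move=> mh h0; rewrite -ge0_integral_pmeasure_of_seq//.
by apply: eq_measure_integral => A mA _; exact: pmeasure_of_quantiles.
Qed.

Lemma measurable_laplace (h : measurableTypeR R -> \bar R) :
  measurable_fun setT h -> (forall x, 0 <= h x) ->
  measurable_fun setT (fun nu : borel => expeR (- \int[pval nu]_x h x)).
Proof.
move=> mh h0.
rewrite (_ : (fun _ => _) = (fun nu => expeR (- \sum_(x <- point_quantiles nu) h x))); last first.
  by apply/funext => nu; rewrite ge0_integral_quantiles.
apply: (measurableT_comp measurable_expeR); apply: measurableT_comp => //.
by apply: measurable_sum_list => //; exact: measurable_point_quantiles.
Qed.

End laplace_functional.

Section survival_limits.
Context {R : realType} (p : probability nat R).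
Variable P : R.-pker (measurableTypeR R) ~> (measurableTypeR R).
Context d (Omega : measurableType d).
Variables (nchild : seq nat -> Omega -> nat) (pos : seq nat -> Omega -> R).
Variable Pr : pmeasure0 R -> probability Omega R.
Hypothesis hZ : branching_markov_chain p P nchild pos Pr.
Local Open Scope ereal_scope.
Local Notation RR := (measurableTypeR R).
Local Notation plist := (plist R).
Local Notation Z := (positions nchild pos).
Local Notation gl := (generation_law p P).
Local Notation nonnil := (~` [set ([::] : plist)]).
Local Notation pm0 := (@pm0 R).
Local Notation borel := (borel_pmeasure0 R).
Local Notation pval := (@pmeasure0_val R).
Variables (m M2 : R).
Hypothesis pm : \int[p]_j j%:R%:E = m%:E.
Hypothesis pM2 : \int[p]_j (j%:R ^+ 2)%:E = M2%:E.
Hypotheses (m0 : (0 < m)%R) (m1 : (m < 1)%R).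
Variable pi : probability RR R.
Hypothesis Ppi : forall (x : R) (h : R -> R), Bbp h ->
  \int[nstep P n x]_y (h y)%:E @[n --> \oo] --> \int[pi]_y (h y)%:E.
Local Notation lam A := (limn (scaled_stationary p P m pi A)).
Variable c : {measure set plist -> \bar R}.
Hypothesis cE : forall A, measurable A -> c A = (lam (A `\ ([::] : plist)))%:E.

Let kap l : R := (m ^+ l * lam nonnil)%R.

Let kap_gt0 l : (0 < kap l)%R.
Proof. by rewrite mulr_gt0 ?exprn_gt0// (nonnil_mass_gt0 pm pM2 m0 m1 Ppi). Qed.

Let mnonnil : measurable (nonnil : set plist).
Proof. by apply: measurableC; exact: measurable_set_nil. Qed.

Let mgl l : measurable_fun setT (fun s : plist => gl l s nonnil).
Proof. exact: measurable_generation_law_ev. Qed.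

Let mpm0 (A : set borel) : measurable A -> measurable (pm0 @^-1` A : set plist).
Proof. by move=> mA; rewrite -[X in measurable X]setTI; apply: measurable_pm0. Qed.

Definition survival_limit l (Q : probability borel R) := forall A, measurable A ->
  Q A = ((kap l)^-1)%:E * \int[c]_(s in pm0 @^-1` A) gl l s nonnil.

Lemma survival_limit_weak l Q : survival_limit l Q ->
  future_survival_limit nchild pos Pr l Q.
Proof.
move=> QE mu F cF bF.
have /choice[M hM] := fun n => cond_law_measure hZ mu n l.
have -> : (fun n => \int[cond_law nchild pos Pr mu n (n + l)]_nu (F nu)%:E) =
    (fun n => \int[M n]_nu (F nu)%:E).
  by apply/funext => n; have [-> _ _] := hM n.
apply: setwise_bounded_integral_cvg => //.
- by move=> n; have [] := hM n.
- exact: (le_lt_trans (probability_le1 Q measurableT) (ltry _)).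
- move=> A mA.
  have -> : (fun n => fine (M n A)) = (fun n =>
     fine (((fine (Pr mu (alive nchild pos (n + l))))^-1)%:E *
     Pr mu (Z n @^-1` (pm0 @^-1` A) `&` Z (n + l) @^-1` nonnil))).
    by apply/funext => n; have [_ _ ->] := hM n.
  have hcv := cond_law_setwise_cvg hZ pm pM2 m0 m1 Ppi cE (l := l) mu mA.
  by rewrite -/(kap l) -(QE A mA) in hcv.
- exact: measurable_continuous_borel.
Qed.

Lemma future_survival_limit_unique l (Q Q' : probability borel R) :
  future_survival_limit nchild pos Pr l Q -> future_survival_limit nchild pos Pr l Q' ->
  forall A, measurable A -> Q A = Q' A.
Proof.
move=> hQ hQ'; apply: probability_weak_unique => F cF bF.
exact: (cvg_unique _ (hQ point F cF bF) (hQ' point F cF bF)).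
Qed.

Lemma laplace_survival_limit l (Q : probability borel R) (h : RR -> \bar R) :
  survival_limit l Q -> measurable_fun setT h -> (forall x, 0 <= h x) ->
  laplace Q h = ((kap l)^-1)%:E *
    \int[c]_s (expeR (- \sum_(x <- s) h x) * gl l s nonnil).
Proof.
move=> QE mh h0.
have k0 : (0 <= (kap l)^-1)%R by rewrite invr_ge0 ltW.
have mf := measurable_laplace mh h0.
have ex0 (s : plist) : 0 <= expeR (- \sum_(x <- s) h x) by exact: expeR_ge0.
have mE : measurable_fun setT (fun s : plist => expeR (- \sum_(x <- s) h x)).
  apply: (measurableT_comp measurable_expeR); apply: measurableT_comp => //.
  exact: measurable_sum_list.
rewrite /laplace; transitivity
    (\int[c]_s (expeR (- \int[pval (pm0 s)]_x h x) * (((kap l)^-1)%:E * gl l s nonnil))).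
  apply: (@integral_pushforward_density _ _ plist borel R c Q pm0
    (fun s => ((kap l)^-1)%:E * gl l s nonnil) _ (@measurable_pm0 R)) => //.
  - exact: emeasurable_funM.
  - by move=> s; rewrite mule_ge0.
  - by move=> s; rewrite fin_numM// generation_law_fin_num.
  - move=> A mA; apply: (etrans (QE A mA)); rewrite ge0_integralZl//; first exact: mpm0.
    exact: measurable_funTS.
  - by move=> nu; exact: expeR_ge0.
rewrite -ge0_integralZl//.
- apply: eq_integral => s _; rewrite muleCA.
  (* At the empty list [pm0] is junk, but the density is [0]. *)
  have [->|s0] := eqVneq s [::].
    by rewrite generation_law_nonnil expr0 subrr !mule0.
  by rewrite pm0E// ge0_integral_pmeasure_of_seq.
- exact: emeasurable_funM.
- by move=> s _; rewrite mule_ge0.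
Qed.

End survival_limits.

Section laplace_identity.
Context {R : realType}.
Local Open Scope ereal_scope.

Lemma expeR_sum (h : R -> R) (s : seq R) :
  expeR (- \sum_(x <- s) (h x)%:E) = (expR (- \sum_(x <- s) h x))%:E.
Proof. by rewrite sumEFin. Qed.

(** The case [a = 0] is included: then [lne 0 = -oo], and both sides vanish unless [s] is empty,
    where both equal [1]. For [l = 0] this realises the convention on the infinite argument. *)
Lemma expeR_sum_shift (h : R -> R) (a : R) (s : seq R) : (0 <= a <= 1)%R ->
  (forall x, (0 <= h x)%R) ->
  expeR (- \sum_(x <- s) ((h x)%:E - lne a%:E)) =
  (expR (- \sum_(x <- s) h x) * a ^+ size s)%:E.
Proof.
move=> /andP[a0 a1] h0.
have la : 0 <= - lne a%:E by rewrite oppe_ge0 lne_le0 lee_fin.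
have hl x : 0 <= (h x)%:E - lne a%:E by rewrite adde_ge0// lee_fin.
elim: s => [|x s ih]; first by rewrite !big_nil oppe0 oppr0 expeR0 expR0 mul1r expr0.
rewrite !big_cons oppeD; last by apply: ge0_adde_def; rewrite inE// sume_ge0.
have la' : expeR (lne a%:E) = a%:E by apply/eqP; rewrite lneK_eq lee_fin.
rewrite expeRD ih [((h x)%:E + _)%E]addeC fin_num_oppeD// oppeK expeRD la' /= opprD expRD.
rewrite exprS -!EFinM.
by congr EFin; ring.
Qed.

End laplace_identity.

Section survival_laplace.
Context {R : realType} (p : probability nat R).
Variable P : R.-pker (measurableTypeR R) ~> (measurableTypeR R).
Local Open Scope ereal_scope.
Local Notation RR := (measurableTypeR R).
Local Notation plist := (plist R).
Local Notation gl := (generation_law p P).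
Local Notation nonnil := (~` [set ([::] : plist)]).
Local Notation borel := (borel_pmeasure0 R).
Variables (m M2 : R).
Hypothesis pm : \int[p]_j j%:R%:E = m%:E.
Hypothesis pM2 : \int[p]_j (j%:R ^+ 2)%:E = M2%:E.
Hypotheses (m0 : (0 < m)%R) (m1 : (m < 1)%R).
Variable pi : probability RR R.
Hypothesis Ppi : forall (x : R) (h : R -> R), Bbp h ->
  \int[nstep P n x]_y (h y)%:E @[n --> \oo] --> \int[pi]_y (h y)%:E.
Local Notation lam A := (limn (scaled_stationary p P m pi A)).
Variable c : {measure set plist -> \bar R}.
Hypothesis cE : forall A, measurable A -> c A = (lam (A `\ ([::] : plist)))%:E.

(** The survival densities are [1 - a ^ |s|] for [Q] and [1 - 0 ^ |s|], the indicator of nonempty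
    lists, for [Q0]; shifting by [- log a] inserts [a ^ |s|]. The identity already holds between
    integrands, and the normalising constants differ by the factor [m ^ l]. *)
Lemma laplace_survival_limit_diff l (Q Q0 : probability borel R) (h : R -> R) :
  survival_limit p P m pi c l Q -> survival_limit p P m pi c 0 Q0 -> Bbp h ->
  laplace Q (fun x => (h x)%:E) =
  (laplace Q0 (fun x => (h x)%:E) -
   laplace Q0 (fun x => (h x)%:E - lne (genfun_iter p l 0)%:E)) / (m ^+ l)%:E.
Proof.
move=> QE Q0E [mh h0 _].
set a := genfun_iter p l 0.
have a01 : (0 <= a <= 1)%R by exact: genfun_iter01.
have /andP[a0 a1] := a01.
have ml0 : (0 < m ^+ l)%R by rewrite exprn_gt0.
have l0 : (0 < lam nonnil)%R := nonnil_mass_gt0 pm pM2 m0 m1 Ppi.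
have mhE : measurable_fun setT (EFin \o h : RR -> \bar R) by exact/measurable_EFinP.
have hE0 x : 0 <= (h x)%:E by rewrite lee_fin.
have mha : measurable_fun setT ((fun x => (h x)%:E - lne a%:E) : RR -> \bar R).
  by apply: emeasurable_funB => //; exact: measurable_cst.
have ha0 x : 0 <= (h x)%:E - lne a%:E.
  by rewrite adde_ge0// oppe_ge0 lne_le0 lee_fin.
rewrite !(laplace_survival_limit pm pM2 m0 m1 Ppi QE)//.
rewrite !(laplace_survival_limit pm pM2 m0 m1 Ppi Q0E)//.
pose E (s : plist) : R := expR (- \sum_(x <- s) h x).
(* [F3] is the integrand for [Q], [F2] that of the shifted functional of [Q0], and their sum that of
   the unshifted one. *)
pose F2 s : R := (E s * a ^+ size s * (1 - 0 ^+ size s))%R.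
pose F3 s : R := (E s * (1 - a ^+ size s))%R.
have -> : \int[c]_s (expeR (- \sum_(x <- s) (h x)%:E) * gl l s nonnil) = \int[c]_s (F3 s)%:E.
  by apply: eq_integral => s _; rewrite expeR_sum generation_law_nonnil -EFinM.
have -> : \int[c]_s (expeR (- \sum_(x <- s) ((h x)%:E - lne a%:E)) * gl 0%N s nonnil) =
    \int[c]_s (F2 s)%:E.
  by apply: eq_integral => s _; rewrite expeR_sum_shift// generation_law_nonnil -EFinM.
have -> : \int[c]_s (expeR (- \sum_(x <- s) (h x)%:E) * gl 0%N s nonnil) =
    \int[c]_s ((F2 s)%:E + (F3 s)%:E).
  apply: eq_integral => s _; rewrite expeR_sum generation_law_nonnil -EFinM -EFinD.
  congr EFin; rewrite /F2 /F3 -/(E s); case: s => [|x s].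
    by rewrite /= !expr0 subrr !mulr0 addr0.
  by rewrite /= expr0n/= subr0 !mulr1; ring.
have mS (f : nat -> R) : measurable_fun setT (fun s : plist => (f (size s))%:E).
  exact: (measurable_fun_size (fun n => (f n)%:E)).
have mE : measurable_fun setT (fun s : plist => (E s)%:E).
  rewrite (_ : (fun _ => _) = (fun s : plist => expeR (- \sum_(x <- s) (h x)%:E))).
    apply: (measurableT_comp measurable_expeR); apply: measurableT_comp => //.
    exact: measurable_sum_list.
  by apply/funext => s; rewrite expeR_sum.
have E0 s : (0 <= E s)%R by exact: expR_ge0.
have E1 s : (E s <= 1)%R.
  by rewrite /E -expR0 ler_expR oppr_le0 sumr_ge0.
have z0 : (0 <= (0 : R) <= 1)%R by rewrite lexx ler01.
have z01 n (b : R) : (0 <= b <= 1 -> 0 <= b ^+ n <= 1)%R.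
  by move=> /andP[b0 b1]; rewrite exprn_ge0// exprn_ile1.
have F20 s : 0 <= (F2 s)%:E.
  rewrite lee_fin /F2 !mulr_ge0 ?exprn_ge0// subr_ge0.
  by case/andP: (z01 (size s) 0%R z0).
have F30 s : 0 <= (F3 s)%:E.
  by rewrite lee_fin /F3 mulr_ge0// subr_ge0; have /andP[] := z01 (size s) a a01.
have mF2 : measurable_fun setT (fun s : plist => (F2 s)%:E).
  rewrite (_ : (fun _ => _) = (fun s : plist => (E s)%:E * (a ^+ size s * (1 - 0 ^+ size s))%:E)).
    by apply: emeasurable_funM => //; exact: (mS (fun n => a ^+ n * (1 - 0 ^+ n))%R).
  by apply/funext => s; rewrite -EFinM mulrA.
have mF3 : measurable_fun setT (fun s : plist => (F3 s)%:E).
  rewrite (_ : (fun _ => _) = (fun s : plist => (E s)%:E * (1 - a ^+ size s)%:E)).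
    by apply: emeasurable_funM => //; exact: (mS (fun n => 1 - a ^+ n)%R).
  by apply/funext => s; rewrite -EFinM.
rewrite ge0_integralD//.
(* Finiteness of the integrals is required to subtract in the extended reals. *)
have fin (F : plist -> R) : measurable_fun setT (EFin \o F) -> (forall s, 0 <= (F s)%:E) ->
    (forall s, (F s <= 1)%R) -> \int[c]_s (F s)%:E \is a fin_num.
  move=> mF F0 F1; rewrite ge0_fin_numE; last exact: integral_ge0.
  apply: (@le_lt_trans _ _ (\int[c]_s 1)).
    by apply: ge0_le_integral => // s _; rewrite lee_fin.
  by rewrite integral_cst// mul1e cE// ltry.
have F21 s : (F2 s <= 1)%R.
  have /andP[? ?] := z01 (size s) a a01.
  have /andP[? ?] := z01 (size s) 0%R z0.
  by rewrite /F2 !mulr_ile1 ?mulr_ge0// ?subr_ge0// gerBl.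
have F31 s : (F3 s <= 1)%R.
  have /andP[? ?] := z01 (size s) a a01.
  by rewrite /F3 mulr_ile1 ?subr_ge0// gerBl.
rewrite -(fineK (fin F2 mF2 F20 F21)) -(fineK (fin F3 mF3 F30 F31)).
rewrite -EFinD -!EFinM inver gt_eqF// -EFinM; congr EFin.
by rewrite expr0 mul1r; field; rewrite !gt_eqF.
Qed.

End survival_laplace.

Theorem corollary2p9 (R : realType) (p : probability nat R)
    (P : R.-pker (measurableTypeR R) ~> (measurableTypeR R))
    (d : measure_display) (Omega : measurableType d)
    (nchild : seq nat -> Omega -> nat) (pos : seq nat -> Omega -> R)
    (Pr : pmeasure0 R -> probability Omega R)
    (hZ : branching_markov_chain p P nchild pos Pr)
    (hC1 : condC1 p) (hC2 : condC2 p) (hC3 : condC3 P) (l : nat) :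
  exists Ql : probability (borel_pmeasure0 R) R,
  [/\ future_survival_limit nchild pos Pr l Ql,
      forall Q : probability (borel_pmeasure0 R) R,
        future_survival_limit nchild pos Pr l Q ->
        forall A, measurable A -> Q A = Ql A &
      forall Qmin : probability (borel_pmeasure0 R) R,
        yaglom_limit nchild pos Pr Qmin ->
        forall h : R -> R, Bbp h ->
        laplace Ql (fun x => (h x)%:E) =
        ((laplace Qmin (fun x => (h x)%:E) -
          laplace Qmin (fun x => (h x)%:E - lne (genfun_iter p l 0)%:E)) /
         (fine (mean p) ^+ l)%:E)%E].
Proof.
have [mean0 mean1 moments] := hC1; have [pi Ppi] := hC3.
have mean_fin : mean p \is a fin_num.
  by rewrite ge0_fin_numE ?(lt_trans mean1) ?ltry// ltW.
have pm : (\int[p]_j j%:R%:E = (fine (mean p))%:E)%E.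
  by rewrite fineK// integral_offspring_mean.
have m0 : 0 < fine (mean p) by rewrite fine_gt0// mean0 (lt_trans mean1) ?ltry.
have m1 : fine (mean p) < 1 by rewrite -lte_fin fineK.
have M2fin : (\int[p]_j (j%:R ^+ 2)%:E \is a fin_num)%E.
  rewrite ge0_fin_numE; last by apply: integral_ge0 => j _; rewrite lee_fin exprn_ge0.
  rewrite integral_pmf => [|j]; last by rewrite lee_fin exprn_ge0.
  by under eq_eseriesr do rewrite -EFinM; exact: moments.
have pM2 := esym (fineK M2fin).
have [c cE] := yaglom_measure_exists pm pM2 m0 m1 Ppi.
have [Ql QlE] := limit_law_exists hZ pm pM2 m0 m1 Ppi cE l.
have [Q0 Q0E] := limit_law_exists hZ pm pM2 m0 m1 Ppi cE 0.
have Qlim := survival_limit_weak hZ pm pM2 m0 m1 Ppi cE QlE.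
exists Ql; split => // [Q hQ|Qmin hQmin h hB].
  exact: future_survival_limit_unique hQ Qlim.
(* A Yaglom limit is a future survival limit for [l = 0], so uniqueness identifies any [Qmin] with
   [Q0] on measurable sets, which are all that the Laplace functional sees. *)
have Qmin0 A : measurable A -> Qmin A = Q0 A.
  apply: (@future_survival_limit_unique _ _ _ nchild pos Pr 0).
    by move=> mu; have := hQmin mu; under [in X in _ -> X]eq_fun do rewrite addn0.
  exact: (survival_limit_weak hZ pm pM2 m0 m1 Ppi cE Q0E).
have lapE g : laplace Qmin g = laplace Q0 g.
  by apply: eq_measure_integral => A mA _; exact: Qmin0.
by rewrite !lapE; exact: (laplace_survival_limit_diff pm pM2 m0 m1 Ppi cE QlE Q0E hB).
Qed.
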